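(* Let $k\ge2$ and let $\Gamma$ be an irreducible finite Coxeter group of rank $k$ with geometric realisation $\Gamma\hookrightarrow O(k)$ as a Euclidean reflection group, with simple roots (unit normals) $n_1,\dots,n_k\in\mathbb{R}^k$, corresponding reflections $\sigma_1,\dots,\sigma_k$ and Schläfli matrix $N=(\langle n_i,n_j\rangle)_{i,j\in[k]}$, ordered such that $\det(n_1,\dots,n_k)>0$. Let $p_j=(-1)^{j-1}n_1\times\cdots\times\widehat{n}_j\times\cdots\times n_k$ for $j\in[k]$ and let $$\mathcal{F}_0=\Big\{p=\sum_{j=1}^k\alpha_jp_j\ \Big|\ p\in S^{k-1}(1),\ \alpha_1,\dots,\alpha_k>0\Big\}$$ be the open spherical fundamental domain of the $\Gamma$-action. For $w\in\mathcal{F}_0$ let $Q_w=\operatorname{conv}(\Gamma w)$ and let $\lambda_1(w)$ be the second largest eigenvalue of the random walk matrix $T(Q_w)$. Then the map $\lambda_1:\mathcal{F}_0\to[-1,1]$ has the property that $\lambda_1(w)\to1$ whenever $w\to\partial\mathcal{F}_0$, and $\lambda_1$ assumes a global minimum at a unique point $w_0\in\mathcal{F}_0$, given by $$w_0=\frac{\sum_{j=1}^kp_j}{\big\|\sum_{j=1}^kp_j\big\|},$$ that is, the corresponding coefficient vector $(\alpha_1,\dots,\alpha_k)$ is a constant vector. Moreover, the corresponding permutahedron $Q_{w_0}$ is equilateral (all its edges have the same length), and there is no other permutahedron $Q_w$ with $w\in\mathcal{F}_0$ which is equilateral.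
   Context: Coxeter setting: $\Gamma=\langle s_1,\dots,s_k\mid(s_is_j)^{m_{ij}}=e\rangle$ with $m_{ii}=1$, $m_{ij}=m_{ji}\ge2$ for $i\ne j$. In the geometric realisation $s_j$ acts as the reflection $\sigma_j(p)=p-2\langle p,n_j\rangle n_j$, where the unit normals $n_j$ of the mirrors are chosen so that $n_i,n_j$ ($i\neq j$) form an angle $\ge\pi/2$ (i.e. $\langle n_i,n_j\rangle=-\cos(\pi/m_{ij})$). $S^{k-1}(1)$ is the unit sphere centred at the origin, and $\partial\mathcal{F}_0$ is the boundary of $\mathcal{F}_0$ in it. The generalized vector product is determined by $\langle x,u_1\times\cdots\times u_{k-1}\rangle=\det(x,u_1,\dots,u_{k-1})$ for all $x\in\mathbb{R}^k$; a hat means omission. For $w\in\mathcal{F}_0$, $Q_w$ is called a permutahedron; it is a simple $k$-polytope containing the origin in its interior, and $\Gamma$ acts simply transitively on its vertices. Izmestiev's matrix: for a $k$-polytope $Q\subset\mathbb{R}^k$ with vertices $w_1,\dots,w_n$ and the origin in its interior, let $G$ be its vertex-edge graph on vertex set $[n]$ and $P=\{p\mid\langle p,w_s\rangle\le1\ \forall s\in[n]\}$ its polar dual. For an edge $st$ let $F_{st}$ be the ridge of $P$ that is the intersection of the facets of $P$ with outer normals $w_s,w_t$, and $\theta_{st}$ the dihedral angle of $P$ at $F_{st}$. $M(Q)\in\mathbb{R}^{n\times n}$ has entries $M_{st}=-\frac{\operatorname{vol}_{k-2}(F_{st})}{\|w_s\|\|w_t\|\sin\theta_{st}}$ if $st$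 is an edge, $M_{st}=0$ if $s\ne t$ and $st$ is not an edge, and $M_{ss}$ determined by $M_{ss}w_s=-\sum_{t\ne s}M_{st}w_t$. Izmestiev proved (known background) that $M(Q)$ is well defined, symmetric, of corank $k$, with exactly one negative eigenvalue, which is simple. Random walk matrix: if a finite subgroup of $O(k)$ preserving $Q$ acts transitively on its vertices, all diagonal entries of $M=M(Q)$ equal a constant $\gamma$ and all row sums equal a constant $\delta<\gamma$; then $T(Q)=\frac{1}{\gamma-\delta}(\gamma\,\mathrm{Id}-M)$, a symmetric doubly stochastic matrix with largest eigenvalue $1$. *)

(* Defs.v *)
From HB Require Import structures.
From mathcomp Require Import all_boot all_order all_algebra all_fingroup.
From mathcomp Require Import all_character finmap.
From mathcomp Require Import all_classical all_reals all_analysis.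
Set Implicit Arguments.
Unset Strict Implicit.
Unset Printing Implicit Defensive.
Import Order.TTheory GRing.Theory Num.Theory.
Import numFieldNormedType.Exports.
Local Open Scope classical_set_scope.
Local Open Scope ring_scope.

(* Points of R^k are row vectors.  The library norm on 'rV[R]_k is the sup norm,
   so the Euclidean structure is introduced separately; both norms induce the
   topology of 'rV[R]_k. *)
Section Euclidean.
Context {R : realType} {k : nat}.
Implicit Types (x u v c : 'rV[R]_k) (A : set 'rV[R]_k).

Definition dot u v : R := (u *m v^T) 0 0.

Definition enorm u : R := Num.sqrt (dot u u).

Definition sphere : set 'rV[R]_k := [set u | enorm u = 1].

Definition boundary_in (S A : set 'rV[R]_k) : set 'rV[R]_k :=
  S `&` closure A `&` closure (S `\` A).

Definition rows (us : seq 'rV[R]_k) : 'M[R]_k := \matrix_(i < k) nth 0 us i.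

(* Generalized vector product of a list of k - 1 vectors of R^k; see dot_cross. *)
Definition cross (us : seq 'rV[R]_k) : 'rV[R]_k :=
  \row_j \det (rows (delta_mx 0 j :: us)).

Definition hull A : set 'rV[R]_k :=
  [set x | exists (n : nat) (a : 'I_n -> R) (v : 'I_n -> 'rV[R]_k),
     [/\ forall i, 0 <= a i, \sum_i a i = 1, forall i, A (v i)
       & x = \sum_i a i *: v i]].

End Euclidean.

Lemma dot_cross (R : realType) (k : nat) (x : 'rV[R]_k.+1)
    (us : seq 'rV[R]_k.+1) :
  dot x (cross us) = \det (rows (x :: us)).
Proof.
rewrite (expand_det_row _ ord0) /dot mxE; apply: eq_bigr => j _.
rewrite !mxE /=; congr (_ * _).
rewrite (expand_det_row _ ord0) (bigD1 j) //= big1 ?addr0 => [|i ij].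
  rewrite !mxE /= !eqxx mul1r /cofactor; congr (_ * \det _).
  by apply/matrixP => a b; rewrite !mxE.
by rewrite !mxE /= (negPf ij) mul0r.
Qed.

Section Volume.
Context {R : realType}.

(* Iterated product of the one-dimensional Lebesgue measure, in the way the
   library's product measure integrates the measures of sections. *)
Fixpoint lebesgue_vol (d : nat) : set 'rV[R]_d -> \bar R :=
  match d with
  | 0%N => fun A => (\1_A (0 : 'rV[R]_0))%:E
  | d'.+1 => fun A =>
      (\int[@lebesgue_measure R]_x
         lebesgue_vol [set u : 'rV[R]_d' | A (row_mx (x : R)%:M u)])%E
  end.

Definition affine_map {d k : nat} (c : 'rV[R]_k * 'M[R]_(d, k))
    (u : 'rV[R]_d) : 'rV[R]_k := c.1 + u *m c.2.

(* An isometric parametrisation of a d-plane containing F. *)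
Definition is_chart {d k : nat} (F : set 'rV[R]_k)
    (c : 'rV[R]_k * 'M[R]_(d, k)) : Prop :=
  c.2 *m c.2^T = 1%:M /\ F `<=` range (affine_map c).

(* Meaningful when F lies in a d-plane; it then does not depend on the chart. *)
Definition vol (d : nat) {k : nat} (F : set 'rV[R]_k) : R :=
  let c := xget (0, 0) [set c : 'rV[R]_k * 'M[R]_(d, k) | is_chart F c] in
  fine (lebesgue_vol (affine_map c @^-1` F)).

End Volume.

Section Polytopes.
Context {R : realType} {k : nat}.
Implicit Types (Q : set 'rV[R]_k) (x y c : 'rV[R]_k).

(* The face of Q on which the linear functional <c, _> is maximal. *)
Definition face Q c : set 'rV[R]_k :=
  [set x | Q x /\ forall y, Q y -> dot c y <= dot c x].

Definition vertices Q : set 'rV[R]_k := [set x | exists c, face Q c = [set x]].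

Definition is_edge Q x y : Prop :=
  x <> y /\ exists c, face Q c = hull [set x; y].

Definition equilateral Q : Prop :=
  exists l : R, forall x y, is_edge Q x y -> enorm (x - y) = l.

(* The order of the enumeration is arbitrary; it only conjugates the matrices
   below by a permutation. *)
Definition nvert Q : nat := size (fset_set (vertices Q) : seq 'rV[R]_k).

Definition vert Q (s : 'I_(nvert Q)) : 'rV[R]_k :=
  nth 0 (fset_set (vertices Q) : seq 'rV[R]_k) s.

Definition polar_dual Q : set 'rV[R]_k :=
  [set p | forall x, vertices Q x -> dot p x <= 1].

(* For vertices x, y of Q, the facet of the polar dual with outer normal x is
   its face in direction x. *)
Definition ridge Q x y : set 'rV[R]_k :=
  face (polar_dual Q) x `&` face (polar_dual Q) y.

(* pi minus the angle between the outer normals x and y of the two facets. *)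
Definition dihedral_angle x y : R :=
  pi - acos (dot x y / (enorm x * enorm y)).

Definition izmestiev_offdiag Q (s t : 'I_(nvert Q)) : R :=
  if `[< is_edge Q (vert s) (vert t) >] then
    - (vol (k - 2) (ridge Q (vert s) (vert t))
       / (enorm (vert s) * enorm (vert t)
          * sin (dihedral_angle (vert s) (vert t))))
  else 0.

(* The coefficient M_ss with M_ss w_s = - sum_(t != s) M_st w_t. *)
Definition izmestiev_diag Q (s : 'I_(nvert Q)) : R :=
  xget 0 [set c : R | c *: vert s =
    - \sum_(t | t != s) izmestiev_offdiag s t *: vert t].

Definition izmestiev_matrix Q : 'M[R]_(nvert Q) :=
  \matrix_(s, t) (if s == t then izmestiev_diag s else izmestiev_offdiag s t).

Definition common_diag {n : nat} (M : 'M[R]_n) : R :=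
  xget 0 [set c | forall s, M s s = c].

Definition common_row_sum {n : nat} (M : 'M[R]_n) : R :=
  xget 0 [set c | forall s, \sum_t M s t = c].

Definition random_walk_matrix Q : 'M[R]_(nvert Q) :=
  let M := izmestiev_matrix Q in
  let gamma := common_diag M in
  let delta := common_row_sum M in
  (gamma - delta)^-1 *: (gamma%:M - M).

End Polytopes.

(* The eigenvalues of a real-diagonalisable matrix in decreasing order, repeated
   according to multiplicity. *)
Definition spectrum {R : realType} {n : nat} (A : 'M[R]_n) : seq R :=
  xget [::] [set e : seq R | sorted (fun x y => y <= x) e /\
                             char_poly A = \prod_(x <- e) ('X - x%:P)].

Definition second_eigenvalue {R : realType} {n : nat} (A : 'M[R]_n) : R :=
  nth 0 (spectrum A) 1.

Section Coxeter.
Context {k : nat}.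

Definition coxeter_matrix (m : 'I_k -> 'I_k -> nat) : Prop :=
  (forall i, m i i = 1%N) /\
  (forall i j, i != j -> m i j = m j i /\ (2 <= m i j)%N).

Definition coxeter_relations (m : 'I_k -> 'I_k -> nat) (G : groupType)
    (g : 'I_k -> G) : Prop :=
  forall i j, ((g i * g j) ^+ m i j = 1)%g.

(* gT = < s_1, ..., s_k | (s_i s_j)^(m_ij) >, by the universal property of the
   presentation among all groups, finite or not. *)
Definition coxeter_presentation (m : 'I_k -> 'I_k -> nat) (gT : finGroupType)
    (s : 'I_k -> gT) : Prop :=
  [/\ <<[set s i | i : 'I_k]>>%g = [set: gT]%SET,
      coxeter_relations m s
    & forall (G : groupType) (g : 'I_k -> G), coxeter_relations m g ->
        exists f : gT -> G,
          (forall x y, f (x * y)%g = (f x * f y)%g) /\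
          (forall i, f (s i) = g i)].

Definition coxeter_irreducible (m : 'I_k -> 'I_k -> nat) : Prop :=
  forall i j, connect [rel a b | (2 < m a b)%N] i j.

End Coxeter.

Section Reflection.
Context {R : realType} {k : nat}.

Definition schlafli (n : 'I_k -> 'rV[R]_k) : 'M[R]_k :=
  \matrix_(i, j) dot (n i) (n j).

Definition simple_roots (m : 'I_k -> 'I_k -> nat) (n : 'I_k -> 'rV[R]_k) :
    Prop :=
  (forall i, enorm (n i) = 1) /\
  (forall i j, i != j -> schlafli n i j = - cos (pi / (m i j)%:R)).

Definition reflection (n p : 'rV[R]_k) : 'rV[R]_k := p - (2 * dot p n) *: n.

(* Matrices act on row vectors from the right; the orbits are the same as for
   the left action because all group elements are taken. *)
Definition geometric_realisation (n : 'I_k -> 'rV[R]_k) (gT : finGroupType)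
    (s : 'I_k -> gT) (rho : mx_representation R [set: gT]%G k) : Prop :=
  mx_faithful rho /\
  forall j p, p *m rho (s j) = reflection (n j) p.

Definition orbit_pt (gT : finGroupType)
    (rho : mx_representation R [set: gT]%G k) (w : 'rV[R]_k) : set 'rV[R]_k :=
  [set w *m rho g | g in [set: gT]].

Definition permutahedron (gT : finGroupType)
    (rho : mx_representation R [set: gT]%G k) (w : 'rV[R]_k) : set 'rV[R]_k :=
  hull (orbit_pt rho w).

(* Indices start at 0, hence the sign (-1)^j instead of (-1)^(j-1). *)
Definition dual_root (n : 'I_k -> 'rV[R]_k) (j : 'I_k) : 'rV[R]_k :=
  (-1) ^+ j *: cross [seq n i | i <- enum 'I_k & i != j].

Definition fundamental_domain (n : 'I_k -> 'rV[R]_k) : set 'rV[R]_k :=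
  [set p | sphere p /\
     exists a : 'I_k -> R, (forall j, 0 < a j) /\
                           p = \sum_j a j *: dual_root n j].

Definition lambda1 (gT : finGroupType)
    (rho : mx_representation R [set: gT]%G k) (w : 'rV[R]_k) : R :=
  second_eigenvalue (random_walk_matrix (permutahedron rho w)).

End Reflection.

(* Main.v *)
(* The random walk matrix of Q_w is T = sum_j mu_j R(s_j), where R(s_j) permutes
   the vertices w g by s_j on the left.  The facet of the polar dual with normal w
   is the slice <p, w> = 1 of the closed Weyl chamber, a simplex, so its ridges
   have explicit volumes and mu_j is proportional to b_j = <om_j, w> / <n_j, w>,
   where (om_j) is the basis dual to (n_j).  Hence
   sum_j mu_j sigma_j w = (1 - 2 / sum_j b_j) w, and lambda = 1 - 2 / sum_j b_j is
   an eigenvalue of T.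

   Izmestiev's signature theorem is not used to see that lambda comes second.
   Put P_j = (1 - R(s_j)) / 2 and L = sum_j mu_j P_j = (1 - T) / 2.  As s_i and s_j
   generate a dihedral group of order 2 m_ij,
   <P_i v, P_j v> >= - cos (pi / m_ij) |P_i v| |P_j v|, so |L v|^2 is at least
   the form sum_ij mu_i mu_j <n_i, n_j> x_i x_j at x_i = |P_i v|.  The positive
   vector <n_j, w> is a ground state of this form with nonpositive off-diagonal
   coefficients, which gives |L v|^2 >= <L v, v> / sum_j b_j: the nonzero
   eigenvalues of L are at least 1 / sum_j b_j = (1 - lambda) / 2.

   With a_j = <n_j, w> and C = (<om_i, om_j>), which has positive entries by
   irreducibility, sum_j b_j = sum_ij C_ij a_j / a_i.  By the inequality
   t + 1/t >= 2 this is minimal exactly when a is constant, and it tends to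
   infinity when some a_j tends to 0.  As 2 a_j is the length of the edge from w
   to sigma_j w, constant a also characterises equilateral Q_w. *)

(* Many objects of the statement are fixed only through choices: the chart in [vol], the
   coefficients in [izmestiev_diag], [common_diag] and [common_row_sum], the list in [spectrum], the
   enumeration of the vertices. Each choice has to be shown possible and harmless; for [vol] this
   takes the change of variables formula for the iterated integral. Vertices, edges and polar facets
   of Q_w all follow from one fact: w - w g is a nonnegative combination of simple roots when w is
   dominant. It rests on the positivity of roots, proved by induction on word length. The inequality
   for <P_i v, P_j v> amounts to the spectral gap of a cycle of length m_ij, found by discrete
   Fourier analysis. In b_j, the numerator comes from the ridge volume and the denominator from the
   sine of the dihedral angle; a further factor (1 - <n_j, w>^2)^(1/2) occurs in both and cancels.
   The eigenvalue 1 of T is simple because the s_j generate the group, so lambda is second also when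
   multiplicities are counted. *)
Require Import Defs.
From HB Require Import structures.
From mathcomp Require Import all_boot all_order all_algebra all_fingroup.
From mathcomp Require Import all_character finmap.
From mathcomp Require Import all_classical all_reals all_analysis.
From mathcomp Require Import measurable_realfun ring lra zify.
From mathcomp Require complex.
Set Implicit Arguments.
Unset Strict Implicit.
Unset Printing Implicit Defensive.
Import Order.TTheory GRing.Theory Num.Theory.
Import numFieldNormedType.Exports.
Local Open Scope classical_set_scope.
Local Open Scope ring_scope.

(** * Lebesgue volume under linear maps *)

(* A named copy of the product measure: on products, the library's sigma-finite
   instance is shadowed by the one for subprobabilities. *)
Section LebesgueProduct.
Context {R : realType} {dd : measure_display} {T : measurableType dd}.
Variable mu : {sigma_finite_measure set T -> \bar R}.

Definition lebesgue_prod : set (measurableTypeR R * T) -> \bar R :=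
  (@lebesgue_measure R \x mu)%E.

HB.instance Definition _ := Measure.copy lebesgue_prod
  ((@lebesgue_measure R \x mu)%E : {measure set (measurableTypeR R * T)%type ->
      \bar R}).

Let lebesgue_prod_sigma_finite : sigma_finite setT lebesgue_prod.
Proof.
have /sigma_finiteP[F [TF ndF Foo]] := sigma_finiteT (@lebesgue_measure R).
have /sigma_finiteP[G [TG ndG Goo]] := sigma_finiteT mu.
exists (fun n => F n `*` G n).
  rewrite -setXTT TF TG; apply/seteqP; split=> [[x y] [[n _ Fnx] [k _ Gky]]|].
    exists (maxn n k) => //; split => /=.
      have /subsetPset FF := ndF _ _ (leq_maxl n k); exact: FF.
    have /subsetPset GG := ndG _ _ (leq_maxr n k); exact: GG.
  by move=> [x y] [n _ [/= ? ?]]; split; exists n.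
move=> n; have [? ?] := Foo n; have [? ?] := Goo n.
split; first exact: measurableX.
by rewrite /lebesgue_prod product_measure1E// lte_mul_pinfty// ge0_fin_numE.
Qed.

HB.instance Definition _ := Measure_isSigmaFinite.Build _ _ _ lebesgue_prod
  lebesgue_prod_sigma_finite.

Definition lebesgue_prod_measure :
  {sigma_finite_measure set (measurableTypeR R * T)%type -> \bar R} := lebesgue_prod.
End LebesgueProduct.

Section IteratedPower.
Context {R : realType}.

(** Nested pairs ending in [unit] mirror the recursion of [lebesgue_vol], so that measurable
    sections and Tonelli's theorem are available coordinate by coordinate. The display varies with
    [d], hence the dependent pair. *)
Fixpoint power_space (d : nat) : {dd : measure_display & measurableType dd} :=
  match d with
  | 0%N => existT _ _ (unit : measurableType _)
  | d'.+1 => existT _ _ ((measurableTypeR R * projT2 (power_space d'))%type :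
      measurableType _)
  end.

Definition dirac_tt : {sigma_finite_measure set (projT2 (power_space 0)) -> \bar R} :=
  (@dirac _ unit tt R : {sigma_finite_measure set unit -> \bar R}).

Fixpoint power_measure (d : nat) : {sigma_finite_measure set (projT2 (power_space d))
    -> \bar R} :=
  match d return {sigma_finite_measure set (projT2 (power_space d)) -> \bar R} with
  | 0%N => dirac_tt
  | d'.+1 => lebesgue_prod_measure (power_measure d')
  end.

Fixpoint row_of_power (d : nat) : projT2 (power_space d) -> 'rV[R]_d :=
  match d return projT2 (power_space d) -> 'rV[R]_d with
  | 0%N => fun=> 0
  | d'.+1 => fun t => row_mx (t.1 : R)%:M (row_of_power t.2)
  end.

Fixpoint power_of_row (d : nat) : 'rV[R]_d -> projT2 (power_space d) :=
  match d return 'rV[R]_d -> projT2 (power_space d) with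
  | 0%N => fun=> tt
  | d'.+1 => fun u => (u 0 0, power_of_row (@rsubmx _ 1 1 d' u))
  end.

Lemma row_mx_scalar00 d (x : R) (u : 'rV[R]_d) : row_mx (x%:M : 'M[R]_1) u 0 0 = x.
Proof.
by rewrite mxE; case: splitP => j //= _; rewrite mxE ord1 eqxx.
Qed.

Lemma row_mx_scalar_hsub d (u : 'rV[R]_d.+1) :
  row_mx ((u 0 0)%:M : 'M[R]_1) (@rsubmx _ 1 1 d u) = u.
Proof.
rewrite -[RHS](@hsubmxK _ 1 1 d); congr row_mx.
by apply/rowP => i; rewrite !mxE ord1 eqxx mulr1n; congr (u _ _); apply/val_inj.
Qed.

Lemma power_of_rowK d : cancel (@power_of_row d) (@row_of_power d).
Proof.
elim: d => [|d IH] /= u; first by apply/rowP => -[].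
by rewrite IH row_mx_scalar_hsub.
Qed.

(** Valid for every set, measurable or not, because [product_measure1] is by definition the integral
    of the measures of sections. *)
Lemma lebesgue_volE d (A : set 'rV[R]_d) : lebesgue_vol A =
    power_measure d (@row_of_power d @^-1` A).
Proof.
elim: d A => [|d IH] A /=.
  by rewrite diracE indicE; congr (_%:R%:E); apply: asbool_equiv_eq.
rewrite /lebesgue_prod /product_measure1; apply: eq_integral => x _ /=.
rewrite IH; congr (power_measure d _); apply/seteqP; split => u /=.
by rewrite /xsection /= inE.
by rewrite /xsection /= inE.
Qed.

Lemma measurable_affine (a b : R) :
  measurable_fun setT (fun x : measurableTypeR R => a * x + b : measurableTypeR R).
Proof. by apply: measurable_funD => //; exact: measurable_funM. Qed.

(** The scaled pushforward is a measure that agrees with Lebesgue measure on the generating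
    intervals []x, y]]; uniqueness does the rest. For negative [a] the preimage is closed at the
    other end, which does not change its length. *)
Lemma lebesgue_affine (a b : R) : a != 0 -> forall A : set (measurableTypeR R),
    measurable A ->
  lebesgue_measure A = ((`|a|)%:E * lebesgue_measure ((fun x => (a * x + b)%R :
      measurableTypeR R) @^-1` A))%E.
Proof.
move=> a0 A mA.
pose f := fun x : measurableTypeR R => a * x + b : measurableTypeR R.
have a0' : 0 <= `|a| by [].
pose nu := mscale (NngNum a0')
    (@measure_function_pushforward__canonical__measure_function_Measure _ _ _ _ _
    (@lebesgue_measure R) _ (measurable_affine a b)).
apply: (@lebesgue_measure_unique R nu) => // _ [[x y] _ <-].
rewrite /nu /mscale /= /pushforward.
have [agt0|alt0|//] := ltgtP 0 a; last by move/eqP; rewrite eq_sym (negPf a0).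
  rewrite [X in _ = (_ * lebesgue_measure X)%E](_ : _ = `](x - b) / a, (y - b)
      / a]%classic); last first.
    apply/seteqP; split=> z /=; rewrite !in_itv /= ltr_pdivrMr // ler_pdivlMr // =>
        /andP[? ?]; apply/andP; lra.
  rewrite !lebesgue_measure_itv /= !lte_fin ltr_pM2r ?invr_gt0 // ltrD2r.
  case: ifP => _; last by rewrite mule0.
  by rewrite -!EFinD -EFinM gtr0_norm //; congr EFin; field.
rewrite [X in _ = (_ * lebesgue_measure X)%E](_ : _ = `[(y - b) / a, (x - b)
    / a[%classic); last first.
  apply/seteqP; split=> z /=; rewrite !in_itv /= ler_ndivrMr // ltr_ndivlMr // =>
      /andP[? ?]; apply/andP; lra.
rewrite !lebesgue_measure_itv /= !lte_fin ltr_nM2r ?invr_lt0 // ltrD2r.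
case: ifP => _; last by rewrite mule0.
by rewrite -!EFinD -EFinM ltr0_norm //; congr EFin; field.
Qed.

Lemma ge0_integral_affine (a b : R) (g : R -> \bar R) : a != 0 ->
  measurable_fun setT g -> (forall x, 0 <= g x)%E ->
  (\int[@lebesgue_measure R]_x g x = `|a|%:E * \int[@lebesgue_measure R]_x g (a * x +
      b)%R)%E.
Proof.
move=> a0 mg g0.
have a0' : 0 <= `|a| by [].
pose f := fun x : measurableTypeR R => a * x + b : measurableTypeR R.
pose push := @measure_function_pushforward__canonical__measure_function_Measure _ _ _
    _ _ (@lebesgue_measure R) _ (measurable_affine a b).
rewrite (@eq_measure_integral _ _ _ setT (mscale (NngNum a0') push)); last first.
  by move=> A mA _; apply: lebesgue_affine.
rewrite ge0_integral_mscale //=; congr (_ * _)%E.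
rewrite ge0_integral_pushforward //.
exact: measurable_affine.
Qed.

Lemma measurable_row_of_power_coord d (i : 'I_d) :
  measurable_fun setT (fun t : projT2 (power_space d) => row_of_power t 0 i :
      measurableTypeR R).
Proof.
elim: d i => [|d IH] i; first by case: i.
have [->|i0] := eqVneq i ord0.
  rewrite [X in measurable_fun _ X](_ : _ = fst) //.
  by apply/funext => -[x t] /=; rewrite row_mx_scalar00.
have [j ->] : exists j : 'I_d, i = rshift 1 j.
  case: (unliftP ord0 i) => [j ->|ii]; last by rewrite ii in i0.
  by exists j; apply/val_inj.
rewrite [X in measurable_fun _ X](_ : _ = (fun t : projT2 (power_space d)
    => row_of_power t 0 j) \o snd).
  exact: measurableT_comp (IH j) _.
by apply/funext => -[x t]; exact: (@row_mxEr _ 1 1 d).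
Qed.

Lemma measurable_to_powerP dd (T : measurableType dd) d (h : T ->
    projT2 (power_space d)) :
  (forall i : 'I_d, measurable_fun setT (fun t => row_of_power (h t)
      0 i : measurableTypeR R)) ->
  measurable_fun setT h.
Proof.
elim: d h => [|d IH] h H.
  by rewrite (_ : h = cst tt) //; apply/funext => t; case: (h t).
apply/measurable_fun_pairP; split.
  have := H ord0; rewrite [X in measurable_fun _ X](_ : _ = fst \o h) //.
  by apply/funext => t /=; rewrite row_mx_scalar00.
apply: IH => i; have := H (rshift 1 i).
rewrite [X in measurable_fun _ X](_ : _ = (fun t => row_of_power (snd (h t)) 0 i)) //.
by apply/funext => t; exact: (@row_mxEr _ 1 1 d).
Qed.

Definition row_measurable d (A : set 'rV[R]_d) := measurable (@row_of_power d @^-1` A).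

Lemma row_measurable_affine d e (v : 'rV[R]_e) (M : 'M[R]_(d, e)) (A : set 'rV[R]_e) :
  row_measurable A -> row_measurable [set u | A (v + u *m M)].
Proof.
move=> mA; pose f := fun t : projT2 (power_space d) => power_of_row (v + row_of_power
    t *m M).
have mf : measurable_fun setT f.
  apply: measurable_to_powerP => i.
  rewrite [X in measurable_fun _ X](_ : _ = fun t : projT2 (power_space d)
      => v 0 i + \sum_j row_of_power t 0 j * M j i); last first.
    by apply/funext => t; rewrite /f power_of_rowK !mxE.
  apply: measurable_funD => //; apply: measurable_sum => j.
  by apply: measurable_funM => //; apply: measurable_row_of_power_coord.
have := mf measurableT _ mA; rewrite setTI /row_measurable.
by congr measurable; apply/seteqP; split => t /=; rewrite /f power_of_rowK.
Qed.

Lemma row_measurable_section d (A : set 'rV[R]_d.+1) (x : R) :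
  row_measurable A -> row_measurable [set u | A (row_mx (x%:M : 'M[R]_1) u)].
Proof.
move=> mA; have := @measurable_xsection _ _ (measurableTypeR R) _ _ x mA.
by congr measurable; apply/seteqP; split => u /=; rewrite /xsection /= inE.
Qed.

Lemma measurable_fun_lebesgue_vol d (A : set 'rV[R]_d.+1) : row_measurable A ->
  measurable_fun setT (fun x : measurableTypeR R => lebesgue_vol [set u | A (row_mx
      (x%:M : 'M[R]_1) u)]).
Proof.
move=> mA; have := measurable_fun_xsection (power_measure d) mA.
congr measurable_fun; apply/funext => x /=; rewrite lebesgue_volE;
    congr (power_measure d _).
by apply/seteqP; split => u /=; rewrite /xsection /= inE.
Qed.

Lemma lebesgue_vol_ge0 d (A : set 'rV[R]_d) : (0 <= lebesgue_vol A)%E.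
Proof. by rewrite lebesgue_volE. Qed.

Lemma row_measurable_translate d (v : 'rV[R]_d) (A : set 'rV[R]_d) :
  row_measurable A -> row_measurable [set u | A (v + u)].
Proof.
move=> /(row_measurable_affine v 1%:M); congr row_measurable.
by apply/seteqP; split => u /=; rewrite mulmx1.
Qed.

Lemma lebesgue_vol_translate d (v : 'rV[R]_d) (A : set 'rV[R]_d) : row_measurable A ->
  lebesgue_vol [set u | A (v + u)] = lebesgue_vol A.
Proof.
elim: d v A => [|d IH] v A mA.
  by congr lebesgue_vol; apply/seteqP; split => u /=; congr A; apply/rowP => -[].
(* The slice at [x] of the translated set is a translate of the slice at [x + v 0 0]; the factor
   [1 *] fits [ge0_integral_affine]. *)
have E x : lebesgue_vol [set u | A (v + row_mx (x%:M : 'M[R]_1) u)] =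
   lebesgue_vol [set u | A (row_mx ((1 * x + v 0 0)%:M : 'M[R]_1) u)].
  rewrite -(IH (@rsubmx _ 1 1 d v) _ (row_measurable_section (1 * x + v 0 0) mA)).
  congr lebesgue_vol; apply: eq_set => u /=; congr A.
  rewrite -[v in LHS]row_mx_scalar_hsub (@add_row_mx _ 1 1 d) mul1r.
  by rewrite -raddfD /= [v 0 0 + _]addrC.
rewrite /=; under eq_integral do rewrite E.
rewrite [RHS](@ge0_integral_affine 1 (v 0 0)) ?oner_eq0 //.
- by rewrite normr1 mul1e.
- exact: measurable_fun_lebesgue_vol.
- by move=> x; apply: lebesgue_vol_ge0.
Qed.

(** The slice at [x] is mapped into the slice at [a * x] by [B] followed by the translation by
    [x *: b], which preserves volume. So [B] acts inside the integral and [a] on the variable of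
    integration. *)
Lemma lebesgue_vol_block d (a : R) (b : 'rV[R]_d) (B : 'M[R]_d) (A : set 'rV[R]_d.+1) :
  a != 0 -> row_measurable A ->
  (forall A, row_measurable A ->
     lebesgue_vol A = `|\det B|%:E * lebesgue_vol [set u | A (u *m B)])%E ->
  (lebesgue_vol A = `|\det (block_mx (a%:M : 'M[R]_1) b 0 B)|%:E *
    lebesgue_vol [set u | A (u *m block_mx (a%:M : 'M[R]_1) b 0 B)])%E.
Proof.
move=> a0 mA HB.
have E x : (lebesgue_vol [set u | A (row_mx ((a * x + 0)%:M : 'M[R]_1) u)] =
   `|\det B|%:E * lebesgue_vol [set u | A (row_mx (x%:M : 'M[R]_1)
       u *m block_mx (a%:M : 'M[R]_1) b 0 B)])%E.
  have mS := row_measurable_section (a * x + 0) mA.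
  rewrite -(lebesgue_vol_translate (x *: b) mS) HB; last exact:
      row_measurable_translate.
  congr (_ * lebesgue_vol _)%E; apply: eq_set => u /=; congr A.
  by rewrite mul_row_block mulmx0 !addr0 mul_scalar_mx scale_scalar_mx mulrC
      mul_scalar_mx.
rewrite det_ublock det_scalar expr1 normrM EFinM -muleA /=.
rewrite (@ge0_integral_affine a 0) //; last 2 first.
- exact: measurable_fun_lebesgue_vol.
- by move=> x; apply: lebesgue_vol_ge0.
congr (_ * _)%E.
under eq_integral do rewrite E.
have mA' := row_measurable_affine 0 (block_mx (a%:M : 'M[R]_1) b 0 B) mA.
rewrite ge0_integralZl //.
- have := measurable_fun_lebesgue_vol mA'; congr measurable_fun.
  by apply/funext => x; congr lebesgue_vol; apply/seteqP; split => u /=; rewrite add0r.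
- by move=> x _; apply: lebesgue_vol_ge0.
Qed.

Lemma row_mx_scalar_lift d (x : R) (u : 'rV[R]_d) (j : 'I_d) :
  row_mx (x%:M : 'M[R]_1) u 0 (lift ord0 j) = u 0 j.
Proof. by rewrite -[RHS](@row_mxEr _ 1 1 d x%:M u 0 j); congr (row_mx _ _ _ _);
    apply/val_inj. Qed.

(** Tonelli's theorem for the function that sends the first two coordinates to the volume of the
    remaining section. *)
Lemma lebesgue_vol_swap d (A : set 'rV[R]_d.+2) : row_measurable A ->
  lebesgue_vol A = lebesgue_vol [set u | A (u *m perm_mx (tperm ord0 (lift ord0
      ord0)))].
Proof.
move=> mA.
pose reassoc := fun z : (measurableTypeR R * measurableTypeR R)
    * projT2 (power_space d) =>
  (z.1.1, (z.1.2, z.2)) : projT2 (power_space d.+2).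
have mr : measurable_fun setT reassoc.
  apply: measurable_fun_pair; first exact: measurableT_comp measurable_fst.
  apply: measurable_fun_pair => //; exact: measurableT_comp measurable_fst.
pose B := reassoc @^-1` (@row_of_power d.+2 @^-1` A).
have mB : measurable B by rewrite -[B]setTI; exact: mr.
have mf := measurable_fun_xsection (power_measure d) mB.
pose f z := (power_measure d \o xsection B) z.
have fE x y : f (x, y) = lebesgue_vol [set u | A (row_mx (x%:M : 'M[R]_1)
    (row_mx (y%:M : 'M[R]_1) u))].
  rewrite lebesgue_volE /f /=; congr (power_measure d _); apply/seteqP.
  by split => u /=; rewrite /xsection /= inE.
transitivity (\int[@lebesgue_measure R]_x \int[@lebesgue_measure R]_y f (x, y))%E.
  rewrite /=; apply: eq_integral => x _; apply: eq_integral => y _; rewrite fE //.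
rewrite (fubini_tonelli f mf (fun z => measure_ge0 _ _)) /=.
apply: eq_integral => x _; apply: eq_integral => y _; rewrite fE //.
congr lebesgue_vol; apply: eq_set => u /=; congr A.
have -> : perm_mx (tperm ord0 (lift ord0 ord0)) = perm_mx (tperm ord0 (lift ord0
    ord0))^-1 :> 'M[R]_d.+2.
  by rewrite tpermV.
rewrite -col_permE; apply/rowP => i; rewrite [RHS]mxE.
case: (unliftP ord0 i) => [j ->|->]; last first.
  by rewrite tpermL row_mx_scalar00 row_mx_scalar_lift row_mx_scalar00.
case: (unliftP ord0 j) => [l ->|->]; last first.
  by rewrite tpermR row_mx_scalar00 row_mx_scalar_lift row_mx_scalar00.
by rewrite tpermD ?row_mx_scalar_lift.
Qed.

Definition linear_change d (M : 'M[R]_d) := forall A : set 'rV[R]_d, row_measurable A ->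
  lebesgue_vol A = (`|\det M|%:E * lebesgue_vol [set u | A (u *m M)])%E.

Lemma row_measurable_mulmx d (M : 'M[R]_d) (A : set 'rV[R]_d) :
  row_measurable A -> row_measurable [set u | A (u *m M)].
Proof.
by move=> /(row_measurable_affine 0 M); congr row_measurable; apply: eq_set => u;
    rewrite add0r.
Qed.

Lemma linear_change_mul d (M N : 'M[R]_d) :
  linear_change M -> linear_change N -> linear_change (M *m N).
Proof.
move=> HM HN A mA; rewrite HN // HM; last exact: row_measurable_mulmx.
rewrite det_mulmx normrM mulrC EFinM muleA; congr (_ * lebesgue_vol _)%E.
by apply: eq_set => u; rewrite mulmxA.
Qed.

Lemma linear_change1 d : linear_change (1%:M : 'M[R]_d).
Proof.
move=> A mA; rewrite det1 normr1 mul1e; congr lebesgue_vol.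
by apply/seteqP; split => u /=; rewrite mulmx1.
Qed.

Lemma linear_change_upper d (M : 'M[R]_d) : \det M != 0 ->
  (forall i j : 'I_d, (j < i)%N -> M i j = 0) -> linear_change M.
Proof.
elim: d M => [|d IH] M detM HM.
  by rewrite [M](_ : _ = 1%:M); [exact: linear_change1|apply/matrixP => -[]].
have EM : M = block_mx ((M 0 0)%:M : 'M[R]_1) (@ursubmx _ 1 d 1 d M)
    0 (@drsubmx _ 1 d 1 d M).
  have <- : @ulsubmx _ 1 d 1 d M = (M 0 0)%:M.
    by apply/matrixP => i j; rewrite !ord1 !mxE eqxx mulr1n; congr (M _ _);
        apply/val_inj.
  have <- : @dlsubmx _ 1 d 1 d M = 0.
    by apply/matrixP => i j; rewrite !mxE HM //= ord1.
  exact: esym (@submxK _ 1 d 1 d M).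
move: detM; rewrite EM (@det_ublock _ 1 d) det_scalar expr1 mulf_eq0 negb_or =>
    /andP[a0 dB].
move=> A mA; apply: lebesgue_vol_block => //; apply: IH => // i j ij.
by rewrite !mxE HM //=.
Qed.

Lemma linear_change_lift0 d (s : 'S_d) : linear_change (perm_mx s : 'M[R]_d) ->
  linear_change (perm_mx (lift0_perm s) : 'M[R]_d.+1).
Proof.
move=> Hs A mA; rewrite -lift0_mx_perm /lift0_mx.
by apply: lebesgue_vol_block => //; exact: oner_neq0.
Qed.

(** Only the exchange of the first two coordinates needs Tonelli. Transpositions fixing 0 are lifts
    from one dimension lower, and the transposition of 0 with any other index is conjugate to that
    exchange by such a lift. *)
Lemma linear_change_tperm d (i j : 'I_d) : linear_change (perm_mx (tperm i j)
    : 'M[R]_d).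
Proof.
elim: d i j => [[]//|d IH] i j.
have HL (a b : 'I_d) : linear_change (perm_mx (tperm (lift ord0 a) (lift ord0 b))
    : 'M[R]_d.+1).
  have -> : tperm (lift ord0 a) (lift ord0 b) = lift0_perm (tperm a b).
    apply/permP => x; case: (unliftP ord0 x) => [y ->|->].
      rewrite lift0_perm_lift; case: (tpermP a b y) => [->|->|/eqP ya /eqP yb].
      - by rewrite tpermL.
      - by rewrite tpermR.
      - by rewrite tpermD // (inj_eq lift_inj) eq_sym.
    by rewrite lift0_perm0 tpermD.
  exact/linear_change_lift0/IH.
have H0 (a : 'I_d) : linear_change (perm_mx (tperm ord0 (lift ord0 a)) : 'M[R]_d.+1).
  clear i j; case: d a IH HL => [[]//|d] a IH HL.
  have H01 : linear_change (perm_mx (tperm ord0 (lift ord0 ord0)) : 'M[R]_d.+2).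
    move=> A mA; rewrite det_perm odd_tperm expr1 normrN1 mul1e.
    exact: lebesgue_vol_swap.
  have [->//|a0] := eqVneq a ord0.
  have -> : tperm ord0 (lift ord0 a) =
      (tperm (lift ord0 ord0) (lift ord0 a) * tperm ord0 (lift ord0 ord0)
          * tperm (lift ord0 ord0) (lift ord0 a))%g.
    by rewrite -mulgA -[X in (X * _)%g]tpermV -conjgE tpermJ tpermL tpermD.
  rewrite perm_mxM [X in X *m _]perm_mxM.
  exact: linear_change_mul (linear_change_mul (HL _ _) H01) (HL _ _).
case: (unliftP ord0 i) (unliftP ord0 j) => [a ->|->] [b ->|->] //.
- by rewrite tpermC.
- by rewrite tperm1 perm_mx1; exact: linear_change1.
Qed.

Lemma linear_change_perm d (s : 'S_d) : linear_change (perm_mx s : 'M[R]_d).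
Proof.
have [ts -> _] := prod_tpermP s; elim: ts => [|t ts IH].
  by rewrite big_nil perm_mx1; exact: linear_change1.
by rewrite big_cons perm_mxM; apply: linear_change_mul => //;
    exact: linear_change_tperm.
Qed.

(* LUP decomposition; the lower triangular factor is conjugate to an upper
   triangular one by the order-reversing permutation. *)
Lemma linear_change_unit d (M : 'M[R]_d) : \det M != 0 -> linear_change M.
Proof.
case: d M => [|d] M detM.
  by rewrite [M](_ : _ = 1%:M); [exact: linear_change1|apply/matrixP => -[]].
have := cormen_lup_correct M; have := cormen_lup_detL M; have := cormen_lup_perm M.
have := @cormen_lup_lower _ _ M; have := @cormen_lup_upper _ _ M.
case: (cormen_lup M) => [[P L] U] /= HU HL /is_perm_mxP [s ->] dL E.
have -> : M = perm_mx s^-1 *m (L *m U).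
  by rewrite -[L *m U]E mulmxA -perm_mxM mulVg perm_mx1 mul1mx.
have dU : \det U != 0.
  apply: contraNneq detM => dU; have : \det (perm_mx s * M)
      = 0 by rewrite E detM dU mulr0.
  by rewrite detM det_perm => /eqP; rewrite mulf_eq0 signr_eq0.
apply: linear_change_mul; first exact: linear_change_perm.
apply: linear_change_mul; last exact: linear_change_upper.
pose w : 'S_d.+1 := perm (@rev_ord_inj d.+1).
have ww : (w * w = 1)%g by apply/permP => i; rewrite permM !permE rev_ordK.
have -> : L = perm_mx w *m (perm_mx w *m L *m perm_mx w) *m perm_mx w.
  by rewrite !mulmxA -perm_mxM ww perm_mx1 mul1mx -mulmxA -perm_mxM ww perm_mx1 mulmx1.
apply: linear_change_mul; last exact: linear_change_perm.
apply: linear_change_mul; first exact: linear_change_perm.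
apply: linear_change_upper.
  by rewrite !det_mulmx dL mulr1 det_perm -expr2 sqrr_sign oner_neq0.
move=> i j ij; rewrite -{2}[w]invgK -col_permE -row_permE !mxE.
have wV : (w^-1 = w)%g by apply/eqP; rewrite eq_invg_mul ww.
rewrite wV !permE HL /=; last by rewrite leq_sub2l // ltnS ltnW.
by rewrite (inj_eq rev_ord_inj) eq_sym -val_eqE /= (ltn_eqF ij).
Qed.

Definition std_simplex d : set 'rV[R]_d :=
  [set t | (forall i, 0 <= t 0 i) /\ \sum_i t 0 i <= 1].

Definition cube d (e : R) : set 'rV[R]_d := [set t | forall i, 0 <= t 0 i <= e].

Lemma row_measurable_coord d (i : 'I_d) (B : set (measurableTypeR R)) : measurable B ->
  row_measurable [set t : 'rV[R]_d | B (t 0 i)].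
Proof.
move=> mB; have := @measurable_row_of_power_coord d i measurableT _ mB.
by rewrite setTI.
Qed.

Lemma row_measurable_forall d (I : finType) (B : I -> set 'rV[R]_d) :
  (forall i, row_measurable (B i)) -> row_measurable [set t | forall i, B i t].
Proof.
move=> mB; rewrite /row_measurable.
rewrite [X in measurable X](_ : _ = \bigcap_(i in [set: I])
    (@row_of_power d @^-1` B i)).
  by apply: fin_bigcap_measurable => // i _; exact: mB.
by apply/seteqP; split => t /= H; [move=> i _ | move=> i]; exact: H.
Qed.

Lemma row_measurable_cube d e : row_measurable (@cube d e).
Proof.
apply: row_measurable_forall => i.
have := @row_measurable_coord d i `[0, e]%classic (measurable_itv _).
by congr row_measurable; apply: eq_set => t; rewrite /= in_itv.
Qed.

Lemma row_measurable_std_simplex d : row_measurable (@std_simplex d).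
Proof.
rewrite /row_measurable.
rewrite [X in measurable X](_ : _ = (@row_of_power d @^-1` [set t | forall i,
    [set t | 0 <= t 0 i] t]) `&`
   ((fun t => \sum_i row_of_power t 0 i : measurableTypeR R) @^-1` `]-oo, 1]%classic)).
  apply: measurableI.
    apply: row_measurable_forall => i.
    have := @row_measurable_coord d i `[0, +oo[%classic (measurable_itv _).
    by congr row_measurable; apply: eq_set => t; rewrite /= in_itv /= andbT.
  have mf : measurable_fun setT (fun t : projT2 (power_space d)
      => \sum_i row_of_power t 0 i : measurableTypeR R).
    by apply: measurable_sum => i; exact: measurable_row_of_power_coord.
  by have := mf measurableT _ (measurable_itv `]-oo, 1]); rewrite setTI.
by apply/seteqP; split => t /=; rewrite in_itv /=; move=> [].
Qed.

Lemma lebesgue_vol0 d : lebesgue_vol (set0 : set 'rV[R]_d) = 0%E.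
Proof. by rewrite lebesgue_volE preimage_set0 measure0. Qed.

Lemma le_lebesgue_vol d (A B : set 'rV[R]_d) : row_measurable A -> row_measurable B ->
  A `<=` B -> (lebesgue_vol A <= lebesgue_vol B)%E.
Proof.
move=> mA mB AB; rewrite !lebesgue_volE le_measure ?inE //.
by move=> t /=; exact: AB.
Qed.

Lemma lebesgue_vol_cube d (e : R) : 0 <= e -> lebesgue_vol (@cube d e) = (e ^+ d)%:E.
Proof.
move=> e0; elim: d => [|d IH].
  by rewrite /= expr0 indicE mem_set //= => -[].
transitivity (\int[@lebesgue_measure R]_x ((e ^+ d)%:E * (\1_(`[0,
    e]%classic : set R) x)%:E))%E.
  rewrite /=; apply: eq_integral => x _; rewrite indicE.
  have [x0e|x0e] := boolP (x \in `[0, e]%classic).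
    rewrite mule1 -IH; congr lebesgue_vol; apply/seteqP; split => u /= H i.
      by have := H (lift ord0 i); rewrite row_mx_scalar_lift.
    case: (unliftP ord0 i) => [j ->|->]; rewrite ?row_mx_scalar_lift ?row_mx_scalar00
        //.
    by move: x0e; rewrite inE /= in_itv.
  rewrite mule0; rewrite [X in lebesgue_vol X](_ : _ = set0) ?lebesgue_vol0 //.
  apply/seteqP; split => u //= H; have := H ord0; rewrite row_mx_scalar00 => H0.
  by move: x0e; rewrite notin_setE /= in_itv /= H0.
rewrite ge0_integralZl //; last 2 first.
- exact/measurable_EFinP/measurable_indic.
- by rewrite lee_fin exprn_ge0.
rewrite integral_indic // setIT.
have lm : lebesgue_measure (`[0, e]%classic : set R) = e%:E.
  rewrite lebesgue_measure_itv /= lte_fin; case: ltgtP e0 => // [e0 _|<- _] //.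
  by rewrite sube0.
by rewrite exprSr EFinM -lm.
Qed.

(** Equal to 1/d!. As a common factor of all ridge volumes it cancels in the random walk matrix, so
    only finiteness and positivity are established. *)
Definition std_vol d : R := fine (lebesgue_vol (@std_simplex d)).

Lemma std_vol_fin d : lebesgue_vol (@std_simplex d) = (std_vol d)%:E.
Proof.
rewrite /std_vol fineK // ge0_fin_numE; last exact: lebesgue_vol_ge0.
apply: (@le_lt_trans _ _ (lebesgue_vol (@cube d 1))); last first.
  by rewrite lebesgue_vol_cube // ltry.
apply: le_lebesgue_vol; [exact: row_measurable_std_simplex|exact: row_measurable_cube|].
move=> t [t0 t1] i; rewrite t0 /=; apply: le_trans t1.
by rewrite (bigD1 i) //= lerDl sumr_ge0.
Qed.

Lemma std_vol_gt0 d : 0 < std_vol d.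
Proof.
rewrite -lte_fin -std_vol_fin.
(* Points of this cube have coordinate sum at most d/(d+1); the side is positive in dimension 0
   too. *)
apply: (@lt_le_trans _ _ (lebesgue_vol (@cube d d.+1%:R^-1))).
  by rewrite lebesgue_vol_cube // lte_fin exprn_gt0.
apply: le_lebesgue_vol; [exact: row_measurable_cube|exact: row_measurable_std_simplex|].
move=> t H; split=> [i|]; first by have /andP[] := H i.
apply: (@le_trans _ _ (\sum_(i < d) d.+1%:R^-1)).
  by apply: ler_sum => i _; have /andP[] := H i.
by rewrite sumr_const card_ord -[X in X <= _]mulr_natl ler_pdivrMr // mul1r ler_nat.
Qed.
End IteratedPower.

(** * Euclidean geometry and volumes of simplices *)

Section DotTheory.
Context {R : realType} {k : nat}.
Implicit Types (u v w : 'rV[R]_k).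

Lemma dotE u v : dot u v = \sum_i u 0 i * v 0 i.
Proof. by rewrite /dot mxE; apply: eq_bigr => i _; rewrite mxE. Qed.

Lemma dotC u v : dot u v = dot v u.
Proof. by rewrite !dotE; apply: eq_bigr => i _; rewrite mulrC. Qed.

Lemma dotDl u v w : dot (u + v) w = dot u w + dot v w.
Proof. by rewrite /dot mulmxDl mxE. Qed.

Lemma dotDr u v w : dot w (u + v) = dot w u + dot w v.
Proof. by rewrite dotC dotDl !(dotC w). Qed.

Lemma dotNl u v : dot (- u) v = - dot u v.
Proof. by rewrite /dot mulNmx mxE. Qed.

Lemma dotNr u v : dot u (- v) = - dot u v.
Proof. by rewrite dotC dotNl dotC. Qed.

Lemma dotBl u v w : dot (u - v) w = dot u w - dot v w.
Proof. by rewrite dotDl dotNl. Qed.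

Lemma dotBr u v w : dot w (u - v) = dot w u - dot w v.
Proof. by rewrite dotDr dotNr. Qed.

Lemma dotZl a u v : dot (a *: u) v = a * dot u v.
Proof. by rewrite /dot -scalemxAl mxE. Qed.

Lemma dotZr a u v : dot u (a *: v) = a * dot u v.
Proof. by rewrite dotC dotZl dotC. Qed.

Lemma dot0l u : dot 0 u = 0.
Proof. by rewrite /dot mul0mx mxE. Qed.

Lemma dot0r u : dot u 0 = 0.
Proof. by rewrite dotC dot0l. Qed.

Lemma dot_suml (I : Type) (r : seq I) (P : pred I) (F : I -> 'rV[R]_k) v :
  dot (\sum_(i <- r | P i) F i) v = \sum_(i <- r | P i) dot (F i) v.
Proof. by rewrite /dot mulmx_suml summxE. Qed.

Lemma dot_sumr (I : Type) (r : seq I) (P : pred I) (F : I -> 'rV[R]_k) v :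
  dot v (\sum_(i <- r | P i) F i) = \sum_(i <- r | P i) dot v (F i).
Proof. by rewrite dotC dot_suml; apply: eq_bigr => i _; rewrite dotC. Qed.

Lemma dot_ge0 u : 0 <= dot u u.
Proof. by rewrite dotE sumr_ge0 // => i _; rewrite -expr2 sqr_ge0. Qed.

Lemma dot_eq0 u : (dot u u == 0) = (u == 0).
Proof.
apply/idP/eqP => [|->]; last by rewrite dot0l.
rewrite dotE psumr_eq0; last by move=> i _; rewrite -expr2 sqr_ge0.
move=> /allP H; apply/rowP => i; rewrite mxE.
by have := H i (mem_index_enum i); rewrite /= mulf_eq0 orbb => /eqP.
Qed.

Lemma dot_gt0 u : (0 < dot u u) = (u != 0).
Proof. by rewrite lt_neqAle dot_ge0 andbT eq_sym dot_eq0. Qed.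

Lemma enorm_ge0 u : 0 <= enorm u.
Proof. exact: sqrtr_ge0. Qed.

Lemma enorm_sqr u : enorm u ^+ 2 = dot u u.
Proof. by rewrite sqr_sqrtr // dot_ge0. Qed.

Lemma enorm_gt0 u : (0 < enorm u) = (u != 0).
Proof. by rewrite sqrtr_gt0 dot_gt0. Qed.

Lemma enormZ a u : enorm (a *: u) = `|a| * enorm u.
Proof. by rewrite /enorm dotZl dotZr mulrA -expr2 sqrtrM ?sqr_ge0 // sqrtr_sqr. Qed.

Lemma sphere_dot u : sphere u -> dot u u = 1.
Proof. by move=> u1; rewrite -enorm_sqr u1 expr1n. Qed.

Lemma cauchy_schwarz_sqr u v : dot u v ^+ 2 <= dot u u * dot v v.
Proof.
have [->|v0] := eqVneq v 0; first by rewrite !dot0r mulr0 expr0n.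
have vv : 0 < dot v v by rewrite dot_gt0.
have := dot_ge0 (dot v v *: u - dot u v *: v).
rewrite dotBl !dotBr !dotZl !dotZr [dot v u]dotC => H.
rewrite -subr_ge0 -(pmulr_rge0 _ vv); apply: le_trans H _; nra.
Qed.

Lemma cauchy_schwarz u v : `|dot u v| <= enorm u * enorm v.
Proof.
rewrite -(@ler_pXn2r _ 2) ?nnegrE ?mulr_ge0 ?enorm_ge0 //.
by rewrite exprMn !enorm_sqr real_normK ?num_real // cauchy_schwarz_sqr.
Qed.

Lemma dot_mulmx_trmx e (u : 'rV[R]_e) (v : 'rV[R]_k) (M : 'M[R]_(e, k)) :
  dot (u *m M) v = dot u (v *m M^T).
Proof. by rewrite /dot trmx_mul trmxK mulmxA. Qed.
End DotTheory.

Lemma dot_isometry {R : realType} {d k : nat} (M : 'M[R]_(d, k)) (u v : 'rV[R]_d) :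
  M *m M^T = 1%:M -> dot (u *m M) (v *m M) = dot u v.
Proof. by move=> MM; rewrite dot_mulmx_trmx -mulmxA MM mulmx1. Qed.

Section Simplex.
Context {R : realType}.

(** Gram-Schmidt from the last row upwards. The rows of [C] are an orthonormal basis of the row
    space, which provides a chart for the plane of a simplex. *)
Lemma orthonormal_factor d k (D : 'M[R]_(d, k)) : row_free D ->
  exists (X : 'M[R]_d) (C : 'M[R]_(d, k)), C *m C^T = 1%:M /\ D = X *m C.
Proof.
elim: d D => [|d IH] D Dfree.
  by exists 1%:M, D; split; [apply/matrixP => -[]|rewrite mul1mx].
pose r := @usubmx _ 1 d k D; pose D' := @dsubmx _ 1 d k D.
have ED : D = col_mx r D' by rewrite -[LHS](@vsubmxK _ 1 d k).
have Dinj (x : 'rV[R]_1) (y : 'rV[R]_d) : x *m r + y *m D' = 0 -> x = 0 /\ y = 0.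
  move=> H; have : row_mx x y *m D = 0 by rewrite ED mul_row_col.
  move/eqP; rewrite mulmx_free_eq0 // => /eqP E0.
  by split; [rewrite -(row_mxKl x y)|rewrite -(row_mxKr x y)]; rewrite E0 linear0.
have D'free : row_free D'.
  by apply: inj_row_free => v vD; apply: (Dinj 0 v _).2; rewrite mul0mx vD addr0.
have [X' [C' [C'C' ED']]] := IH _ D'free.
have Xu : X' \in unitmx.
  rewrite -row_free_unit; apply: inj_row_free => v vX.
  by apply/eqP; rewrite -(mulmx_free_eq0 _ D'free) ED' mulmxA vX mul0mx.
pose r' := r - r *m C'^T *m C'.
have r'0 : r' != 0.
  apply/eqP => /eqP; rewrite subr_eq0 => /eqP Er.
  have [|/matrixP/(_ 0 0) + _] := Dinj 1%:M (- (r *m C'^T *m invmx X')).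
    by rewrite mul1mx mulNmx ED' mulmxA mulmxKV // -Er subrr.
  by rewrite !mxE => /eqP; rewrite oner_eq0.
have r'C : r' *m C'^T = 0 by rewrite mulmxBl -!mulmxA C'C' mulmx1 subrr.
have r'n : enorm r' != 0 by rewrite gt_eqF // enorm_gt0.
exists (block_mx (enorm r')%:M (r *m C'^T) 0 X' : 'M[R]_(1 + d)),
       (col_mx ((enorm r')^-1 *: r') C' : 'M[R]_(1 + d, k)); split; last first.
  rewrite ED (@mul_block_col _ 1 d 1 d k) mul0mx add0r -ED'.
  by rewrite mul_scalar_mx scalerA divff // scale1r /r' subrK.
rewrite (@tr_col_mx _ 1 d) (@mul_col_row _ 1 d k 1 d) C'C'.
have -> : (enorm r')^-1 *: r' *m ((enorm r')^-1 *: r')^T = 1%:M.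
  apply/rowP => i; rewrite ord1 linearZ /= -scalemxAl -scalemxAr !mxE eqxx mulr1n.
  have -> : \sum_j r' 0 j * r'^T j 0 = enorm r' ^+ 2.
    by rewrite enorm_sqr dotE; apply: eq_bigr => j _; rewrite [r'^T _ _]mxE.
  by field.
rewrite -scalemxAl r'C scaler0 linearZ /= -scalemxAr -[C' in C' *m _]trmxK -trmx_mul
    r'C trmx0 scaler0.
exact: esym (@scalar_mx_block _ 1 d 1).
Qed.

Definition simplex d k (q : 'I_d.+1 -> 'rV[R]_k) : set 'rV[R]_k :=
  [set p | exists a : 'I_d.+1 -> R,
     [/\ forall i, 0 <= a i, \sum_i a i = 1 & p = \sum_i a i *: q i]].

Definition edge_mx d k (q : 'I_d.+1 -> 'rV[R]_k) : 'M[R]_(d, k) :=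
  \matrix_i (q (lift ord0 i) - q ord0).

Lemma simplex_edge d k (q : 'I_d.+1 -> 'rV[R]_k) :
  simplex q = [set q ord0 + t *m edge_mx q | t in @std_simplex R d].
Proof.
apply/seteqP; split => [p [a [a0 a1 ->]]|p [t [t0 t1] <-]].
  exists (\row_i a (lift ord0 i)); first split.
  - by move=> i; rewrite mxE.
  - rewrite -a1 big_ord_recl; under eq_bigr do rewrite mxE.
    by rewrite lerDr.
  rewrite mulmx_sum_row big_ord_recl /=.
  under eq_bigr do rewrite rowK mxE scalerBr.
  rewrite sumrB -scaler_suml (_ : \sum_i a (lift ord0 i) = 1 - a ord0); last first.
    by rewrite -a1 big_ord_recl addrAC subrr add0r.
  by rewrite scalerBl scale1r opprB [LHS]addrCA [X in _ + X =
      _]addrCA subrr addr0 addrC.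
exists (fun i => if unlift ord0 i is Some j then t 0 j else 1 - \sum_j t 0 j); split.
- by move=> i; case: unliftP => [j _|_] //; rewrite subr_ge0.
- rewrite big_ord_recl unlift_none; under [X in _ + X]eq_bigr do rewrite liftK.
  by rewrite subrK.
- rewrite big_ord_recl unlift_none mulmx_sum_row; under eq_bigr do rewrite rowK
    scalerBr.
  under [X in _ = _ + X]eq_bigr do rewrite liftK.
  by rewrite sumrB -scaler_suml scalerBl scale1r -addrA; congr (_ + _); rewrite addrC.
Qed.

Lemma lebesgue_vol_simplex d (u : 'rV[R]_d) (G : 'M[R]_d) : \det G != 0 ->
  lebesgue_vol [set u + t *m G | t in @std_simplex R d] = (`|\det G| * std_vol d)%:E.
Proof.
move=> dG; have Gu : G \in unitmx by rewrite unitmxE unitfE.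
pose S := [set v : 'rV[R]_d | std_simplex (v *m invmx G)].
have mS : row_measurable S by apply: row_measurable_mulmx;
    exact: row_measurable_std_simplex.
have -> : [set u + t *m G | t in @std_simplex R d] = [set v | S (- u + v)].
  apply/seteqP; split => [v [t tS <-]|v]; rewrite /S /=.
    by rewrite addKr mulmxK.
  by move=> H; exists ((- u + v) *m invmx G) => //; rewrite mulmxKV // addNKr.
rewrite lebesgue_vol_translate // (linear_change_unit dG mS) EFinM -std_vol_fin.
by congr (_ * lebesgue_vol _)%E; apply/seteqP; split => v /=; rewrite /S /= mulmxK.
Qed.

(** Every chart gives the same value: in a chart with linear part [C] the edge matrix becomes some
    [G] with [edge_mx q = G *m C], and [C *m C^T = 1%:M] turns the Gram determinant into the square
    of [\det G]. A chart exists by [orthonormal_factor], so the default value of [xget] does not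
    occur. *)
Lemma vol_simplex d k (q : 'I_d.+1 -> 'rV[R]_k) : row_free (edge_mx q) ->
  vol d (simplex q) = std_vol d * Num.sqrt (\det (edge_mx q *m (edge_mx q)^T)).
Proof.
move=> qfree; rewrite /vol; case: xgetP => [[c0 C] _ [/= CC qC]|]; last first.
  have [X [C [CC EX]]] := orthonormal_factor qfree.
  move/(_ (q ord0, C)); case; split=> //=.
  by rewrite simplex_edge => _ [t _ <-]; exists (t *m X);
      rewrite // /affine_map /= EX mulmxA.
have qr i : exists u, q i = c0 + u *m C.
  have [|u _ <-] := qC (q i); last by exists u.
  exists (fun j => (j == i)%:R); split=> //.
    by rewrite (bigD1 i) //= eqxx big1 ?addr0 // => j /negPf ->.
  by rewrite (bigD1 i) //= eqxx scale1r big1 ?addr0 // => j /negPf ->; rewrite scale0r.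
have /choice[u qu] := qr.
pose G : 'M[R]_d := edge_mx u.
have EG : edge_mx q = G *m C.
  apply/row_matrixP => i; rewrite row_mul !rowK !qu opprD addrACA subrr add0r.
  by rewrite mulmxBl.
have dG : \det (edge_mx q *m (edge_mx q)^T) = \det G ^+ 2.
  by rewrite EG trmx_mul mulmxA -[G *m C *m _]mulmxA CC mulmx1 det_mulmx det_tr.
have dG0 : \det G != 0.
  rewrite -unitfE -unitmxE -row_free_unit; apply: inj_row_free => v vG.
  by apply/eqP; rewrite -(mulmx_free_eq0 _ qfree) EG mulmxA vG mul0mx.
have -> : affine_map (c0, C) @^-1` simplex q = [set u ord0 + t *m G | t in
    @std_simplex R d].
  rewrite simplex_edge; apply/seteqP; split => [v [t tS]|_ [t tS <-]].
    rewrite /affine_map /= qu EG -addrA => /addrI; rewrite mulmxA -mulmxDl => E.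
    exists t => //; have := congr1 (mulmx^~ C^T) E.
    by rewrite -!mulmxA CC !mulmx1.
  by exists t => //; rewrite /affine_map /= qu EG mulmxDl mulmxA addrA.
by rewrite lebesgue_vol_simplex //= dG sqrtr_sqr mulrC.
Qed.
End Simplex.

(** * The spectral gap of a weighted sum of reflections *)

Section CyclicWirtinger.
Context {R : realType}.

(** Real part of a character sum over Z/m. The frequency is a real number so that differences of
    indices may be negative. *)
Definition cos_sum (m : nat) (x : R) : R := \sum_(l < m)
    cos (l%:R * (2 * pi / m%:R * x)).

Lemma cos_sumN m x : cos_sum m (- x) = cos_sum m x.
Proof. by apply: eq_bigr => l _; rewrite !mulrN cosN. Qed.

Lemma cos_2pi_nat (l : nat) : cos (l%:R * (2 * pi)) = 1 :> R.
Proof.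
elim: l => [|l IH]; first by rewrite mul0r cos0.
by rewrite -natr1 mulrDl mul1r [2 * pi]mulr_natl cosD2pi -[pi *+ 2]mulr_natl.
Qed.

Lemma sin_2pi_natD (l : nat) (x : R) : sin (l%:R * (2 * pi) + x) = sin x.
Proof.
elim: l => [|l IH]; first by rewrite mul0r add0r.
rewrite -natr1 mulrDl mul1r [2 * pi]mulr_natl addrAC sinD2pi -[pi *+ 2]mulr_natl //.
Qed.

Lemma cos_sum0 m : cos_sum m 0 = m%:R.
Proof.
rewrite /cos_sum; under eq_bigr do rewrite !mulr0 cos0.
by rewrite sumr_const card_ord.
Qed.

Lemma cos_sumn m : cos_sum m m%:R = m%:R.
Proof.
case: m => [|m]; first by rewrite /cos_sum big_ord0.
rewrite /cos_sum; under eq_bigr do rewrite divfK ?pnatr_eq0 // cos_2pi_nat.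
by rewrite sumr_const card_ord.
Qed.

Lemma cos_sum_eq0 m (r : nat) : (0 < r < m)%N -> cos_sum m r%:R = 0.
Proof.
move=> /andP[r0 rm].
have mp : 0 < (m%:R : R) by rewrite ltr0n (leq_trans _ rm).
have m0 : (m%:R : R) != 0 by rewrite gt_eqF.
pose h : R := pi * r%:R / m%:R.
have sh : sin h != 0.
  have h0 : 0 < h by rewrite divr_gt0 // mulr_gt0 ?pi_gt0 // ltr0n.
  have hpi : h < pi by rewrite ltr_pdivrMr // ltr_pM2l ?pi_gt0 // ltr_nat.
  by rewrite gt_eqF // sin_gt0_pi // h0 hpi.
(* Multiplied by sin h, each cosine is half a difference of two sines at odd multiples of h, and the
   sum telescopes over r full turns. *)
apply: (mulfI sh); rewrite mulr0 mulr_sumr.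
have -> : \sum_(i < m) sin h * cos (i%:R * (2 * pi / m%:R * r%:R)) =
    \sum_(0 <= i < m) (sin (i.+1%:R * (2 * h) - h) / 2 - sin (i%:R * (2 * h) - h) / 2).
  rewrite big_mkord; apply: eq_bigr => i _.
  have -> : i.+1%:R * (2 * h) - h = i%:R * (2 * h) + h by rewrite -natr1; ring.
  rewrite sinD sinB (_ : 2 * pi / m%:R * r%:R = 2 * h); first by field.
  by rewrite /h; field.
rewrite telescope_sumr // mul0r add0r sinN.
have -> : m%:R * (2 * h) - h = r%:R * (2 * pi) + (- h) by rewrite /h; field.
by rewrite sin_2pi_natD sinN subrr.
Qed.

Context {N : nat}.
Variables (U : 'M[R]_N) (m : nat).
Hypothesis m2 : (2 <= m)%N.
Hypothesis UU : U *m U^T = 1%:M.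
Hypothesis Um : U ^+ m = 1%:M.

Lemma dot_iter (v : 'rV[R]_N) i j : dot (v *m U ^+ (i + j)) (v *m U ^+ i)
    = dot (v *m U ^+ j) v.
Proof.
have UUi : U ^+ i *m (U ^+ i)^T = 1%:M.
  elim: i => [|i IH]; first by rewrite expr0 trmx1 mulmx1.
  by rewrite exprS trmx_mul mulmxA -(mulmxA U) IH mulmx1.
by rewrite addnC exprD mulmxA dot_isometry.
Qed.

(* Parseval on Z/m: expand |sum_j exp(i l j th) v U^j|^2 and sum over l against 1 and cos(l th). *)
Lemma cyclic_wirtinger (v : 'rV[R]_N) : \sum_(l < m) v *m U ^+ l = 0 ->
  dot (v *m U) v <= cos (2 * pi / m%:R) * dot v v.
Proof.
move=> v0; have m0 : (m%:R : R) != 0 by rewrite pnatr_eq0; case: m m2.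
pose th : R := 2 * pi / m%:R.
have th0 : 0 <= th by rewrite divr_ge0 // mulr_ge0 // pi_ge0.
pose F (j : 'I_m) := v *m U ^+ j.
pose A (l : 'I_m) := \sum_(j < m) cos (l%:R * (th * j%:R)) *: F j.
pose B (l : 'I_m) := \sum_(j < m) sin (l%:R * (th * j%:R)) *: F j.
pose W l := dot (A l) (A l) + dot (B l) (B l).
have W0 l : 0 <= W l by rewrite addr_ge0 ?dot_ge0.
have WE l : W l = \sum_(i < m) \sum_(j < m) cos (l%:R * (th * (i%:R - j%:R)))
    * dot (F i) (F j).
  rewrite /W /A /B !dot_suml -big_split /=; apply: eq_bigr => i _.
  rewrite !dot_sumr -big_split /=; apply: eq_bigr => j _.
  by rewrite !dotZl !dotZr mulrBr mulrBr cosB; ring.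
have S1 : \sum_(l < m) W l = m%:R * m%:R * dot v v.
  under eq_bigr do rewrite WE.
  rewrite exchange_big /=; transitivity (\sum_(i < m) m%:R * dot v v); last first.
    by rewrite sumr_const card_ord -[LHS]mulr_natl mulrA.
  apply: eq_bigr => i _; rewrite exchange_big /= (bigD1 i) //= [X in _ + X]big1 ?addr0.
    rewrite subrr -mulr_suml -[X in X * _]/(cos_sum m 0) cos_sum0; congr (_ * _).
    by have := dot_iter v i 0; rewrite addn0 expr0 mulmx1 /F.
  move=> j ji; rewrite -mulr_suml -[X in X * _]/(cos_sum m (i%:R - j%:R)).
  have [ij|ij|/val_inj ij] := ltngtP i j; last by rewrite ij eqxx in ji.
    rewrite -opprB cos_sumN -natrB ?(ltnW ij) // cos_sum_eq0 ?mul0r // subn_gt0 ij /=.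
    by apply: leq_ltn_trans (ltn_ord j); rewrite leq_subr.
  rewrite -natrB ?(ltnW ij) // cos_sum_eq0 ?mul0r // subn_gt0 ij /=.
  by apply: leq_ltn_trans (ltn_ord i); rewrite leq_subr.
have fU (i : 'I_m) : dot (F (ordS i)) (F i) = dot (v *m U) v.
  have -> : F (ordS i) = v *m U ^+ i.+1.
    rewrite /F /=; have [im|im] := ltnP i.+1 m; first by rewrite modn_small.
    have -> : i.+1 = m by apply/eqP; rewrite eqn_leq im andbT ltn_ord.
    by rewrite modnn Um expr0.
  by have := dot_iter v i 1; rewrite addn1 expr1.
have S2 : \sum_(l < m) cos (l%:R * th) * W l = m%:R * m%:R * dot (v *m U) v.
  have E2 (l : 'I_m) : cos (l%:R * th) * W l =
     \sum_(i < m) \sum_(j < m) (cos (l%:R * (th * (i%:R - j%:R + 1)))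
         + cos (l%:R * (th * (i%:R - j%:R - 1)))) / 2 * dot (F i) (F j).
    rewrite WE mulr_sumr; apply: eq_bigr => i _; rewrite mulr_sumr;
        apply: eq_bigr => j _.
    rewrite mulrA; congr (_ * _).
    have -> : l%:R * (th * (i%:R - j%:R + 1)) = l%:R * (th * (i%:R - j%:R))
        + l%:R * th by ring.
    have -> : l%:R * (th * (i%:R - j%:R - 1)) = l%:R * (th * (i%:R - j%:R))
        - l%:R * th by ring.
    by rewrite cosD cosB; field.
  under eq_bigr do rewrite E2.
  (* The integer i - j + 1 lies between 2 - m and m, and the sum vanishes except at 0 and at m. The
     value m is the wrap-around from i = m - 1 to j = 0. *)
  have delta (i j : 'I_m) : cos_sum m (i%:R - j%:R + 1) = m%:R * (j == ordS i)%:R.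
    have [ij|ij] := leqP j i.+1; last first.
      have -> : i%:R - j%:R + 1 = - (j - i.+1)%:R :> R by rewrite natrB ?(ltnW ij)
          // -natr1; ring.
      rewrite cos_sumN cos_sum_eq0; last first.
        by rewrite subn_gt0 ij /=; apply: leq_ltn_trans (ltn_ord j); rewrite leq_subr.
      case: eqP => [ji|]; last by rewrite mulr0.
      move: ij; rewrite ji /=; have : (i.+1 %% m <= i.+1)%N by exact: leq_mod.
      by rewrite ltnNge => ->.
    have -> : i%:R - j%:R + 1 = (i.+1 - j)%:R :> R by rewrite natrB // -natr1; ring.
    have [E|E] := eqVneq (i.+1 - j)%N 0%N.
      have ji : (j = i.+1 :> nat) by apply/eqP; rewrite eqn_leq ij -subn_eq0 E.
      rewrite E cos_sum0 (_ : j == ordS i) ?mulr1 //.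
      by apply/eqP/val_inj; rewrite /= modn_small // -ji.
    have [Em|Em] := eqVneq (i.+1 - j)%N m.
      have j0 : j = 0%N :> nat.
        by apply/eqP; rewrite -leqn0 -(leq_add2l m) addn0 -{1}Em subnK // ltn_ord.
      have im : i.+1 = m by move: Em; rewrite j0 subn0.
      by rewrite Em cos_sumn (_ : j == ordS i) ?mulr1 //; apply/eqP/val_inj;
          rewrite /= im modnn.
    rewrite cos_sum_eq0; last first.
      by rewrite lt0n E /= ltn_neqAle Em /=; apply: leq_trans (ltn_ord i);
          rewrite leq_subr.
    case: eqP => [ji|]; last by rewrite mulr0.
    have jE : j = (i.+1 %% m)%N :> nat by rewrite ji.
    have [im|im] := ltnP i.+1 m; first by move: E; rewrite jE modn_small // subnn.
    have im' : i.+1 = m by apply/eqP; rewrite eqn_leq im andbT ltn_ord.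
    by move: Em; rewrite jE im' modnn subn0 eqxx.
  rewrite exchange_big /=; under eq_bigr => i _ do rewrite exchange_big /=.
  have E3 (i j : 'I_m) :
    \sum_(l < m) (cos (l%:R * (th * (i%:R - j%:R + 1)))
        + cos (l%:R * (th * (i%:R - j%:R - 1)))) / 2 * dot (F i) (F j)
    = m%:R / 2 * ((j == ordS i)%:R * dot (v *m U) v) + m%:R / 2 * ((i == ordS j)%:R *
        dot (v *m U) v).
    rewrite -mulr_suml -mulr_suml big_split /= -!/(cos_sum m _) delta.
    have -> : i%:R - j%:R - 1 = - (j%:R - i%:R + 1) :> R by ring.
    rewrite cos_sumN delta.
    case: (j =P ordS i) => [->|_]; case: (_ =P ordS _) => [E|_].
    - by rewrite dotC fU; field.
    - by rewrite dotC fU; field.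
    - by rewrite E fU; field.
    - by rewrite !mulr0 addr0 !mul0r !mulr0 addr0.
  under eq_bigr => i _ do under eq_bigr => j _ do rewrite E3.
  under eq_bigr => i _ do rewrite big_split /= -!mulr_sumr -!mulr_suml.
  rewrite big_split /= -!mulr_sumr -!mulr_suml.
  have E4 : \sum_(i < m) \sum_(j < m) (j == ordS i)%:R = m%:R :> R.
    rewrite -[RHS](_ : \sum_(i < m) 1 = _); last by rewrite sumr_const card_ord.
    apply: eq_bigr => i _; rewrite (bigD1 (ordS i)) //= eqxx big1 ?addr0 //.
    by move=> j /negPf ->.
  by rewrite E4 [X in _ + _ * (X * _)]exchange_big /= E4; field.
(* The hypothesis on [v] removes the frequency 0. Among the others cos (l th) is largest at l = 1:
   angles beyond pi are reflected by replacing l with m - l, and cosine decreases on [0, pi]. *)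
have c1 (l : 'I_m) : l != 0%N :> nat -> cos (l%:R * th) <= cos th.
  move=> l0.
  have E : cos (l%:R * th) = cos ((m - l)%:R * th).
    have -> : l%:R * th = pi *+ 2 - (m - l)%:R * th.
      by rewrite natrB ?(ltnW (ltn_ord l)) // /th; field.
    by rewrite addrC cosD2pi cosN.
  have decr (a : nat) : (0 < a)%N -> a%:R * th <= pi -> cos (a%:R * th) <= cos th.
    move=> a0 ap; have tha : th <= a%:R * th by rewrite ler_peMl // ler1n.
    rewrite leNgt ltr_cos ?in_itv /= ?ap ?(le_trans tha ap) ?andbT -?leNgt //.
    exact: le_trans th0 tha.
  have [lp|lp] := leP (l%:R * th) pi; first by rewrite decr // lt0n.
  rewrite E decr ?subn_gt0 // natrB ?(ltnW (ltn_ord l)) // mulrBl.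
  have -> : m%:R * th = 2 * pi by rewrite /th; field.
  by rewrite lerBlDr; move: lp; lra.
have W00 (l : 'I_m) : l = 0%N :> nat -> W l = 0.
  move=> l0; rewrite /W /A /B l0.
  under eq_bigr do rewrite mul0r cos0 scale1r.
  under [X in _ + dot X _]eq_bigr do rewrite mul0r sin0 scale0r.
  by rewrite v0 dot0l big1 // dot0l addr0.
have mm : 0 < (m%:R * m%:R : R) by rewrite mulr_gt0 // ltr0n; case: m m2.
rewrite -(ler_pM2l mm) -S2 mulrCA -S1 mulr_sumr; apply: ler_sum => l _.
have [l0|l0] := eqVneq (l : nat) 0%N; first by rewrite W00 // !mulr0.
by rewrite ler_wpM2r // c1.
Qed.
End CyclicWirtinger.

(** For a symmetric involution [S], the orthogonal projection (1 - S) / 2 onto its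
    (-1)-eigenspace. *)
Definition anti {R : realType} {N : nat} (S : 'M[R]_N) (v : 'rV[R]_N) : 'rV[R]_N :=
  2^-1 *: (v - v *m S).

Section InvolutionPair.
Context {R : realType} {N : nat}.

Lemma dot_sym_mulmx (S : 'M[R]_N) (u v : 'rV[R]_N) : S^T = S ->
  dot (u *m S) v = dot u (v *m S).
Proof. by move=> SS; rewrite dot_mulmx_trmx SS. Qed.

Lemma anti_sym (S : 'M[R]_N) (u v : 'rV[R]_N) : S^T = S ->
  dot (anti S u) v = dot u (anti S v).
Proof. by move=> SS; rewrite /anti dotZl dotZr dotBl dotBr dot_sym_mulmx. Qed.

Lemma antiK (S : 'M[R]_N) (u : 'rV[R]_N) : S *m S = 1%:M ->
    anti S (anti S u) = anti S u.
Proof.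
move=> S2; rewrite /anti -scalemxAl mulmxBl -mulmxA S2 mulmx1 -scalerBr opprB.
by rewrite -mulr2n -[(u - _) *+ 2]scaler_nat !scalerA; congr (_ *: _); field.
Qed.

Lemma antiD (S : 'M[R]_N) (u v : 'rV[R]_N) : anti S (u + v) = anti S u + anti S v.
Proof. by rewrite /anti mulmxDl opprD addrACA scalerDr. Qed.

Lemma anti_mul (S : 'M[R]_N) (u : 'rV[R]_N) : S *m S = 1%:M ->
    anti S u *m S = - anti S u.
Proof.
by move=> S2; rewrite /anti -scalemxAl mulmxBl -mulmxA S2 mulmx1 -scalerN opprB.
Qed.

Variables (S T : 'M[R]_N) (m : nat).
Hypotheses (ST : S^T = S) (TT : T^T = T) (S2 : S *m S = 1%:M) (T2 : T *m T = 1%:M).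
Hypotheses (m2 : (2 <= m)%N) (STm : (S *m T) ^+ m = 1%:M).

Let U := S *m T.
Let ortho (v : 'rV[R]_N) := forall f : 'rV[R]_N, f *m U = f -> dot v f = 0.

Let UU : U *m U^T = 1%:M.
Proof. by rewrite /U trmx_mul ST TT mulmxA -(mulmxA S) T2 mulmx1 S2. Qed.

Let fixE (f : 'rV[R]_N) : f *m U = f -> f *m S = f *m T.
Proof. by move=> fU; rewrite -{2}fU /U mulmxA -mulmxA T2 mulmx1. Qed.

Let fixT (f : 'rV[R]_N) : f *m U = f -> f *m T *m U = f *m T.
Proof. by move=> fU; rewrite -(fixE fU) /U !mulmxA -(mulmxA f) S2 mulmx1 fixE. Qed.

Let iterU (f : 'rV[R]_N) l : f *m U = f -> f *m U ^+ l = f.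
Proof.
move=> fU; elim: l => [|l IH]; first by rewrite expr0 mulmx1.
by rewrite exprS mulmxA fU.
Qed.

Let powS n : U ^+ n *m U = U ^+ n.+1. Proof. by rewrite exprSr. Qed.

Let sum_iterU (v : 'rV[R]_N) : (\sum_(l < m) v *m U ^+ l) *m U = \sum_(l < m)
    v *m U ^+ l.
Proof.
rewrite mulmx_suml; case: m m2 STm => // n _ Un.
rewrite big_ord_recr [RHS]big_ord_recl /= -mulmxA powS Un addrC expr0; congr (_ + _).
by apply: eq_bigr => i _; rewrite -mulmxA powS.
Qed.

Let ortho_sum v : ortho v -> \sum_(l < m) v *m U ^+ l = 0.
Proof.
move=> vo; set x := \sum_(l < m) _; apply/eqP; rewrite -dot_eq0 {1}/x dot_suml big1
    // => l _.
have xU : x *m U = x by exact: sum_iterU.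
have E i : U ^+ i *m (U ^+ i)^T = 1%:M.
  elim: i => [|i IH]; first by rewrite expr0 trmx1 mulmx1.
  by rewrite exprS trmx_mul mulmxA -(mulmxA U) IH mulmx1.
by rewrite -(iterU l xU) dot_isometry // vo.
Qed.

Let ortho_split (v : 'rV[R]_N) : exists2 v0, v0 *m U = v0 & ortho (v - v0).
Proof.
have m0 : (m%:R : R) != 0 by rewrite pnatr_eq0; case: m m2.
exists (m%:R^-1 *: \sum_(l < m) v *m U ^+ l) => [|f fU];
    first by rewrite -scalemxAl sum_iterU.
rewrite dotBl dotZl dot_suml (eq_bigr (fun=> dot v f)) => [|l _].
  by rewrite sumr_const card_ord -[X in _^-1 * X]mulr_natl mulKf // subrr.
have E i : U ^+ i *m (U ^+ i)^T = 1%:M.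
  elim: i => [|i IH]; first by rewrite expr0 trmx1 mulmx1.
  by rewrite exprS trmx_mul mulmxA -(mulmxA U) IH mulmx1.
by rewrite -{1}(iterU l fU) dot_isometry.
Qed.

Let ortho_anti v : ortho v -> ortho (anti T v).
Proof.
move=> vo f fU; rewrite anti_sym // /anti dotZr dotBr vo // vo ?subrr ?mulr0 //.
exact: fixT.
Qed.

Lemma cos_pi_div_ge0 : 0 <= cos (pi / m%:R : R).
Proof.
have m0 : 0 < (m%:R : R) by rewrite ltr0n; case: m m2.
apply: cos_ge0_pihalf; apply/andP; split.
  by apply: (@le_trans _ _ 0); rewrite ?oppr_le0 ?divr_ge0 ?pi_ge0.
by rewrite ler_pM2l ?pi_gt0 // lef_pV2 ?posrE // ler_nat.
Qed.

(** On the (-1)-eigenspace of [T] the quadratic form of [U] is minus that of [S]. The bound cos (2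
    pi / m) for [U] thus becomes (1 + cos (2 pi / m)) / 2 = cos (pi / m)^2 for the projection. *)
Let anti_ortho_le b : ortho b -> b *m T = - b ->
  dot (anti S b) (anti S b) <= cos (pi / m%:R) ^+ 2 * dot b b.
Proof.
move=> bo bT; have := cyclic_wirtinger m2 UU STm (ortho_sum bo).
have -> : dot (b *m U) b = - dot b (b *m S).
  by rewrite /U mulmxA dot_sym_mulmx // bT dotNr dotC.
have -> : 2 * pi / m%:R = (pi / m%:R) *+ 2 :> R by rewrite -[RHS]mulr_natl mulrA.
rewrite cosD [in sin _ * _]/= -!expr2 => H.
have cs := cos2Dsin2 (pi / m%:R : R).
have -> : dot (anti S b) (anti S b) = (dot b b - dot b (b *m S)) / 2.
  by rewrite anti_sym // antiK // /anti dotZr dotBr mulrC.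
have bb := dot_ge0 b; nra.
Qed.

(* Split off the part of v fixed by S T: there both projections agree, and on the
   orthogonal complement the product of the projections has norm at most
   cos (pi / m). *)
Lemma anti_dot_ge v :
  - cos (pi / m%:R) * (enorm (anti S v) * enorm (anti T v)) <= dot (anti S v)
      (anti T v).
Proof.
have [v0 v0U vo] := ortho_split v.
set v1 := v - v0 in vo; have Ev : v = v0 + v1 by rewrite addrC subrK.
have aE : anti S v0 = anti T v0 by rewrite /anti fixE.
set a := anti S v0 in aE.
have aU : a *m U = a.
  by rewrite aE /anti -scalemxAl mulmxBl v0U fixT.
have aS : anti S a = a by rewrite antiK.
have aT : anti T a = a by rewrite aE antiK.
have oS : dot a (anti S v1) = 0 by rewrite -anti_sym // aS dotC vo.
have oT : dot a (anti T v1) = 0 by rewrite -anti_sym // aT dotC vo.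
have ES : dot (anti S v) (anti S v) = dot a a + dot (anti S v1) (anti S v1).
  by rewrite Ev antiD dotDl !dotDr -/a oS (dotC _ a) oS addr0 add0r.
have ET : dot (anti T v) (anti T v) = dot a a + dot (anti T v1) (anti T v1).
  by rewrite Ev antiD dotDl !dotDr -aE oT (dotC _ a) oT addr0 add0r.
have -> : dot (anti S v) (anti T v) = dot a a + dot (anti S v1) (anti T v1).
  by rewrite Ev (antiD S) (antiD T) -aE -/a dotDl !dotDr oT (dotC _ a) oS addr0 add0r.
have aa := dot_ge0 a; have c0 := cos_pi_div_ge0.
have H1 : - (cos (pi / m%:R) * (enorm (anti S v1) * enorm (anti T v1)))
    <= dot (anti S v1) (anti T v1).
  have -> : dot (anti S v1) (anti T v1) = dot (anti S v1) (anti S (anti T v1)).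
    by rewrite [RHS]anti_sym // antiK // anti_sym.
  have := cauchy_schwarz (anti S v1) (anti S (anti T v1)).
  rewrite ler_norml => /andP[H _]; apply: le_trans H; rewrite lerN2 mulrCA.
  rewrite ler_wpM2l ?enorm_ge0 //.
  rewrite -(@ler_pXn2r _ 2) ?nnegrE ?mulr_ge0 ?enorm_ge0 // exprMn !enorm_sqr.
  by apply: anti_ortho_le; [exact: ortho_anti|exact: anti_mul].
have le1 : enorm (anti S v1) <= enorm (anti S v) by rewrite ler_wsqrtr // ES lerDr.
have le2 : enorm (anti T v1) <= enorm (anti T v) by rewrite ler_wsqrtr // ET lerDr.
have := ler_pM (enorm_ge0 _) (enorm_ge0 _) le1 le2 => H2.
have := ler_wpM2l c0 H2; lra.
Qed.
End InvolutionPair.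

Section SpectralGap.
Context {R : realType} {k N : nat}.
Variables (m : 'I_k -> 'I_k -> nat) (S : 'I_k -> 'M[R]_N).
Hypotheses (ST : forall i, (S i)^T = S i) (S2 : forall i, S i *m S i = 1%:M).
Hypothesis m2 : forall i j, i != j -> (2 <= m i j)%N.
Hypothesis Sm : forall i j, i != j -> (S i *m S j) ^+ m i j = 1%:M.
Variables (B : 'M[R]_k) (mu a : 'I_k -> R) (c : R).
Hypothesis Bd : forall i, B i i = 1.
Hypothesis Bo : forall i j, i != j -> B i j = - cos (pi / (m i j)%:R).
Hypothesis BT : forall i j, B i j = B j i.
Hypotheses (mu0 : forall i, 0 < mu i) (a0 : forall i, 0 < a i).
Hypothesis Bc : forall i, \sum_j B i j * (mu j * a j) = c * a i.

(* Substituting x i = z i * a i turns the difference of the two sides into a sum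
   of squares (z i - z j)^2 with coefficients - B i j >= 0. *)
Lemma ground_state (x : 'I_k -> R) :
  c * \sum_i mu i * x i ^+ 2 <= \sum_i \sum_j mu i * mu j * B i j * (x i * x j).
Proof.
pose z i := x i / a i.
have xE i : x i = z i * a i by rewrite /z divfK // gt_eqF.
have E : c * \sum_i mu i * x i ^+ 2 =
    \sum_i \sum_j mu i * mu j * B i j * (a i * a j) * z i ^+ 2.
  rewrite mulr_sumr; apply: eq_bigr => i _.
  transitivity (mu i * z i ^+ 2 * a i * (c * a i)); first by rewrite xE; ring.
  by rewrite -Bc mulr_sumr; apply: eq_bigr => j _; ring.
have E' : c * \sum_i mu i * x i ^+ 2 =
    \sum_i \sum_j mu i * mu j * B i j * (a i * a j) * z j ^+ 2.
  rewrite E exchange_big /=; apply: eq_bigr => i _; apply: eq_bigr => j _.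
  by rewrite BT; ring.
rewrite -(@ler_pM2l _ 2) // mulr_natl mulr2n {1}E E' -!big_split /= mulr_sumr.
apply: ler_sum => i _; rewrite -big_split /= mulr_sumr; apply: ler_sum => j _.
rewrite -subr_ge0 [X in 0 <= X](_ : _ = - B i j * (mu i * mu j * (a i * a j))
    * (z i - z j) ^+ 2); last first.
  by rewrite !xE; ring.
have [->|ij] := eqVneq i j; first by rewrite subrr expr0n mulr0.
rewrite Bo // opprK mulr_ge0 ?sqr_ge0 // mulr_ge0 ?cos_pi_div_ge0 ?m2 //.
by rewrite !mulr_ge0 // ltW.
Qed.

Hypothesis mu1 : \sum_i mu i = 1.

(** With L = sum_i mu_i P_i, the alternative is decided by <L v, v> = sum_i mu_i |P_i v|^2. If it
    vanishes, so does each P_i v and [v] is fixed. Otherwise c l |v|^2 <= l^2 |v|^2 may be divided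
    by l |v|^2 > 0. *)
Lemma spectral_gap (v : 'rV[R]_N) (tau : R) :
  \sum_i mu i *: (v *m S i) = tau *: v ->
  (forall i, v *m S i = v) \/ c <= (1 - tau) / 2.
Proof.
move=> vtau; set l := (1 - tau) / 2.
have Lv : \sum_i mu i *: anti (S i) v = l *: v.
  rewrite /anti; under eq_bigr do rewrite scalerA mulrC -scalerA scalerBr.
  by rewrite -scaler_sumr sumrB -scaler_suml mu1 vtau -scalerBl scalerA [2^-1 * _]mulrC.
pose x i := enorm (anti (S i) v).
have Lvv : l * dot v v = \sum_i mu i * x i ^+ 2.
  rewrite -dotZl -Lv dot_suml; apply: eq_bigr => i _.
  by rewrite dotZl /x enorm_sqr [in RHS]anti_sym // antiK // anti_sym.
have LL : l * (l * dot v v) >= c * (l * dot v v).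
  rewrite [in leLHS]Lvv; apply: le_trans (ground_state x) _.
  rewrite -dotZl -dotZr -Lv dot_suml; apply: ler_sum => i _.
  rewrite dot_sumr; apply: ler_sum => j _; rewrite dotZl dotZr mulrA -!mulrA.
  rewrite !ler_pM2l //; have [->|ij] := eqVneq i j; first by rewrite Bd mul1r /x
      -expr2 enorm_sqr.
  by rewrite Bo // anti_dot_ge // ?m2 // Sm.
have [E0|N0] := eqVneq (\sum_i mu i * x i ^+ 2) 0.
  left => i; move/eqP: E0; rewrite psumr_eq0; last by move=> j _;
      rewrite mulr_ge0 ?sqr_ge0 // ltW.
  move/allP/(_ i (mem_index_enum i)); rewrite /= mulf_eq0 gt_eqF //= sqrf_eq0.
  rewrite /x sqrtr_eq0 le_eqVlt ltNge dot_ge0 orbF dot_eq0 /anti scaler_eq0 invr_eq0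
      pnatr_eq0 /=.
  by rewrite subr_eq0 => /eqP.
right; rewrite -Lvv in N0.
have : 0 < l * dot v v.
  by rewrite lt_neqAle eq_sym N0 Lvv sumr_ge0 // => i _;
      rewrite mulr_ge0 ?sqr_ge0 // ltW.
by move=> p; rewrite -(ler_pM2r p).
Qed.
End SpectralGap.

(** * Eigenvalues of symmetric matrices *)

Section SymmetricSpectrum.
Context {R : realType}.

Import complex.

(** Descent from the complex numbers: the complexified matrix is Hermitian with real spectral
    values, and the minimal polynomial does not change under field extension, so over the reals it
    still splits into distinct linear factors. *)
Lemma symmetric_diagonalizable n (A : 'M[R]_n) : A^T = A -> diagonalizable A.
Proof.
case: n A => [|n] A AT; first by rewrite [A](_ : _ = 0);
    [exact: diagonalizable0|apply/matrixP => -[]].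
pose f := real_complex R.
have fAsym : map_mx f A \is symmetricmx.
  by apply/is_hermitianmxP; rewrite expr0 scale1r map_mx_id // map_trmx AT.
have fAreal : map_mx f A \is a realmx.
  by apply/mxOverP => i j; rewrite mxE; apply/complex_realP; exists (A i j).
have fAherm := realsym_hermsym fAsym fAreal.
have /orthomx_spectralP fAE := hermitian_normalmx fAherm.
have dreal := hermitian_spectral_diag_real fAherm.
set P := spectralmx _ in fAE; set d := spectral_diag _ in fAE dreal.
have Pu : P \in unitmx := spectral_unit _.
have Pdiag : diagonalizable_for P (map_mx f A).
  apply/(diagonalizable_forLR Pu); exists d.
  by rewrite mxpoly.conjVmx.
have := diagonalizable_for_mxminpoly Pu Pdiag; rewrite mxminpoly_map.
set rs := undup _ => E.
pose rs' := [seq complex.Re r | r <- rs].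
have rsE : rs = [seq f r | r <- rs'].
  rewrite -map_comp -[LHS]map_id; apply/eq_in_map => r rrs /=.
  rewrite /f RRe_real //; move: rrs; rewrite mem_undup => /mapP[i _ ->].
  have -> : mxpoly.conjmx P (map_mx f A) = diag_mx d.
    by rewrite mxpoly.conjumx // fAE !mulmxA mulmxV // mul1mx mulmxK.
  by rewrite mxE eqxx mulr1n; exact/mxOverP.
apply/diagonalizableP; exists rs'.
  by rewrite -(map_inj_uniq (@complexI R)) -[map _ _]rsE undup_uniq.
suff -> : mxminpoly A = \prod_(x <- rs') ('X - x%:P) by [].
apply: (map_poly_inj f); rewrite E rsE big_map rmorph_prod /=.
by apply: eq_bigr => x _; rewrite rmorphB /= map_polyX map_polyC.
Qed.

Lemma symmetric_diag_form n (A : 'M[R]_n) : A^T = A ->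
  exists (P : 'M[R]_n) (d : 'rV[R]_n), P \in unitmx /\ P *m A = diag_mx d *m P.
Proof.
move=> /symmetric_diagonalizable[P Pu /(diagonalizable_forLR Pu)[d ->]].
exists P, d; split=> //.
by rewrite mxpoly.conjVmx // !mulmxA mulmxV // mul1mx.
Qed.

(** The characteristic polynomial determines the chosen list up to order. Diagonalisability turns
    the one-dimensional 1-eigenspace into a single occurrence of 1 in the list, and all later
    entries are then at most [lam], which does occur. *)
Lemma second_eigenvalueE n (A : 'M[R]_n) (u v : 'rV[R]_n) (lam : R) : A^T = A ->
  u != 0 -> u *m A = u -> (forall x : 'rV[R]_n, x *m A = x -> exists c, x = c *: u) ->
  v != 0 -> v *m A = lam *: v -> lam < 1 ->
  (forall (x : 'rV[R]_n) tau, x != 0 -> x *m A = tau *: x -> tau = 1 \/ tau <= lam) ->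
  second_eigenvalue A = lam.
Proof.
move=> AT u0 uA uniq1 v0 vA lam1 gap.
have [P [d [Pu PA]]] := symmetric_diag_form AT.
have Prow i : row i P *m A = d 0 i *: row i P.
  by rewrite -row_mul PA row_mul row_diag_mx -scalemxAl -rowE.
have Prow0 i : row i P != 0.
  apply: contraTneq Pu => Pi0; rewrite -row_free_unit; apply/negP => Pf.
  have : (delta_mx 0 i : 'rV[R]_n) *m P = 0 by rewrite -rowE.
  move/eqP; rewrite mulmx_free_eq0 // => /eqP /matrixP/(_ 0 i)/eqP.
  by rewrite !mxE !eqxx oner_eq0.
pose s := [seq d 0 i | i <- enum 'I_n].
have charA : char_poly A = \prod_(x <- s) ('X - x%:P).
  have -> : char_poly A = char_poly (diag_mx d).
    have dP : \det (map_mx polyC P) != 0.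
      by rewrite det_map_mx polyC_eq0 -unitfE -unitmxE.
    have E : map_mx polyC P *m char_poly_mx A = char_poly_mx (diag_mx d)
        *m map_mx polyC P.
      by rewrite /char_poly_mx mulmxBr mulmxBl scalar_mxC -!map_mxM PA.
    by apply: (mulfI dP); rewrite /char_poly -det_mulmx E det_mulmx mulrC.
  rewrite char_poly_trig ?diag_mx_is_trig // /s big_map big_enum /=.
  by apply: eq_bigr => i _; rewrite mxE eqxx mulr1n.
have sP x : x \in s -> x = 1 \/ x <= lam.
  by move=> /mapP[i _ ->]; exact: gap (Prow0 i) (Prow i).
have ins (y : 'rV[R]_n) x : y != 0 -> y *m A = x *: y -> x \in s.
  move=> y0 yA; have : eigenvalue A x by apply/eigenvalueP; exists y.
  by rewrite eigenvalue_root_char charA root_prod_XsubC.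
have s1 : 1 \in s by apply: (ins u) => //; rewrite scale1r.
have slam : lam \in s by apply: (ins v).
(* Two diagonal entries equal to 1 would make two rows of the invertible [P] multiples of [u]. *)
have count1 : (count_mem (1%R : R) s <= 1)%N.
  rewrite /s count_map -size_filter leqNgt; apply/negP => sz.
  set t := [seq _ <- _ | _] in sz.
  have tu : uniq t by rewrite filter_uniq // enum_uniq.
  case Et : t sz tu => [|i [|j t']] //= _ /andP[]; rewrite inE negb_or => /andP[ij _] _.
  have d1 l : l \in t -> d 0 l = 1 by rewrite mem_filter => /andP[/eqP].
  have [ci Ei] : exists c, row i P = c *: u.
    by apply: uniq1; rewrite Prow d1 ?scale1r // Et inE eqxx.
  have [cj Ej] : exists c, row j P = c *: u.
    by apply: uniq1; rewrite Prow d1 ?scale1r // Et !inE eqxx orbT.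
  have : (cj *: (delta_mx 0 i : 'rV[R]_n) - ci *: delta_mx 0 j) *m P = 0.
    by rewrite mulmxBl -!scalemxAl -!rowE Ei Ej !scalerA mulrC subrr.
  move/eqP; rewrite mulmx_free_eq0 ?row_free_unit // => /eqP /matrixP/(_ 0 i).
  rewrite !mxE !eqxx (negPf ij) mulr0 subr0 mulr1 => cj0.
  by have := Prow0 j; rewrite Ej cj0 scale0r eqxx.
rewrite /second_eigenvalue /spectrum; case: xgetP => [e _ /= [es]|]; last first.
  move/(_ (sort (fun x y => y <= x) s)); case; split=> /=.
    by apply: sort_sorted => x y; exact: le_total.
  by rewrite charA; apply: perm_big; rewrite perm_sym perm_sort.
rewrite charA => /prod_XsubC_eq se.
have mem_e x : (x \in e) = (x \in s) by rewrite (perm_mem se).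
have counte : (count_mem (1%R : R) e <= 1)%N by move/seq.permP: (se) => <-.
case: e es se mem_e counte => [|x [|y e]] es se mem_e counte.
- by have := mem_e 1; rewrite s1.
- have := mem_e 1; have := mem_e lam; rewrite s1 slam !inE => /eqP El /eqP E1.
  by rewrite El -E1 ltxx in lam1.
have tr : transitive (fun x y : R => y <= x) by move=> a b c ba ca;
    exact: le_trans ca ba.
have le_x z : z \in y :: e -> z <= x.
  have : path (fun x y : R => y <= x) x (y :: e) by [].
  by rewrite path_sortedE // => /andP[/allP + _]; exact.
have le_y z : z \in e -> z <= y.
  have : path (fun x y : R => y <= x) y e by case/andP: es.
  by rewrite path_sortedE // => /andP[/allP + _]; exact.
have x1 : x = 1.
  have xs : x \in s by rewrite -mem_e inE eqxx.
  have : 1 <= x by have := mem_e 1; rewrite s1 inE => /orP[/eqP <-//|/le_x].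
  by case: (sP x xs) => // xl x1; have := le_lt_trans (le_trans x1 xl) lam1;
      rewrite ltxx.
have yl : y <= lam.
  have ys : y \in s by rewrite -mem_e !inE eqxx orbT.
  case: (sP y ys) => // y1.
  by move: counte; rewrite /= x1 y1 eqxx.
apply/eqP; rewrite eq_le yl /=.
have := mem_e lam; rewrite slam !inE => /or3P[/eqP E|/eqP ->//|/le_y //].
by rewrite E x1 ltxx in lam1.
Qed.
End SymmetricSpectrum.

(** * Root systems of finite Coxeter groups *)

Section DualBasis.
Context {R : realType} {k : nat}.
Variables n om : 'I_k -> 'rV[R]_k.
Hypothesis dual : forall i j, dot (om j) (n i) = (i == j)%:R.

Lemma dual_mx : (\matrix_i n i)^T *m (\matrix_i om i) = 1%:M.
Proof.
apply: mulmx1C; apply/matrixP => i j; rewrite !mxE eq_sym -dual dotE.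
by apply: eq_bigr => l _; rewrite !mxE.
Qed.

Lemma expand_root x : x = \sum_j dot (om j) x *: n j.
Proof.
have E : (\matrix_i om i)^T *m (\matrix_i n i) = 1%:M.
  by rewrite -[RHS]trmx1 -dual_mx trmx_mul trmxK.
rewrite -[LHS]mulmx1 -E mulmxA mulmx_sum_row; apply: eq_bigr => j _.
rewrite rowK; congr (_ *: _); rewrite mxE dotE; apply: eq_bigr => l _.
by rewrite !mxE mulrC.
Qed.

Lemma expand_weight x : x = \sum_j dot (n j) x *: om j.
Proof.
rewrite -[LHS]mulmx1 -dual_mx mulmxA mulmx_sum_row; apply: eq_bigr => j _.
rewrite rowK; congr (_ *: _); rewrite mxE dotE; apply: eq_bigr => l _.
by rewrite !mxE mulrC.
Qed.

Lemma dot_expand x y : dot x y = \sum_j dot (om j) x * dot (n j) y.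
Proof. by rewrite {1}(expand_root x) dot_suml; apply: eq_bigr => j _;
    rewrite dotZl. Qed.

(** By [expand_root] these are the coordinates of [x] in the basis of simple roots, so this is the
    cone that they span; [dominant] is the dual cone, the closed Weyl chamber. *)
Definition poscone (x : 'rV[R]_k) := forall j, 0 <= dot (om j) x.

Definition dominant (x : 'rV[R]_k) := forall i, 0 <= dot x (n i).

Definition sdominant (x : 'rV[R]_k) := forall i, 0 < dot x (n i).

Lemma poscone_eq0 x : poscone x -> poscone (- x) -> x = 0.
Proof.
move=> xp xn; rewrite (expand_root x) big1 // => j _.
have := xp j; have := xn j; rewrite dotNr oppr_ge0 => h1 h2.
by rewrite (le_anti (introT andP (conj h1 h2))) scale0r.
Qed.
End DualBasis.

(** * Word length and alternating words *)

Section CoxeterGroup.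
Context {k : nat} {gT : finGroupType}.
Variables (m : 'I_k -> 'I_k -> nat) (s : 'I_k -> gT).
Hypothesis gen : <<[set s i | i : 'I_k]>>%g = [set: gT]%SET.
Hypothesis ss : forall i, (s i * s i = 1)%g.
Hypothesis m2 : forall i j, i != j -> (2 <= m i j)%N.
Hypothesis rel_m : forall i j, ((s i * s j) ^+ m i j = 1)%g.

(** A boolean, by way of tuples of fixed length, so that [ex_minn] can define the Coxeter length. *)
Definition is_word (g : gT) (q : nat) : bool :=
  [exists t : q.-tuple 'I_k, (\prod_(i <- t) s i)%g == g].

Lemma is_wordP g q : reflect (exists2 t : seq 'I_k, size t = q & (\prod_(i <- t)
    s i = g)%g) (is_word g q).
Proof.
apply: (iffP existsP) => [[t /eqP tg]|[t tq tg]].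
  by exists (val t); rewrite ?size_tuple.
have tq' : size t == q by rewrite tq.
by exists (Tuple tq'); rewrite /= tg.
Qed.

Lemma is_word_ex g : exists q, is_word g q.
Proof.
have : g \in <<[set s i | i : 'I_k]>>%g by rewrite gen inE.
case/gen_prodgP => q [c cs ->]; exists q.
have ex i : exists j, c i == s j by have /imsetP[j _ ->] := cs i; exists j.
apply/is_wordP; exists [seq xchoose (ex i) | i <- index_enum 'I_q].
  by rewrite size_map [index_enum _]unlock -enumT size_enum_ord.
rewrite big_map; apply: eq_bigr => i _.
by rewrite -(eqP (xchooseP (ex i))).
Qed.

Definition len g := ex_minn (is_word_ex g).

Lemma lenP g : exists2 t : seq 'I_k, size t = len g & (\prod_(i <- t) s i = g)%g.
Proof. by rewrite /len; case: ex_minnP => q /is_wordP. Qed.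

Lemma len_le (t : seq 'I_k) : (len (\prod_(i <- t) s i)%g <= size t)%N.
Proof. by rewrite /len; case: ex_minnP => q _; apply; apply/is_wordP; exists t. Qed.

Lemma lenM g h : (len (g * h)%g <= len g + len h)%N.
Proof.
have [t <- <-] := lenP g; have [u <- <-] := lenP h.
by rewrite -size_cat -big_cat; exact: len_le.
Qed.

Lemma len_s i : (len (s i) <= 1)%N.
Proof. by have := len_le [:: i]; rewrite big_seq1. Qed.

Lemma lenMs i g : (len (s i * g)%g <= (len g).+1)%N.
Proof. by apply: leq_trans (lenM _ _) _; rewrite -add1n leq_add2r len_s. Qed.

Lemma simple_mulK i : involutive (mulg (s i)).
Proof. by move=> g; rewrite mulgA ss mul1g. Qed.

Lemma len_descent g : g != 1%g -> exists j, (len (s j * g)%g < len g)%N.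
Proof.
have [[|j t] <- <-] := lenP g; first by rewrite big_nil eqxx.
by move=> _; exists j; rewrite big_cons simple_mulK ltnS; exact: len_le.
Qed.

Fixpoint alt i j q : gT := if q is q'.+1 then (s i * alt j i q')%g else 1%g.

Lemma altSr i j q : (alt i j q.+1 = alt i j q * s (if odd q then j else i))%g.
Proof.
elim: q i j => [|q IH] i j; first by rewrite /= mulg1 mul1g.
rewrite [LHS]/= -[(s j * alt i j q)%g]/(alt j i q.+1) IH mulgA; congr (_ * s _)%g.
by rewrite /=; case: (odd q).
Qed.

Lemma alt_len i j q : (len (alt i j q) <= q)%N.
Proof.
elim: q i j => [|q IH] i j; first by have := len_le [::]; rewrite big_nil.
by apply: leq_trans (lenMs _ _) _; rewrite ltnS.
Qed.

Lemma alt_double i j r : (alt i j r.*2 = (s i * s j) ^+ r)%g.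
Proof. by elim: r => [|r IH] //=; rewrite IH expgS mulgA. Qed.

Lemma simple_inv i : ((s i)^-1 = s i)%g.
Proof. by apply/eqP; rewrite eq_invg_mul ss. Qed.

(** The braid relation. For q = m i j, equal to 2r or 2r + 1, the power (s_j s_i)^r is the inverse
    of (s_i s_j)^r, and equality of the two words is a rearrangement of (s_i s_j)^q = 1. *)
Lemma alt_braid i j : i != j -> alt i j (m i j) = alt j i (m i j).
Proof.
move=> ij; have := rel_m i j; set q := m i j => rq.
have VE r : ((s j * s i) ^+ r = ((s i * s j) ^+ r)^-1)%g by rewrite -expgVn invMg
    !simple_inv.
have := odd_double_half q; set r := q./2; case: (odd q) => qE; rewrite -qE in rq *.
  rewrite add1n in rq *; rewrite !altSr odd_double !alt_double VE.
  apply: (mulgI ((s i * s j) ^+ r)%g); rewrite mulKVg.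
  apply: (mulIg (s j)); rewrite ss -rq.
  by rewrite expgSr -addnn expgD !mulgA.
rewrite add0n in rq *; rewrite !alt_double VE; apply/eqP.
by rewrite eq_sym eq_invg_mul -expgD addnn rq.
Qed.

Lemma alt_cat i j q r : alt i j (q + r) = (alt i j q * (if odd q then alt j i r else
    alt i j r))%g.
Proof.
elim: q i j => [|q IH] i j; first by rewrite mul1g.
by rewrite addSn /= IH mulgA; case: (odd q).
Qed.

(* Take the longest alternating prefix starting with s j. *)
Lemma alt_peel i j g : i != j -> (len g <= len (s i * g)%g)%N ->
    (len (s j * g)%g < len g)%N ->
  exists q v, [/\ (0 < q < m i j)%N, g = (alt j i q * v)%g, (len v < len g)%N &
    (len v <= len (s i * v)%g)%N /\ (len v <= len (s j * v)%g)%N].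
Proof.
move=> ij gi gj.
pose peel q := [exists v, (g == alt j i q * v)%g && (len g == q + len v)%N].
have peel_le q : peel q -> (q <= len g)%N.
  by case/existsP => v /andP[_ /eqP ->]; exact: leq_addr.
have peel1 : peel 1%N.
  apply/existsP; exists (s j * g)%g; rewrite /= mulg1 simple_mulK eqxx /= add1n
      eqn_leq gj andbT.
  by rewrite -{1}(simple_mulK j g) lenMs.
have [q qP qmax] := ex_maxnP (ex_intro peel 1%N peel1) peel_le.
have q1 : (0 < q)%N by exact: qmax.
case/existsP: qP => v /andP[/eqP gE /eqP lg]; exists q, v.
(* A prefix with at least [m i j] letters could be rewritten by the braid relation to start with
   [s i], and then [s i] would shorten [g], against [gi]. *)
have qm : (q < m i j)%N.
  rewrite ltnNge; apply/negP => mq.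
  have gE' : g = (alt i j (m i j) * ((if odd (m i j) then alt i j (q - m i j)
      else alt j i (q - m i j)) * v))%g.
    rewrite mulgA -[X in X = _]/g gE; congr (_ * v)%g.
    by rewrite -{1}(subnKC mq) alt_cat alt_braid.
  have m0 : (0 < m i j)%N := ltnW (m2 ij).
  have : (len (s i * g)%g <= (m i j).-1 + ((q - m i j) + len v))%N.
    rewrite gE'; case: (m i j) m0 => // m' _ /=; rewrite -mulgA simple_mulK.
    apply: leq_trans (lenM _ _) _; apply: leq_add; first exact: alt_len.
    apply: leq_trans (lenM _ _) _; rewrite leq_add2r.
    by case: ifP => _; exact: alt_len.
  move/(leq_trans gi); rewrite lg addnA leq_add2r.
  by case: (m i j) m0 mq => // m' _ mq; rewrite /= -{1}(subnKC mq) addSn ltnn.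
have next : (len v <= len (s (if odd q then i else j) * v)%g)%N.
  rewrite leqNgt; apply/negP => lv.
  have : peel q.+1.
    apply/existsP; exists (s (if odd q then i else j) * v)%g.
    rewrite altSr -mulgA simple_mulK -gE eqxx /= lg addSnnS eqn_add2l eqn_leq lv andbT.
    by rewrite -{1}(simple_mulK (if odd q then i else j) v) lenMs.
  by move/qmax; rewrite ltnn.
(* Here [s] is the last letter of the prefix. If it shortened [v], cancelling it would express [g]
   with fewer than [len g] letters. *)
have prev : (len v <= len (s (if odd q then j else i) * v)%g)%N.
  rewrite leqNgt; apply/negP => lv.
  have gE' : g = (alt j i q.-1 * (s (if odd q then j else i) * v))%g.
    rewrite {1}gE mulgA; congr (_ * v)%g; case: q q1 {lg qm qmax gE next lv} => // q _.
    by rewrite altSr /=; case: (odd q).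
  have := lenM (alt j i q.-1) (s (if odd q then j else i) * v)%g.
  rewrite -gE' lg leqNgt; case/negP.
  apply: leq_ltn_trans (leq_add (alt_len _ _ _) (leqnn _)) _.
  by case: q q1 {lg qm qmax gE next gE'} lv => // q _ lv;
      rewrite /= addSn ltnS leq_add2l ltnW.
split=> //; first by rewrite q1.
- by rewrite lg -addn1 addnC leq_add2r.
- by move: next prev; case: (odd q).
Qed.
End CoxeterGroup.

(** * Faces of convex hulls *)

Section Hull.
Context {R : realType} {k : nat}.
Implicit Types (A : set 'rV[R]_k) (x y c : 'rV[R]_k).

Lemma sub_hull A : A `<=` hull A.
Proof.
move=> x Ax; exists 1%N, (fun=> 1), (fun=> x); split=> //.
- by rewrite sumr_const card_ord.
- by rewrite big_ord_recl big_ord0 addr0 scale1r.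
Qed.

Lemma dot_hull_le A c M x : (forall y, A y -> dot c y <= M) -> hull A x -> dot c x <= M.
Proof.
move=> H [N [a [v [a0 a1 Av ->]]]]; rewrite dot_sumr -[M]mul1r -a1 mulr_suml.
by apply: ler_sum => i _; rewrite dotZr ler_wpM2l // H.
Qed.

Definition maximizers A c : set 'rV[R]_k :=
  [set x | A x /\ forall y, A y -> dot c y <= dot c x].

Lemma face_hull A c : face (hull A) c = hull (maximizers A c).
Proof.
apply/seteqP; split => [x [[N [a [v [a0 a1 Av xE]]]] xmax]|x [N [a [v [a0 a1 Av xE]]]]].
  have vmax i : 0 < a i -> maximizers A c (v i).
    move=> ai; have vle j : dot c (v j) <= dot c x by apply: xmax; exact: sub_hull.
    suff E : dot c (v i) = dot c x.
      by split=> // y Ay; rewrite E; apply: xmax; exact: sub_hull.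
    apply/eqP; rewrite eq_le vle /= leNgt; apply/negP => lt_vi.
    suff : dot c x < dot c x by rewrite ltxx.
    rewrite {1}xE dot_sumr -[ltRHS]mul1r -a1 mulr_suml (bigD1 i) //= [ltRHS](bigD1 i)
        //=.
    rewrite dotZr; apply: ltr_leD; first by rewrite ltr_pM2l.
    by apply: ler_sum => j _; rewrite dotZr ler_wpM2l.
  have [i0 ai0] : exists i0, 0 < a i0.
    apply/not_existsP => H; have : \sum_i a i = 0.
      by apply: big1 => i _; apply/eqP; rewrite eq_le a0 andbT leNgt; apply/negP;
          exact: H.
    by rewrite a1 => /eqP; rewrite oner_eq0.
  (* Points of weight 0 need not be maximisers; they are replaced by [v i0], which leaves the
     combination unchanged. *)
  exists N, a, (fun i => if 0 < a i then v i else v i0); split=> // [i|].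
    by case: ifP => [|_]; exact: vmax.
  rewrite xE; apply: eq_bigr => i _; case: ifPn => //; rewrite -leNgt => ai.
  by rewrite (le_anti (introT andP (conj ai (a0 i)))) !scale0r.
have [i0 _] : exists i0 : 'I_N, True.
  case: N a v a0 a1 Av xE => [|N] a v _ a1 _ _; last by exists ord0.
  by move: a1; rewrite big_ord0 => /esym/eqP; rewrite oner_eq0.
have E : dot c x = dot c (v i0).
  rewrite xE dot_sumr (eq_bigr (fun i => a i * dot c (v i0))) => [|i _].
    by rewrite -mulr_suml a1 mul1r.
  rewrite dotZr; congr (_ * _); apply/eqP; rewrite eq_le.
  by have [Ai Hi] := Av i; have [A0 H0] := Av i0; rewrite H0 // Hi.
split; first by exists N, a, v; split=> // i; have [] := Av i.
move=> y; rewrite E; apply: dot_hull_le => z; have [_] := Av i0; exact.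
Qed.

Lemma hull1 x : hull [set x] = [set x].
Proof.
apply/seteqP; split => [y [N [a [v [a0 a1 Av ->]]]]|y /= ->]; last exact: sub_hull.
rewrite /= (eq_bigr (fun i => a i *: x)) => [|i _]; last by have /= -> := Av i.
by rewrite -scaler_suml a1 scale1r.
Qed.

Lemma hull2 x y z : hull [set x; y] z -> exists2 t, 0 <= t & z = x + t *: (y - x).
Proof.
case=> N [a [v [a0 a1 Av ->]]].
have ex i : exists b : bool, v i = x + b%:R *: (y - x).
  case: (Av i) => /= ->; first by exists false; rewrite scale0r addr0.
  by exists true; rewrite scale1r addrC subrK.
have /choice[b vb] := ex; exists (\sum_i a i * (b i)%:R).
  by apply: sumr_ge0 => i _; rewrite mulr_ge0.
under eq_bigr do rewrite vb scalerDr scalerA.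
by rewrite big_split /= -!scaler_suml a1 scale1r.
Qed.

(** Along the segment the parameter t is nonnegative and averages to 0 at [x], so any generator of
    positive weight has t = 0 and is [x] itself. *)
Lemma hull_segment_end A x y : hull A = hull [set x; y] -> x <> y -> A x.
Proof.
move=> E xy; have : hull A x by rewrite E; apply: sub_hull; left.
case=> N [a [v [a0 a1 Av xE]]].
have ex i : exists t, 0 <= t /\ v i = x + t *: (y - x).
  have : hull [set x; y] (v i) by rewrite -E; exact: sub_hull.
  by move=> /hull2[t t0 vt]; exists t.
have /choice[t vt] := ex.
have : \sum_i a i * t i = 0.
  have : (\sum_i a i * t i) *: (y - x) = 0.
    move: xE; under eq_bigr do rewrite (vt _).2 scalerDr scalerA.
    rewrite big_split /= -!scaler_suml a1 scale1r => E2.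
    by apply: (@addrI _ x); rewrite addr0 -E2.
  by move/eqP; rewrite scaler_eq0 subr_eq0 => /orP[/eqP //|/eqP yx]; case: xy.
move/eqP; rewrite psumr_eq0 => [/allP at0|i _]; last by rewrite mulr_ge0 // (vt i).1.
have [i ai] : exists i, a i != 0.
  apply/not_existsP => H; have : \sum_i a i = 0.
    by apply: big1 => i _; apply/eqP/negPn/negP; exact: H.
  by rewrite a1 => /eqP; rewrite oner_eq0.
have := at0 i (mem_index_enum i); rewrite /= mulf_eq0 (negPf ai) /= => /eqP ti0.
by have := Av i; rewrite (vt i).2 ti0 scale0r addr0.
Qed.
End Hull.

(** * Obtuse bases and their dual cones *)

Section Acute.
Context {R : realType} {k : nat}.
Variables (m : 'I_k -> 'I_k -> nat).
Hypothesis mii : forall i, m i i = 1%N.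
Hypothesis m2 : forall i j, i != j -> (2 <= m i j)%N.
Hypothesis hirr : coxeter_irreducible m.
Variables n om : 'I_k -> 'rV[R]_k.
Hypothesis dual : forall i j, dot (om j) (n i) = (i == j)%:R.
Hypothesis nn : forall i j, i != j -> dot (n i) (n j) = - cos (pi / (m i j)%:R).

Lemma obtuse i j : i != j -> dot (n i) (n j) <= 0.
Proof. by move=> ij; rewrite nn // oppr_le0 cos_pi_div_ge0 // m2. Qed.

Lemma obtuse_lt i j : (2 < m i j)%N -> i != j /\ dot (n i) (n j) < 0.
Proof.
move=> mij; have ij : i != j by apply: contraTneq mij => ->; rewrite mii.
split=> //; rewrite nn // oppr_lt0.
have mp : 0 < (m i j)%:R :> R by rewrite ltr0n (leq_trans _ mij).
apply: cos_gt0_pihalf; apply/andP; split.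
  by apply: (@lt_trans _ _ 0); rewrite ?oppr_lt0 ?divr_gt0 ?pi_gt0.
by rewrite ltr_pM2l ?pi_gt0 // ltf_pV2 ?posrE // ltr_nat.
Qed.

(** Split p = x + y, with [x] carrying the negative coordinates. Dominance gives <p, x> <= 0 and
    obtuseness gives <y, x> >= 0, so |x|^2 <= 0. *)
Lemma dominant_poscone p : dominant n p -> poscone om p.
Proof.
move=> pd j; rewrite leNgt; apply/negP => cj.
pose c i := dot (om i) p.
pose x := \sum_(i | c i < 0) c i *: n i.
pose y := \sum_(i | ~~ (c i < 0)) c i *: n i.
have pE : p = x + y by rewrite [LHS](expand_root dual) (bigID (fun i => c i < 0)).
have px : dot p x <= 0.
  rewrite dot_sumr sumr_le0 // => i ci; rewrite dotZr.
  by rewrite nmulr_rle0.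
have yx : 0 <= dot y x.
  rewrite dot_suml sumr_ge0 // => i; rewrite -leNgt => ci;
      rewrite dot_sumr sumr_ge0 // => l cl.
  rewrite dotZl dotZr mulr_ge0 // nmulr_rge0 // obtuse //.
  by apply: contraTneq cl => <-; rewrite -leNgt.
have x0 : x = 0.
  apply/eqP; rewrite -dot_eq0 eq_le dot_ge0 andbT.
  by move: px; rewrite {1}pE dotDl; lra.
have : dot (om j) x = c j.
  rewrite dot_sumr (bigD1 j) //= big1 ?addr0; last first.
    by move=> i /andP[_ ij]; rewrite dotZr dual (negPf ij) mulr0.
  by rewrite dotZr dual eqxx mulr1.
by rewrite x0 dot0r => c0; move: cj; rewrite -/(c j) -c0 ltxx.
Qed.

(** If the coordinate at [a] vanishes, then <n_a, p> >= 0 is a sum of nonpositive terms. Hence the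
    coordinate vanishes at each neighbour of [a] in the Coxeter graph and, by connectedness,
    everywhere. Applied to w this gives positive weights, applied to [om j] a positive Gram matrix
    C. *)
Lemma dominant_pos p : dominant n p -> p != 0 -> forall i, 0 < dot (om i) p.
Proof.
move=> pd p0 i; have pp := dominant_poscone pd.
rewrite lt_neqAle pp andbT eq_sym; apply: contraNneq p0 => ci.
have step a b : dot (om a) p = 0 -> (2 < m a b)%N -> dot (om b) p = 0.
  move=> ca mab; have [ab dab] := obtuse_lt mab.
  have le0 l : dot (n a) (dot (om l) p *: n l) <= 0.
    rewrite dotZr; have [->|la] := eqVneq l a; first by rewrite ca mul0r.
    by rewrite mulr_ge0_le0 // obtuse // eq_sym.
  have s0 : 0 <= \sum_l dot (n a) (dot (om l) p *: n l).
    by rewrite -dot_sumr -(expand_root dual p) dotC.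
  have /eqP : \sum_l - dot (n a) (dot (om l) p *: n l) = 0.
    apply/eqP; rewrite eq_le sumr_ge0 ?andbT => [|l _]; last by rewrite oppr_ge0.
    by rewrite sumrN oppr_le0.
  rewrite psumr_eq0 => [/allP/(_ b (mem_index_enum b))|l _]; last by rewrite oppr_ge0.
  by rewrite /= oppr_eq0 dotZr mulf_eq0 (lt_eqF dab) orbF => /eqP.
rewrite (expand_root dual p) big1 // => j _.
suff -> : dot (om j) p = 0 by rewrite scale0r.
have /connectP[t] := hirr i j; elim: t i ci => [|b t IH] a ca /=; first by move=> _ ->.
by move=> /andP[ab] /IH; apply; exact: step ab.
Qed.
End Acute.

(** * Ridges of the polar dual *)

Section ChamberSlice.
Context {R : realType}.

(* When w is dominant, this is the ridge of the polar dual of Q_w shared by the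
   facets with normals w and sigma_j w; see ridge_slice. *)
Definition chamber_slice k (n : 'I_k -> 'rV[R]_k) (w : 'rV[R]_k) (j : 'I_k)
    : set 'rV[R]_k :=
  [set p | [/\ dominant n p, dot p (n j) = 0 & dot p w = 1]].

Section Coordinates.
Context {d : nat}.
Variables n om : 'I_d.+2 -> 'rV[R]_d.+2.
Hypothesis dual : forall i j, dot (om j) (n i) = (i == j)%:R.
Hypothesis n1 : forall i, dot (n i) (n i) = 1.
Variable w : 'rV[R]_d.+2.
Hypothesis w1 : dot w w = 1.
Hypothesis omw : forall i, 0 < dot (om i) w.
Hypothesis wn : forall j, dot w (n j) ^+ 2 < 1.
Variable j : 'I_d.+2.

(** Vertices of the slice: the extremal rays of wall j of the chamber, cut at height 1 in direction
    w. *)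
Let q (l : 'I_d.+1) := (dot (om (lift j l)) w)^-1 *: om (lift j l).

Lemma chamber_slice_simplex : chamber_slice n w j = simplex q.
Proof.
apply/seteqP; split => [p [pd pj pw]|p [a [a0 a1 ->]]].
  exists (fun l => dot (n (lift j l)) p * dot (om (lift j l)) w); split.
  - by move=> l; apply: mulr_ge0; [rewrite dotC; exact: pd|exact: ltW].
  - rewrite -pw {2}(expand_weight dual p) dot_suml (bigD1_ord j) //=.
    rewrite dotZl [dot (n j) p]dotC pj mul0r add0r.
    by apply: eq_bigr => l _; rewrite dotZl.
  - rewrite [LHS](expand_weight dual p) (bigD1_ord j) //= [dot (n j)
      p]dotC pj scale0r add0r.
    by apply: eq_bigr => l _; rewrite /q scalerA mulfK // gt_eqF.
split.
- move=> i; rewrite dot_suml sumr_ge0 // => l _; rewrite !dotZl dual.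
  by rewrite mulr_ge0 // mulr_ge0 ?ler0n // invr_ge0 ltW.
- rewrite dot_suml big1 // => l _; rewrite !dotZl dual.
  by rewrite -[_ == _]/(j == lift j l) (negPf (neq_lift _ _)) !mulr0.
- rewrite dot_suml -a1; apply: eq_bigr => l _; rewrite !dotZl mulVf ?mulr1 //.
  by rewrite gt_eqF.
Qed.

(** Here [r] is the length of the component of w orthogonal to [n j], and [e] its direction. The
    vectors [n j] and [e] form an orthonormal basis of the complement of the row space of [D], and
    1/r is the distance of the plane of the slice from the origin. *)
Let D := edge_mx q.
Let h := dot w (n j).
Let r := Num.sqrt (1 - h ^+ 2).
Let e := r^-1 *: (w - h *: n j).

Let r0 : 0 < r.
Proof. by rewrite sqrtr_gt0 subr_gt0; exact: wn. Qed.

Let rr : r ^+ 2 = 1 - h ^+ 2.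
Proof. by rewrite sqr_sqrtr // ltW // subr_gt0; exact: wn. Qed.

Let qn l i : dot (q l) (n i) = (dot (om (lift j l)) w)^-1 * (i == lift j l)%:R.
Proof. by rewrite dotZl dual. Qed.

Let qnj l : dot (q l) (n j) = 0.
Proof. by rewrite qn (negPf (neq_lift _ _)) mulr0. Qed.

Let qe l : dot (q l) e = r^-1.
Proof.
rewrite dotZr dotBr dotZr qnj mulr0 subr0 /q dotZl mulVf ?mulr1 //.
by rewrite gt_eqF.
Qed.

Let nje : dot (n j) e = 0.
Proof. by rewrite dotZr dotBr dotZr n1 mulr1 dotC subrr mulr0. Qed.

Let ee : dot e e = 1.
Proof.
rewrite dotZl dotZr dotBl !dotBr !dotZl !dotZr n1 w1 (dotC (n j) w) -/h.
have -> : 1 - h * h - (h * h - h * (h * 1)) = r ^+ 2 by rewrite rr; ring.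
by field; rewrite gt_eqF.
Qed.

Let dotmx (u v : 'rV[R]_d.+2) : u *m v^T = (dot u v)%:M.
Proof. by apply/matrixP => a b; rewrite !ord1 [RHS]mxE eqxx. Qed.

Let DT (v : 'rV[R]_d.+2) : (forall l, dot (q l) v = dot (q ord0) v) -> D *m v^T = 0.
Proof.
move=> H; apply/colP => l; rewrite [RHS]mxE.
have -> : (D *m v^T) l 0 = dot (row l D) v by rewrite dotE mxE;
    apply: eq_bigr => i _; rewrite !mxE.
by rewrite rowK dotBl H subrr.
Qed.

Let DTr (v : 'rV[R]_d.+2) : (forall l, dot (q l) v = dot (q ord0) v) -> v *m D^T = 0.
Proof. by move=> /DT H; rewrite -[v]trmxK -trmx_mul H trmx0. Qed.

(** The Gram determinant of [D] is the square of \det A. Replacing [e] by the vertex [q ord0], whose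
    component along [e] is 1/r, gives [M], whose determinant is accessible: duality makes the
    product of [M] with the transposed matrix of roots block triangular. *)
Let M : 'M[R]_(1 + (1 + d)) := col_mx (n j) (col_mx (q ord0) D).
Let A : 'M[R]_(1 + (1 + d)) := col_mx (n j) (col_mx e D).

Let njD : n j *m D^T = 0.
Proof. by apply: DTr => l; rewrite !qnj. Qed.

Let eD : e *m D^T = 0.
Proof. by apply: DTr => l; rewrite !qe. Qed.

Let Dnj : D *m (n j)^T = 0.
Proof. by apply: DT => l; rewrite !qnj. Qed.

Let De : D *m e^T = 0.
Proof. by apply: DT => l; rewrite !qe. Qed.

Let detA : \det A ^+ 2 = \det (D *m D^T).
Proof.
have -> : \det A ^+ 2 = \det (A *m A^T) by rewrite det_mulmx det_tr.
rewrite /A !tr_col_mx (mul_col_row (n j)) !dotmx n1 mul_mx_row njD dotmx nje.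
rewrite mul_col_mx Dnj dotmx (dotC e) nje raddf0 row_mx0 col_mx0 det_ublock
    det_scalar1 mul1r.
by rewrite mul_col_row dotmx ee eD De det_ublock det_scalar1 mul1r.
Qed.

Let detMA : \det M * \det A = r^-1 * \det (D *m D^T).
Proof.
rewrite -(det_tr A) -det_mulmx /M /A !tr_col_mx (mul_col_row (n j))
    !dotmx n1 mul_mx_row njD dotmx nje.
rewrite mul_col_mx Dnj dotmx qnj raddf0 row_mx0 col_mx0 det_ublock det_scalar1 mul1r.
by rewrite mul_col_row dotmx qe De det_ublock det_scalar1.
Qed.

(** Moves root j to the top, to match the rows of [M]; only the sign of the determinant is
    affected. *)
Let sigma : 'S_d.+2 := lift_perm ord0 j 1%g.
Let Nr : 'M[R]_(1 + (1 + d)) := row_perm sigma (\matrix_i n i).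

Let detN : `|\det Nr| = `|\det (\matrix_i n i)|.
Proof. by rewrite /Nr row_permE det_mulmx det_perm normrM normr_sign mul1r. Qed.

Let NrE : Nr = col_mx (n j) (col_mx (n (lift j ord0)) (\matrix_(l < d)
    n (lift j (lift ord0 l)))).
Proof.
apply/row_matrixP => i; apply/rowP => a; rewrite !mxE.
case: splitP => i' ii.
  rewrite (_ : i = ord0) ?lift_perm_id //; first by rewrite !ord1.
  by apply/val_inj; rewrite /= ii ord1.
rewrite (_ : i = lift ord0 i'); last by apply/val_inj; rewrite /= ii.
rewrite lift_perm_lift perm1 mxE; case: splitP => l li.
  by rewrite (_ : i' = ord0) ?ord1 //; apply/val_inj; rewrite /= li ord1.
by rewrite (_ : i' = lift ord0 l) ?mxE //; apply/val_inj; rewrite /= li.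
Qed.

Let detMN : \det M * \det Nr = \prod_(l < d.+1) (dot (om (lift j l)) w)^-1.
Proof.
rewrite -(det_tr Nr) -det_mulmx NrE /M !tr_col_mx (mul_col_row (n j)) !dotmx n1.
rewrite mul_col_mx Dnj dotmx qnj raddf0 col_mx0 det_ublock det_scalar1 mul1r.
rewrite mul_col_row dotmx qn eqxx mulr1.
have -> : q ord0 *m (\matrix_(l < d) n (lift j (lift ord0 l)))^T = 0.
  apply/rowP => l; rewrite [RHS]mxE.
  transitivity (dot (q ord0) (n (lift j (lift ord0 l)))).
    by rewrite dotE mxE; apply: eq_bigr => i _; rewrite !mxE.
  by rewrite qn (inj_eq lift_inj) mulr0.
rewrite det_lblock det_scalar1 big_ord_recl; congr (_ * _).
have -> : D *m (\matrix_(l < d) n (lift j (lift ord0 l)))^T =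
   diag_mx (\row_l (dot (om (lift j (lift ord0 l))) w)^-1).
  apply/matrixP => a b; rewrite [RHS]mxE mxE.
  transitivity (dot (row a D) (n (lift j (lift ord0 b)))).
    by rewrite dotE; apply: eq_bigr => i _; rewrite !mxE.
  rewrite rowK dotBl !qn !(inj_eq lift_inj) mulr0 subr0 eq_sym mulr_natr.
  by rewrite mxE.
by rewrite det_diag; apply: eq_bigr => l _; rewrite mxE.
Qed.

Let detM0 : \det M != 0.
Proof.
have : \det M * \det Nr != 0.
  by rewrite detMN; apply/prodf_neq0 => l _; rewrite invr_eq0 gt_eqF.
by rewrite mulf_eq0 negb_or => /andP[].
Qed.

Let Dfree : row_free D.
Proof.
have : row_free M by rewrite row_free_unit unitmxE unitfE.
move=> Mf; apply: inj_row_free => v vD.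
have : row_mx (0 : 'rV[R]_1) (row_mx (0 : 'rV[R]_1) v) *m M = 0.
  by rewrite !mul_row_col !mul0mx vD !addr0.
move/eqP; rewrite mulmx_free_eq0 // => /eqP E.
have := congr1 (fun x : 'rV[R]_(1 + (1 + d)) => rsubmx (rsubmx x)) E.
by rewrite !row_mxKr !linear0.
Qed.

Lemma det_slice : Num.sqrt (\det (D *m D^T)) =
  r * (`|\det (\matrix_i n i)|^-1 * \prod_(l < d.+1) (dot (om (lift j l)) w)^-1).
Proof.
have D0 : \det (D *m D^T) != 0.
  rewrite -unitfE -unitmxE -row_free_unit; apply: inj_row_free => u uD.
  have : dot (u *m D) (u *m D) = 0.
    by rewrite dot_mulmx_trmx -mulmxA uD dot0r.
  move/eqP; rewrite dot_eq0 mulmx_free_eq0 // => /eqP //.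
have A0 : \det A != 0 by move: D0; rewrite -detA expf_eq0.
have MA : \det M = r^-1 * \det A.
  by apply: (mulIf A0); rewrite detMA -detA; ring.
have N0 : \det (\matrix_i n i) != 0.
  rewrite -normr_eq0 -detN normr_eq0; apply: contraNneq detM0 => N0.
  have := detMN; rewrite N0 mulr0 => /esym/eqP/prodf_eq0[l _].
  by rewrite invr_eq0 gt_eqF.
have -> : \prod_(l < d.+1) (dot (om (lift j l)) w)^-1 =
    `|\det M| * `|\det (\matrix_i n i)|.
  rewrite -detN -normrM detMN ger0_norm // prodr_ge0 // => l _.
  by rewrite invr_ge0 ltW.
rewrite -detA sqrtr_sqr MA normrM normfV (gtr0_norm r0).
by field; rewrite normr_eq0 N0 gt_eqF.
Qed.

Lemma vol_chamber_slice (O : 'M[R]_d.+2) : O *m O^T = 1%:M ->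
  vol d [set p *m O | p in chamber_slice n w j] =
  std_vol d * (`|\det (\matrix_i n i)|^-1 * \prod_i (dot (om i) w)^-1)
      * (r * dot (om j) w).
Proof.
move=> OO; have -> : [set p *m O | p in chamber_slice n w j] =
    simplex (fun l => q l *m O).
  rewrite chamber_slice_simplex; apply/seteqP; split => [_ [_ [a [a0 a1 ->]] <-]|_ [a
      [a0 a1 ->]]].
    by exists a; split => //; rewrite mulmx_suml; apply: eq_bigr => l _;
        rewrite -scalemxAl.
  exists (\sum_l a l *: q l); first by exists a.
  by rewrite mulmx_suml; apply: eq_bigr => l _; rewrite -scalemxAl.
have EO : edge_mx (fun l => q l *m O) = D *m O.
  by apply/row_matrixP => l; rewrite row_mul !rowK mulmxBl.
have Ou : O \in unitmx by have [] := mulmx1_unit OO.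
rewrite vol_simplex EO; last by rewrite -row_leq_rank mxrankMfree ?row_free_unit //
    row_leq_rank.
have -> : D *m O *m (D *m O)^T = D *m D^T by rewrite trmx_mul mulmxA -(mulmxA D)
    OO mulmx1.
(* Completing the product over all indices but j to the full product costs the factor
   [dot (om j) w]; with [r] it carries the whole dependence on j. *)
rewrite det_slice [\prod_i _](bigD1_ord j) //=.
have := lt0r_neq0 (omw j); move: (`|_|^-1) (\prod_(_ < _) _) (dot _ w) => X Y Z Z0.
by field.
Qed.
End Coordinates.

Lemma vol_chamber_slice_prop k (n om : 'I_k -> 'rV[R]_k) (w : 'rV[R]_k) : (2 <= k)%N ->
  (forall i j, dot (om j) (n i) = (i == j)%:R) -> (forall i, dot (n i) (n i) = 1) ->
  dot w w = 1 -> (forall i, 0 < dot (om i) w) -> (forall j, dot w (n j) ^+ 2 < 1) ->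
  exists2 K : R, 0 < K & forall j (O : 'M[R]_k), O *m O^T = 1%:M ->
    vol (k - 2) [set p *m O | p in chamber_slice n w j] =
    K * (Num.sqrt (1 - dot w (n j) ^+ 2) * dot (om j) w).
Proof.
case: k n om w => [|[|d]] // n om w _ dual n1 w1 omw wn.
exists (std_vol d * (`|\det (\matrix_i n i)|^-1 * \prod_i (dot (om i) w)^-1)).
  rewrite mulr_gt0 ?std_vol_gt0 // mulr_gt0 //; last first.
    by apply: prodr_gt0 => i _; rewrite invr_gt0.
  rewrite invr_gt0 normr_gt0; have := congr1 determinant (dual_mx dual).
  rewrite det_mulmx det_tr det1 => E; apply/eqP => n0; move/eqP: E.
  by rewrite n0 mul0r eq_sym oner_eq0.
move=> j O OO; have -> : (d.+2 - 2 = d)%N by rewrite -addn2 addnK.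
exact: vol_chamber_slice.
Qed.
End ChamberSlice.

(** * Permutahedra *)

Section GeometricRepresentation.
Context {R : realType} {k : nat} {gT : finGroupType}.
Variables (m : 'I_k -> 'I_k -> nat) (s : 'I_k -> gT).
Hypothesis gen : <<[set s i | i : 'I_k]>>%g = [set: gT]%SET.
Hypothesis ss : forall i, (s i * s i = 1)%g.
Hypothesis m2 : forall i j, i != j -> (2 <= m i j)%N.
Hypothesis rel_m : forall i j, ((s i * s j) ^+ m i j = 1)%g.
Variables n om : 'I_k -> 'rV[R]_k.
Hypothesis dual : forall i j, dot (om j) (n i) = (i == j)%:R.
Hypothesis n1 : forall i, dot (n i) (n i) = 1.
Hypothesis nn : forall i j, i != j -> dot (n i) (n j) = - cos (pi / (m i j)%:R).
Hypothesis mii : forall i, m i i = 1%N.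
Hypothesis hirr : coxeter_irreducible m.
Variable rho : mx_representation R [set: gT]%G k.
Hypothesis rho_s : forall j p, p *m rho (s j) = reflection (n j) p.

Local Notation poscone := (poscone om).
Local Notation dominant := (dominant n).
Local Notation sdominant := (sdominant n).

Lemma rhoM g h : rho (g * h)%g = rho g *m rho h.
Proof. by rewrite repr_mxM ?inE. Qed.

Lemma rho1 : rho 1%g = 1%:M.
Proof. exact: repr_mx1. Qed.

Lemma dot_reflection i x y : dot (reflection (n i) x) (reflection (n i) y) = dot x y.
Proof.
rewrite /reflection dotBl !dotBr !dotZl !dotZr n1 [dot (n i) y]dotC; ring.
Qed.

Lemma rho_orth g : rho g *m (rho g)^T = 1%:M.
Proof.
have [t _ <-] := lenP gen g; elim: t => [|i t IH].
  by rewrite big_nil rho1 trmx1 mulmx1.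
rewrite big_cons rhoM trmx_mul mulmxA -(mulmxA (rho (s i))) IH mulmx1.
apply/row_matrixP => a; rewrite row_mul; apply/rowP => b.
have -> : (row a (rho (s i)) *m (rho (s i))^T) 0 b = dot (row a (rho (s i)))
    (row b (rho (s i))).
  by rewrite dotE mxE; apply: eq_bigr => l _; rewrite !mxE.
rewrite !rowE !rho_s dot_reflection mulmx1 dotE (bigD1 a) //= big1 ?addr0.
  by rewrite !mxE !eqxx mul1r eq_sym.
by move=> l la; rewrite !mxE eqxx (negPf la) mul0r.
Qed.

Lemma dot_rho g (x y : 'rV[R]_k) : dot (x *m rho g) (y *m rho g) = dot x y.
Proof. exact/dot_isometry/rho_orth. Qed.

Lemma rhoVK g (x : 'rV[R]_k) : x *m rho g *m rho (g^-1)%g = x.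
Proof. by rewrite -mulmxA -rhoM mulgV rho1 mulmx1. Qed.

Lemma rhoKV g (x : 'rV[R]_k) : x *m rho (g^-1)%g *m rho g = x.
Proof. by rewrite -mulmxA -rhoM mulVg rho1 mulmx1. Qed.

Lemma reflection_root i : reflection (n i) (n i) = - n i.
Proof. by rewrite /reflection n1 mulr1 scaler_nat mulr2n opprD addrA subrr add0r. Qed.

Lemma sin_pi_div_ge0 (m0 q : nat) : (0 < m0)%N -> (q <= m0)%N ->
    0 <= sin (q%:R * (pi / m0%:R) : R).
Proof.
move=> m00 qm; apply: sin_ge0_pi; rewrite mulr_ge0 ?divr_ge0 ?pi_ge0 //=.
by rewrite mulrCA ler_piMr ?pi_ge0 // ler_pdivrMr ?ltr0n // mul1r ler_nat.
Qed.

(* The dihedral orbit of a simple root: Chebyshev recursion for sin (q th). *)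
Lemma alt_root i j q : i != j -> let th := pi / (m i j)%:R : R in
  sin th *: (n i *m rho (alt s j i q)) =
  sin (q.+1%:R * th) *: n (if odd q then j else i) + sin (q%:R * th)
      *: n (if odd q then i else j).
Proof.
move=> ij th; elim: q => [|q IH].
  by rewrite rho1 mulmx1 mul0r sin0 scale0r addr0 mul1r.
rewrite altSr rhoM mulmxA scalemxAl IH mulmxDl -!scalemxAl !rho_s /=.
have rec : sin (q.+2%:R * th) = 2 * cos th * sin (q.+1%:R * th) - sin (q%:R * th).
  have -> : q.+2%:R * th = q.+1%:R * th + th by rewrite -(natr1 q.+1) mulrDl mul1r.
  have -> : q%:R * th = q.+1%:R * th - th by rewrite -(natr1 q) mulrDl mul1r addrK.
  by rewrite sinD sinB; ring.
have refl a b : a != b -> dot (n a) (n b) = - cos th ->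
   sin (q.+1%:R * th) *: reflection (n b) (n a) + sin (q%:R * th) *: reflection (n b)
       (n b) =
   sin (q.+2%:R * th) *: n b + sin (q.+1%:R * th) *: n a.
  move=> ab dab; rewrite reflection_root /reflection dab rec.
  rewrite scalerBr !scalerN scalerA scalerBl -addrA -opprD addrC; congr (_ + _).
  rewrite -scalerDl -scalerBl -scaleNr; congr (_ *: _); ring.
case: (odd q) => /=; last by apply: refl => //; rewrite nn.
by apply: refl; [rewrite eq_sym | rewrite dotC nn].
Qed.

(* Peeling an alternating word off g leaves an element v of smaller length for
   which n_i v and n_j v are positive by induction, with coefficients
   sin (q th), q <= m i j. *)
Lemma root_pos i g : (len gen g <= len gen (s i * g)%g)%N -> poscone (n i *m rho g).
Proof.
have [q] := ubnP (len gen g); elim: q g i => // q IH g i; rewrite ltnS => gq gi.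
have [->|g1] := eqVneq g 1%g.
  by rewrite rho1 mulmx1 => j; rewrite dual ler0n.
have [j gj] := len_descent gen ss g1.
have ij : i != j by apply: contraTneq gj => <-; rewrite -leqNgt.
have [r [v [/andP[r0 rm] gE vg [vi vj]]]] := alt_peel ss m2 rel_m ij gi gj.
have vq := leq_trans vg gq.
have pi_ := IH v i vq vi; have pj := IH v j vq vj.
pose th : R := pi / (m i j)%:R.
have mp : (0 < m i j)%N := ltnW (m2 ij).
have th0 : 0 < sin th.
  rewrite sin_gt0_pi // divr_gt0 ?pi_gt0 ?ltr0n //= ltr_pdivrMr ?ltr0n //.
  by rewrite ltr_pMr ?pi_gt0 // ltr1n m2.
move=> l; rewrite gE rhoM mulmxA -(pmulr_rge0 _ th0) -dotZr scalemxAl alt_root //.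
rewrite mulmxDl -!scalemxAl dotDr !dotZr.
have s1 : 0 <= sin (r.+1%:R * th) by exact: sin_pi_div_ge0.
have s2 : 0 <= sin (r%:R * th) by apply: sin_pi_div_ge0 => //; exact: ltnW.
by rewrite addr_ge0 // mulr_ge0 //; case: (odd r).
Qed.

Lemma n_neq0 i : n i != 0.
Proof. by rewrite -dot_eq0 n1 oner_eq0. Qed.

(** For g = s_j h with h shorter, w - w g = (w - w h) + 2 <w, n_j> n_j h, and n_j h is a positive
    root by [root_pos]. *)
Lemma sub_orbit_pos w g : dominant w -> poscone (w - w *m rho g).
Proof.
move=> wd; have [q] := ubnP (len gen g); elim: q g => // q IH g; rewrite ltnS => gq.
have [->|g1] := eqVneq g 1%g; first by rewrite rho1 mulmx1 subrr => l; rewrite dot0r.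
have [j gj] := len_descent gen ss g1.
set h := (s j * g)%g in gj.
have gE : g = (s j * h)%g by rewrite /h simple_mulK.
have hp : poscone (n j *m rho h) by apply: root_pos; rewrite -gE ltnW.
have IHh := IH h (leq_trans gj gq).
move=> l; rewrite {1}gE rhoM mulmxA rho_s /reflection mulmxBl -scalemxAl opprB addrCA
    addrC.
by rewrite dotDr addr_ge0 ?IHh // dotZr !mulr_ge0.
Qed.

(** In the same decomposition, w g = w would put both n_j h and its negative into the cone of
    positive roots, forcing n_j h = 0. *)
Lemma sub_orbit_neq0 w g : sdominant w -> g != 1%g -> w *m rho g != w.
Proof.
move=> wd g1; have wd' : dominant w by move=> i; exact: ltW.
have [j gj] := len_descent gen ss g1; set h := (s j * g)%g in gj.
have gE : g = (s j * h)%g by rewrite /h simple_mulK.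
have hp : poscone (n j *m rho h) by apply: root_pos; rewrite -gE ltnW.
have IHh := sub_orbit_pos h wd'.
apply/eqP => E; have : w - w *m rho g = 0 by rewrite E subrr.
rewrite {1}gE rhoM mulmxA rho_s /reflection mulmxBl -scalemxAl opprB addrCA addrC =>
    /eqP.
rewrite addr_eq0 => /eqP E2.
have c0 : 0 < 2 * dot w (n j) by rewrite mulr_gt0.
have n0 : n j *m rho h = 0.
  apply: (poscone_eq0 dual) => // l; rewrite -(pmulr_rge0 _ c0) -[_ * dot (om l)
      _]dotZr scalerN -E2.
  exact: IHh.
by have := n_neq0 j; rewrite -[n j](rhoVK h) n0 mul0mx eqxx.
Qed.

Lemma orbit_inj w : sdominant w -> injective (fun g => w *m rho g).
Proof.
move=> wd g h E; apply/eqP; rewrite eq_mulgV1; apply/negPn/negP => gh.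
have := sub_orbit_neq0 wd gh.
by rewrite rhoM mulmxA E rhoVK eqxx.
Qed.

Lemma dot_orbit_le p w g : dominant p -> dominant w -> dot p (w *m rho g) <= dot p w.
Proof.
move=> pd wd; rewrite -subr_ge0 -dotBr dotC (dot_expand dual) sumr_ge0 // => j _.
by rewrite mulr_ge0 ?sub_orbit_pos // dotC pd.
Qed.

Lemma dot_orbit_eq p w g : dominant p -> dominant w -> dot p (w *m rho g) = dot p w ->
  w - w *m rho g = \sum_(j | dot p (n j) == 0) dot (om j) (w - w *m rho g) *: n j.
Proof.
move=> pd wd /eqP; rewrite eq_sym -subr_eq0 -dotBr dotC (dot_expand dual) psumr_eq0;
    last first.
  by move=> j _; rewrite mulr_ge0 ?sub_orbit_pos // dotC pd.
move=> /allP H; rewrite {1}(expand_root dual (w - w *m rho g))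
    (bigID (fun j => dot p (n j) == 0)) /=.
rewrite [X in _ + X]big1 ?addr0 // => j pj.
have := H j (mem_index_enum j); rewrite /= mulf_eq0 [dot (n j) p]dotC (negPf pj)
    orbF => /eqP ->.
by rewrite scale0r.
Qed.

Lemma dot_orbit_strict p w g : sdominant p -> sdominant w -> g != 1%g ->
    dot p (w *m rho g) < dot p w.
Proof.
move=> pd wd g1; rewrite lt_neqAle dot_orbit_le ?andbT; try by move=> i; exact: ltW.
apply/eqP => E; have := sub_orbit_neq0 wd g1; case/negP.
rewrite eq_sym -subr_eq0 (dot_orbit_eq _ _ E); try by move=> i; exact: ltW.
by rewrite big1 // => j /eqP pj; have := pd j; rewrite pj ltxx.
Qed.

(** If [p] is off wall j, it is strictly dominant and g = 1. Otherwise equality leaves only the root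
    [n j], so w g = w - t n_j; as w g and w have the same length, t is 0 or 2 <w, n_j>. *)
Lemma dot_orbit_wall p w g j : dominant p -> (forall i, i != j -> 0 < dot p (n i)) ->
    sdominant w ->
  dot p (w *m rho g) = dot p w -> g = 1%g \/ g = s j.
Proof.
move=> pd pj wd E; have wd' : dominant w by move=> i; exact: ltW.
have := dot_orbit_eq pd wd' E.
have [pj0|pj0] := eqVneq (dot p (n j)) 0; last first.
  have pd' : sdominant p.
    by move=> i; have [->|/pj//] := eqVneq i j; rewrite lt_neqAle eq_sym pj0 pd.
  have [->|g1] := eqVneq g 1%g; first by left.
  by have := dot_orbit_strict pd' wd g1; rewrite E ltxx.
rewrite (big_pred1 j) => [|i]; last first.
  have [->|ij] := eqVneq i j; first by rewrite pj0 eqxx /= eqxx.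
  by rewrite gt_eqF ?pj //= (negPf ij).
set t := dot _ _ => wE.
have E2 : w *m rho g = w - t *: n j by rewrite -wE opprB addrC subrK.
have : dot (w *m rho g) (w *m rho g) = dot w w by exact: dot_rho.
rewrite E2 dotBl !dotBr !dotZl !dotZr n1 [dot (n j) w]dotC => Ht.
have : t * (t - 2 * dot w (n j)) = 0 by move: Ht; lra.
move/eqP; rewrite mulf_eq0 subr_eq0 => /orP[/eqP t0|/eqP t2]; [left|right].
  by apply: (orbit_inj wd); rewrite E2 t0 scale0r subr0 rho1 mulmx1.
by apply: (orbit_inj wd); rewrite E2 t2 rho_s.
Qed.

Lemma orbit_ptP w x : orbit_pt rho w x <-> exists g, x = w *m rho g.
Proof. by split=> [[g _ <-]|[g ->]]; [exists g|exists g]. Qed.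

Lemma dot_rhoV g h x y : dot (x *m rho g) (y *m rho h) = dot x (y *m rho (h * g^-1)%g).
Proof. by rewrite rhoM mulmxA -[in RHS](dot_rho g) rhoKV. Qed.

Lemma sum_weight_sdominant : sdominant (\sum_j om j).
Proof.
move=> i; rewrite dot_suml (bigD1 i) //= dual eqxx big1 ?addr0 // => j ji.
by rewrite dual eq_sym (negPf ji).
Qed.

Lemma sdominantW w : sdominant w -> dominant w.
Proof. by move=> wd i; exact: ltW. Qed.

(** * Faces of the permutahedron and of its polar dual *)

Section Permutahedron.
Variable w : 'rV[R]_k.
Hypothesis wd : sdominant w.

Let Q := permutahedron rho w.

Lemma face_vertex p g : sdominant p -> face Q (p *m rho g) = [set w *m rho g].
Proof.
move=> pd; rewrite /Q /permutahedron face_hull.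
suff -> : maximizers (orbit_pt rho w) (p *m rho g) = [set w *m rho g] by exact: hull1.
apply/seteqP; split => [x [/orbit_ptP[h ->] H]|_ ->]; last first.
  split=> [|y /orbit_ptP[h ->]]; first by apply/orbit_ptP; exists g.
  rewrite !dot_rhoV mulgV rho1 mulmx1.
  by apply: dot_orbit_le; apply: sdominantW.
have := H _ (proj2 (orbit_ptP _ _) (ex_intro _ g erefl)).
rewrite !dot_rhoV mulgV rho1 mulmx1 => le1 /=.
have [hg|hg] := eqVneq (h * g^-1)%g 1%g.
  by move/eqP: hg; rewrite -eq_mulgV1 => /eqP ->.
by have := dot_orbit_strict pd wd hg; rewrite ltNge le1.
Qed.

Lemma vertices_permutahedron : vertices Q = orbit_pt rho w.
Proof.
apply/seteqP; split => [x [c cx]|x /orbit_ptP[g ->]]; last first.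
  by exists ((\sum_j om j) *m rho g); exact: face_vertex sum_weight_sdominant.
rewrite /Q /permutahedron face_hull in cx.
have : hull (maximizers (orbit_pt rho w) c) x by rewrite cx.
case=> N [a [v [a0 a1 Av xE]]].
case: N a v a0 a1 Av xE => [|N] a v _ a1 Av _.
  by move: a1; rewrite big_ord0 => /esym/eqP; rewrite oner_eq0.
have := sub_hull (Av ord0); rewrite cx /= => <-.
by have [] := Av ord0.
Qed.

Lemma wall_neq j : w *m rho (s j) <> w.
Proof.
rewrite rho_s /reflection => /eqP; rewrite -subr_eq0 addrAC subrr add0r oppr_eq0
    scaler_eq0.
by rewrite (negPf (n_neq0 j)) orbF mulf_eq0 pnatr_eq0 /= gt_eqF.
Qed.

Lemma face_edge g j : face Q ((\sum_(i | i != j) om i) *m rho g) =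
  hull [set w *m rho g; w *m rho (s j * g)%g].
Proof.
(* A point in the relative interior of wall j of the chamber. *)
set c := \sum_(i | i != j) om i.
have cj : dot c (n j) = 0.
  by rewrite dot_suml big1 // => i ij; rewrite dual eq_sym (negPf ij).
have ci i : i != j -> 0 < dot c (n i).
  move=> ij; rewrite dot_suml (bigD1 i) //= dual eqxx big1 ?addr0 // => l /andP[_ li].
  by rewrite dual eq_sym (negPf li).
have cd : dominant c by move=> i; have [->|/ci/ltW //] := eqVneq i j; rewrite cj.
rewrite /Q /permutahedron face_hull; congr hull.
have cs : dot c (w *m rho (s j)) = dot c w.
  by rewrite rho_s /reflection dotBr dotZr cj mulr0 subr0.
apply/seteqP; split => [x [/orbit_ptP[h ->] H]|x xE]; last first.
  have xg : exists2 h, x = w *m rho h & dot (c *m rho g) x = dot c w.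
    case: xE => ->; first by exists g; rewrite // dot_rhoV mulgV rho1 mulmx1.
    by exists (s j * g)%g; rewrite // dot_rhoV mulgK.
  have [h xh xc] := xg; split=> [|y /orbit_ptP[h' ->]]; first by apply/orbit_ptP;
      exists h.
  by rewrite xc dot_rhoV; apply: dot_orbit_le => //; exact: sdominantW.
have := H _ (proj2 (orbit_ptP _ _) (ex_intro _ g erefl)).
rewrite !dot_rhoV mulgV rho1 mulmx1 => le1.
have E : dot c (w *m rho (h * g^-1)%g) = dot c w.
  by apply/eqP; rewrite eq_le le1 andbT; apply: dot_orbit_le => //; exact: sdominantW.
case: (dot_orbit_wall cd ci wd E) => hg; [left|right] => /=.
  by move/eqP: hg; rewrite -eq_mulgV1 => /eqP ->.
by rewrite -hg mulgKV.
Qed.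

Lemma is_edgeP x y : is_edge Q x y <->
  exists g j, x = w *m rho g /\ y = w *m rho (s j * g)%g.
Proof.
split=> [[xy [c cE]]|[g [j [-> ->]]]]; last first.
  split; last by exists ((\sum_(i | i != j) om i) *m rho g); exact: face_edge.
  move=> E; apply: (@wall_neq j).
  by rewrite -[RHS](rhoVK g) E rhoM mulmxA rhoVK.
rewrite /Q /permutahedron face_hull in cE.
have [/orbit_ptP[g xg] xmax] := hull_segment_end cE xy.
have [/orbit_ptP[h yh] ymax] : maximizers (orbit_pt rho w) c y.
  by apply: (@hull_segment_end _ _ _ y x); [rewrite setUC|exact/nesym].
(* Moving by g^-1 takes the end [x] to w. As w then maximises [c'] over the orbit, comparison with
   the points w s_i shows that [c'] is dominant. *)
pose c' := c *m rho (g^-1)%g.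
have c'E u : dot c' (w *m rho u) = dot c (w *m rho (u * g)%g).
  by rewrite /c' dot_rhoV invgK.
have cx : dot c x = dot c' w by rewrite -[w in RHS]mulmx1 -rho1 c'E mul1g xg.
have cle u : dot c' (w *m rho u) <= dot c' w.
  by rewrite c'E -cx; apply: xmax; apply/orbit_ptP; exists (u * g)%g.
have c's i : dot c' (w *m rho (s i)) = dot c' w - 2 * dot w (n i) * dot c' (n i).
  by rewrite rho_s /reflection dotBr dotZr.
have wi i : 0 < 2 * dot w (n i) by rewrite mulr_gt0.
have c'd : dominant c'.
  move=> i; have := cle (s i); rewrite c's lerBlDr lerDl => H.
  by rewrite -(pmulr_rge0 _ (wi i)).
(* If [c'] lay on two walls, the face would contain w, w s_i and w s_j after the move, which are not
   collinear since n_i and n_j are independent. *)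
have two i j : i != j -> dot c' (n i) = 0 -> dot c' (n j) = 0 -> False.
  move=> ij ci cj.
  have seg l : dot c' (n l) = 0 -> exists t, - (2 * dot w (n l))
      *: n l = t *: ((y - x) *m rho (g^-1)%g).
    move=> cl; have : hull [set x; y] (w *m rho (s l * g)%g).
      rewrite -cE; apply: sub_hull; split; first by apply/orbit_ptP; exists (s l * g)%g.
      by move=> z zo; rewrite -c'E c's cl mulr0 subr0 -cx; exact: xmax.
    case/hull2 => t _ E; exists t.
    have := congr1 (mulmx^~ (rho (g^-1)%g)) E; rewrite xg rhoM mulmxA rhoVK mulmxDl
        rhoVK -scalemxAl rho_s.
    by rewrite /reflection => /addrI <-; rewrite scaleNr.
  have [t Et] := seg i ci; have [t' Et'] := seg j cj.
  have E : (t' * - (2 * dot w (n i))) *: n i = (t * - (2 * dot w (n j))) *: n j.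
    by rewrite -!scalerA Et Et' !scalerA mulrC.
  have t0 : t != 0.
    apply/eqP => t0; move/eqP: Et; rewrite t0 scale0r scaler_eq0 oppr_eq0 (negPf
        (n_neq0 i)) orbF.
    by rewrite gt_eqF.
  have := congr1 (dot (om j)) E; rewrite !dotZr !dual (negPf ij)
      eqxx mulr0 mulr1 => /esym/eqP.
  by rewrite mulf_eq0 (negPf t0) oppr_eq0 gt_eqF.
have [j cj] : exists j, forall i, i != j -> 0 < dot c' (n i).
  have [[j cj]|nz] := pselect (exists j, dot c' (n j) = 0).
    exists j => i ij; rewrite lt_neqAle c'd andbT eq_sym; apply/eqP => ci.
    exact: (two i j).
  have [i0 _] : exists i0 : 'I_k, True.
    have : y - x != 0 by rewrite subr_eq0; apply/eqP => yx; exact/xy/esym.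
    by move/rV0Pn => [i _]; exists i.
  exists i0 => i _; rewrite lt_neqAle c'd andbT eq_sym; apply/eqP => ci.
  by apply: nz; exists i.
have ch : dot c' (w *m rho (h * g^-1)%g) = dot c' w.
  rewrite c'E mulgKV -yh -cx; apply/eqP; rewrite eq_le ymax; last by apply/orbit_ptP;
      exists g.
  by rewrite xmax //; apply/orbit_ptP; exists h.
exists g, j; split=> //; rewrite yh.
case: (dot_orbit_wall c'd cj wd ch) => E; last by rewrite -E mulgKV.
by case: xy; rewrite xg yh; move/eqP: E; rewrite -eq_mulgV1 => /eqP ->.
Qed.

Lemma edge_length g j : enorm (w *m rho g - w *m rho (s j * g)%g) = 2 * dot w (n j).
Proof.
have -> : w *m rho g - w *m rho (s j * g)%g = (2 * dot w (n j)) *: (n j *m rho g).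
  by rewrite rhoM mulmxA rho_s /reflection mulmxBl -scalemxAl opprB addrC subrK.
by rewrite enormZ /enorm dot_rho n1 sqrtr1 mulr1 ger0_norm // mulr_ge0 // ltW.
Qed.

Hypothesis w1 : dot w w = 1.
Hypothesis hk : (2 <= k)%N.

Lemma w_neq0 : w != 0.
Proof. by rewrite -dot_eq0 w1 oner_eq0. Qed.

Lemma enorm_orbit g : enorm (w *m rho g) = 1.
Proof. by rewrite /enorm dot_rho w1 sqrtr1. Qed.

Lemma weight_gt0 j : 0 < dot (om j) w.
Proof.
exact: (dominant_pos mii m2 hirr dual nn (sdominantW wd) w_neq0).
Qed.

Lemma other_index (j : 'I_k) : exists i : 'I_k, i != j.
Proof.
have [j0|j0] := eqVneq (j : nat) 0%N.
  by exists (Ordinal hk); rewrite -val_eqE /= j0.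
have k0 : (0 < k)%N by exact: ltnW hk.
by exists (Ordinal k0); rewrite -val_eqE /= eq_sym.
Qed.

Lemma dot_root_lt1 j : dot w (n j) ^+ 2 < 1.
Proof.
rewrite ltNge; apply/negP => h1; have [i ij] := other_index j.
have : w - dot w (n j) *: n j = 0.
  apply/eqP; rewrite -dot_eq0 eq_le dot_ge0 andbT.
  by rewrite dotBl !dotBr !dotZl !dotZr n1 w1 (dotC (n j)); move: h1; lra.
move/eqP; rewrite subr_eq0 => /eqP wE.
have := wd i; rewrite wE dotZl ltNge; case/negP.
by rewrite mulr_ge0_le0 ?(ltW (wd j)) // (obtuse m2 nn) // eq_sym.
Qed.

Lemma polar_dualE p : polar_dual Q p <-> forall g, dot p (w *m rho g) <= 1.
Proof.
rewrite /polar_dual /= vertices_permutahedron; split=> [H g|H x /orbit_ptP[g ->] //].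
by apply: H; apply/orbit_ptP; exists g.
Qed.

(** The maximum is 1 and is attained at [w *m rho g] itself: the orbit consists of unit vectors, so
    by Cauchy-Schwarz it lies in the polar dual. *)
Lemma face_polar g p : face (polar_dual Q) (w *m rho g) p <->
  polar_dual Q p /\ dot p (w *m rho g) = 1.
Proof.
split=> [[pP pmax]|[pP p1]]; last first.
  split=> // y /polar_dualE/(_ g); rewrite dotC => yP.
  by rewrite [X in _ <= X]dotC p1.
split=> //; have /polar_dualE/(_ g) := pP; rewrite le_eqVlt => /orP[/eqP //|].
rewrite ltNge => /negP[]; rewrite dotC.
suff : polar_dual Q (w *m rho g) by move/pmax; rewrite dot_rho w1.
apply/polar_dualE => h; apply: le_trans (ler_norm _) _.
by apply: le_trans (cauchy_schwarz _ _) _; rewrite !enorm_orbit mulr1.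
Qed.

(** After moving by g^-1, the polar inequalities at the points w s_i say exactly that p is dominant,
    given <p, w> = 1. Conversely these few inequalities imply all the others by [dot_orbit_le]. *)
Lemma ridge_slice g j : ridge Q (w *m rho g) (w *m rho (s j * g)%g) =
  [set p *m rho g | p in chamber_slice n w j].
Proof.
have refl p i : dot p (w *m rho (s i)) = dot p w - 2 * dot w (n i) * dot p (n i).
  by rewrite rho_s /reflection dotBr dotZr.
have wi i : 0 < 2 * dot w (n i) by rewrite mulr_gt0.
apply/seteqP; split => [p [/face_polar[/polar_dualE pP pg] /face_polar[_ psg]]|_ [p
    [pd pj pw] <-]].
  exists (p *m rho (g^-1)%g); last exact: rhoKV.
  have E u : dot (p *m rho (g^-1)%g) (w *m rho u) = dot p (w *m rho (u * g)%g).
    by rewrite dot_rhoV invgK.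
  have pw : dot (p *m rho (g^-1)%g) w = 1 by rewrite -[w]mulmx1 -rho1 E mul1g.
  split=> //.
    move=> i; have := pP (s i * g)%g; rewrite -E refl pw lerBlDr lerDl => H.
    by rewrite -(pmulr_rge0 _ (wi i)).
  have := psg; rewrite -E refl pw => /eqP; rewrite subr_eq addrC -subr_eq subrr
      eq_sym mulf_eq0.
  by rewrite gt_eqF //= => /eqP.
have pP : polar_dual Q (p *m rho g).
  apply/polar_dualE => h; rewrite dot_rhoV -pw.
  by apply: dot_orbit_le => //; exact: sdominantW.
split; apply/face_polar; split=> //; first by rewrite dot_rho.
by rewrite dot_rhoV mulgK refl pj mulr0 subr0.
Qed.

Lemma sin_dihedral g j : sin (dihedral_angle (w *m rho g) (w *m rho (s j * g)%g)) =
  2 * dot w (n j) * Num.sqrt (1 - dot w (n j) ^+ 2).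
Proof.
rewrite /dihedral_angle !enorm_orbit mulr1 divr1.
have -> : dot (w *m rho g) (w *m rho (s j * g)%g) = 1 - 2 * dot w (n j) ^+ 2.
  by rewrite dot_rhoV mulgK rho_s /reflection dotBr dotZr w1; ring.
have h0 := ltW (wd j); have h1 := ltW (dot_root_lt1 j); set h := dot w (n j) in h0 h1 *.
have hh : 0 <= h ^+ 2 by exact: sqr_ge0.
rewrite sinB sinpi cospi mul0r sub0r mulN1r opprK sin_acos; last by apply/andP; lra.
have -> : 1 - (1 - 2 * h ^+ 2) ^+ 2 = (2 * h) ^+ 2 * (1 - h ^+ 2) by ring.
by rewrite sqrtrM ?sqr_ge0 // sqrtr_sqr ger0_norm // mulr_ge0.
Qed.

(** The b_j of the overview. *)
Definition weight_ratio j : R := dot (om j) w / dot w (n j).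

Lemma weight_ratio_gt0 j : 0 < weight_ratio j.
Proof. by rewrite divr_gt0 ?weight_gt0. Qed.

Lemma edge_weight : exists2 c : R, 0 < c & forall g j,
  vol (k - 2) (ridge Q (w *m rho g) (w *m rho (s j * g)%g))
  / (enorm (w *m rho g) * enorm (w *m rho (s j * g)%g)
     * sin (dihedral_angle (w *m rho g) (w *m rho (s j * g)%g))) = c * weight_ratio j.
Proof.
have [K K0 HK] := vol_chamber_slice_prop hk dual n1 w1 weight_gt0 dot_root_lt1.
exists (K / 2) => [|g j]; first by rewrite divr_gt0.
rewrite ridge_slice HK ?rho_orth // sin_dihedral !enorm_orbit !mul1r /weight_ratio.
have r0 : Num.sqrt (1 - dot w (n j) ^+ 2) != 0.
  by rewrite gt_eqF // sqrtr_gt0 subr_gt0 dot_root_lt1.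
move: (Num.sqrt _) r0 => r r0; have h0 := lt0r_neq0 (wd j);
    move: (dot w (n j)) h0 => h h0.
by field; rewrite h0 r0.
Qed.

Lemma finite_orbit : finite_set (vertices Q).
Proof. by rewrite vertices_permutahedron; apply: finite_image;
    exact: finite_finset. Qed.

Lemma mem_orbit_fset x : (x \in fset_set (vertices Q)) = (x \in orbit_pt rho w).
Proof. by rewrite in_fset_set ?vertices_permutahedron // -vertices_permutahedron;
    exact: finite_orbit. Qed.

Lemma vert_ex (a : 'I_(nvert Q)) : exists g, vert a = w *m rho g.
Proof.
apply/orbit_ptP; apply/set_mem; rewrite -mem_orbit_fset /vert.
by apply: mem_nth.
Qed.

Lemma vert_elt_ex : exists G : 'I_(nvert Q) -> gT, forall a, vert a = w *m rho (G a).
Proof. by have /choice[G label_vert] := vert_ex; exists G. Qed.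

Lemma vert_inj : injective (@vert _ _ Q).
Proof.
move=> a b /eqP; rewrite /vert nth_uniq ?fset_uniq ?ltn_ord // => /eqP ab.
exact: val_inj.
Qed.

Lemma vert_surj g : exists a : 'I_(nvert Q), vert a = w *m rho g.
Proof.
have H : w *m rho g \in fset_set (vertices Q).
  by rewrite mem_orbit_fset inE; apply/orbit_ptP; exists g.
have ia : (index (w *m rho g) (fset_set (vertices Q) : seq 'rV[R]_k) < nvert Q)%N.
  by rewrite index_mem.
by exists (Ordinal ia); rewrite /vert nth_index.
Qed.

(** * The random walk matrix on group elements *)

Section Labelled.
Variable G : 'I_(nvert Q) -> gT.
Hypothesis label_vert : forall a, vert a = w *m rho (G a).
Variable E : gT -> 'I_(nvert Q).
Hypothesis vert_label : forall g, vert (E g) = w *m rho g.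

Lemma vert_labelK : cancel G E.
Proof. by move=> a; apply: vert_inj; rewrite vert_label label_vert. Qed.

Lemma label_vertK : cancel E G.
Proof. by move=> g; apply: (orbit_inj wd); rewrite -label_vert vert_label. Qed.

Lemma label_eq a g : (G a == g) = (a == E g).
Proof. by apply/eqP/eqP => [<-|->]; rewrite ?vert_labelK ?label_vertK. Qed.

(** Edges join [w *m rho g] to [w *m rho (s j * g)], so adjacency is left multiplication, whereas
    the symmetries of the polytope multiply on the right. The action on row vectors reverses
    products. *)
Definition left_translation (g : gT) : 'M[R]_(nvert Q) :=
    \matrix_(a, b) (G b == (g * G a)%g)%:R.

Lemma row_mul_left_translation (x : 'rV[R]_(nvert Q)) g b : (x *m left_translation g)
    0 b = x 0 (E (g^-1 * G b)%g).
Proof.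
rewrite mxE (bigD1 (E (g^-1 * G b)%g)) //= mxE label_vertK mulKVg eqxx mulr1 big1
    ?addr0 // => a ab.
rewrite mxE; case: eqP => [Gb|]; last by rewrite mulr0.
by rewrite Gb mulKg vert_labelK eqxx in ab.
Qed.

Lemma left_translationM g h : left_translation g *m left_translation h =
    left_translation (h * g)%g.
Proof.
apply/row_matrixP => a; apply/rowP => b; rewrite row_mul row_mul_left_translation
    !mxE label_vertK.
by rewrite -[RHS](_ : (h^-1 * G b == g * G a)%g%:R = _) // (can2_eq (mulKVg h)
    (mulKg h)) mulgA.
Qed.

Lemma left_translation1 : left_translation 1%g = 1%:M.
Proof. by apply/matrixP => a b; rewrite !mxE mul1g (inj_eq (can_inj vert_labelK))
    eq_sym. Qed.

Lemma left_translationX g q : left_translation g ^+ q = left_translation (g ^+ q)%g.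
Proof.
elim: q => [|q IH]; first by rewrite expr0 expg0 left_translation1.
by rewrite exprS IH expgSr; exact: left_translationM.
Qed.

Lemma left_translation_tr j : (left_translation (s j))^T = left_translation (s j).
Proof.
apply/matrixP => a b; rewrite !mxE; congr (nat_of_bool _)%:R.
by apply/eqP/eqP => ->; rewrite mulgA ss mul1g.
Qed.

Lemma simple_inj : injective s.
Proof.
move=> i j sij; apply/eqP/negPn/negP => ij.
have := rho_s i w; rewrite sij rho_s /reflection => /addrI/oppr_inj E2.
have := congr1 (dot (om i)) E2; rewrite !dotZr !dual eqxx eq_sym (negPf ij) mulr0 mulr1.
by move/eqP; rewrite eq_sym mulf_eq0 pnatr_eq0 /= gt_eqF.
Qed.

Lemma simple_neq1 j : s j != 1%g.
Proof. by apply/eqP => sj; apply: (@wall_neq j); rewrite sj rho1 mulmx1. Qed.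

Lemma offdiagE : exists2 c : R, 0 < c & forall a b, a != b ->
  izmestiev_offdiag a b = - (c * \sum_j weight_ratio j * left_translation (s j) a b).
Proof.
have [c c0 Hc] := edge_weight; exists c => // a b ab; rewrite /izmestiev_offdiag.
case: asboolP => [/is_edgeP[g [j [ag bg]]]|ne]; last first.
  rewrite big1 ?mulr0 ?oppr0 // => j _; rewrite mxE; case: eqP => [Gb|];
      last by rewrite mulr0.
  case: ne; apply/is_edgeP; exists (G a), j; split; first exact: label_vert.
  by rewrite label_vert Gb.
have Ga : G a = g by apply: (orbit_inj wd); rewrite -label_vert.
have Gb : G b = (s j * g)%g by apply: (orbit_inj wd); rewrite -label_vert.
rewrite ag bg Hc; congr (- (_ * _)); rewrite (bigD1 j) //= mxE Gb Ga eqxx mulr1 big1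
    ?addr0 // => i ij.
rewrite mxE Gb Ga (inj_eq (mulIg g)) (inj_eq simple_inj) eq_sym (negPf ij) mulr0 //.
Qed.

Definition weight_ratio_sum : R := \sum_j weight_ratio j.

Lemma k_gt0 : (0 < k)%N. Proof. exact: ltnW hk. Qed.

Lemma weight_ratio_sum_gt0 : 0 < weight_ratio_sum.
Proof.
rewrite /weight_ratio_sum (bigD1 (Ordinal k_gt0)) //= ltr_pwDl ?weight_ratio_gt0 //
    sumr_ge0 // => j _.
exact/ltW/weight_ratio_gt0.
Qed.

(* The relation M_ss w_s = - sum_(t != s) M_st w_t, up to a common factor. *)
Lemma weighted_reflections : \sum_j weight_ratio j *: (w *m rho (s j))
    = (weight_ratio_sum - 2) *: w.
Proof.
have H j : weight_ratio j *: (w *m rho (s j)) = weight_ratio j *: w - 2 *: (dot (om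
    j) w *: n j).
  rewrite rho_s /reflection scalerBr !scalerA; congr (_ - _ *: _).
  by rewrite /weight_ratio; field; rewrite gt_eqF.
under eq_bigr do rewrite H.
by rewrite sumrB -scaler_suml -scaler_sumr -(expand_root dual w) scalerBl.
Qed.

Lemma sum_left_translation (V : lmodType R) (f : 'I_(nvert Q) -> V) g a :
  \sum_b left_translation g a b *: f b = f (E (g * G a)%g).
Proof.
rewrite (bigD1 (E (g * G a)%g)) //= mxE label_vertK eqxx scale1r big1 ?addr0 // => b ba.
by rewrite mxE label_eq (negPf ba) scale0r.
Qed.

Lemma left_translation_diag j a : left_translation (s j) a a = 0.
Proof.
rewrite mxE; case: eqP => // Ga; have := simple_neq1 j.
by rewrite -(inj_eq (mulIg (G a))) mul1g -Ga eqxx.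
Qed.

Lemma izmestiev_matrixE : exists2 c : R, 0 < c &
  izmestiev_matrix Q = (c * (weight_ratio_sum - 2))%:M - c *: \sum_j weight_ratio j
      *: left_translation (s j).
Proof.
have [c c0 Hc] := offdiagE; exists c => //.
have sumE a b : (c *: \sum_j weight_ratio j *: left_translation (s j))
    a b = c * \sum_j weight_ratio j * left_translation (s j) a b.
  by rewrite mxE summxE; congr (_ * _); apply: eq_bigr => j _; rewrite mxE.
have sumD a : c * \sum_j weight_ratio j * left_translation (s j) a a = 0.
  by rewrite big1 ?mulr0 // => j _; rewrite left_translation_diag mulr0.
have diag_sum (a : 'I_(nvert Q)) : - (\sum_(t | t != a)
    izmestiev_offdiag a t *: vert t) = (c * (weight_ratio_sum - 2)) *: vert a.
  rewrite (eq_bigr (fun t => - (c * \sum_j weight_ratio j * left_translation (s j)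
      a t) *: vert t)); last first.
    by move=> t ta; rewrite Hc // eq_sym.
  have -> : \sum_(t | t != a) - (c * \sum_j weight_ratio j * left_translation (s j)
      a t) *: vert t =
      \sum_t - (c * \sum_j weight_ratio j * left_translation (s j) a t) *: vert t.
    by rewrite [RHS](bigD1 a) //= sumD oppr0 scale0r add0r.
  under eq_bigr do rewrite scaleNr -scalerA scaler_suml.
  rewrite sumrN opprK -scaler_sumr exchange_big /= -scalerA; congr (_ *: _).
  rewrite label_vert scalemxAl -weighted_reflections mulmx_suml; apply: eq_bigr => j _.
  under eq_bigr do rewrite -scalerA.
  by rewrite -scaler_sumr sum_left_translation vert_label rhoM mulmxA scalemxAl.
apply/matrixP => a b; rewrite [LHS]mxE.
transitivity ((c * (weight_ratio_sum - 2)) *+ (a == b) - (c *: \sum_j weight_ratio j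
    *: left_translation (s j)) a b); last by rewrite !mxE.
rewrite sumE.
case: eqP => [<-|/eqP ab]; last by rewrite Hc // add0r.
(* Any two admissible coefficients agree because [vert a] is nonzero. *)
rewrite sumD subr0 mulr1n /izmestiev_diag; case: xgetP => [x _ /= xE|/(_ (c *
    (weight_ratio_sum - 2)))]; last first.
  by rewrite /= diag_sum.
apply/eqP; rewrite -subr_eq0; have /eqP : (x - c * (weight_ratio_sum - 2))
    *: vert a = 0.
  by rewrite scalerBl xE diag_sum subrr.
rewrite scaler_eq0 => /orP[//|/eqP v0].
by have := w_neq0; rewrite -[w](rhoVK (G a)) -label_vert v0 mul0mx eqxx.
Qed.

Lemma random_walk_matrixE :
  random_walk_matrix Q = \sum_j (weight_ratio j / weight_ratio_sum)
      *: left_translation (s j).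
Proof.
have [c c0 ME] := izmestiev_matrixE; rewrite /random_walk_matrix ME.
have w0 := lt0r_neq0 weight_ratio_sum_gt0; have c0' := lt0r_neq0 c0.
set M := _%:M - _.
have diagM (a : 'I_(nvert Q)) : M a a = c * (weight_ratio_sum - 2).
  rewrite /M !mxE eqxx mulr1n summxE big1 ?mulr0 ?subr0 // => j _.
  by rewrite mxE left_translation_diag mulr0.
have rowM (a : 'I_(nvert Q)) : \sum_t M a t = c * (weight_ratio_sum - 2)
    - c * weight_ratio_sum.
  under eq_bigr do rewrite mxE.
  rewrite big_split /=; congr (_ + _).
    by rewrite (bigD1 a) //= mxE eqxx mulr1n big1 ?addr0 // => t ta;
        rewrite mxE eq_sym (negPf ta).
  under eq_bigr do rewrite mxE mxE summxE.
  rewrite sumrN -mulr_sumr exchange_big /=; congr (- (_ * _)); apply: eq_bigr => j _.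
  under eq_bigr do rewrite mxE.
  rewrite -mulr_sumr -[RHS]mulr1; congr (_ * _).
  have := @sum_left_translation R^o (fun=> 1) (s j) a; rewrite /=.
  by under eq_bigr do rewrite -[_ *: _]/(_ * _) mulr1.
have -> : common_diag M = c * (weight_ratio_sum - 2).
  rewrite /common_diag; case: xgetP => [x _ /= xE|/(_ (c * (weight_ratio_sum - 2)))];
      last by case.
  by rewrite -(xE (E 1%g)) diagM.
have -> : common_row_sum M = c * (weight_ratio_sum - 2) - c * weight_ratio_sum.
  rewrite /common_row_sum; case: xgetP => [x _ /= xE|/(_ (c * (weight_ratio_sum - 2)
      - c * weight_ratio_sum))]; last by case.
  by rewrite -(xE (E 1%g)) rowM.
(* Here gamma - delta is [c * weight_ratio_sum], and the unknown scale [c] cancels. *)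
rewrite /M opprB addrC subrK opprB addrC subrK scalerA.
have -> : (c * weight_ratio_sum)^-1 * c = weight_ratio_sum^-1 by field; rewrite w0 c0'.
by rewrite scaler_sumr; apply: eq_bigr => j _; rewrite scalerA mulrC.
Qed.

Lemma lambda1_labelled : lambda1 rho w = 1 - 2 / weight_ratio_sum.
Proof.
rewrite /lambda1 -/Q random_walk_matrixE.
have w0 := lt0r_neq0 weight_ratio_sum_gt0.
pose mu j := weight_ratio j / weight_ratio_sum.
have mu0 j : 0 < mu j by rewrite divr_gt0 ?weight_ratio_gt0 ?weight_ratio_sum_gt0.
have mu1 : \sum_j mu j = 1 by rewrite -mulr_suml mulfV.
have mulA (x : 'rV[R]_(nvert Q)) : x *m (\sum_j mu j *: left_translation (s j))
    = \sum_j mu j *: (x *m left_translation (s j)).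
  by rewrite mulmx_sumr; apply: eq_bigr => j _; rewrite -scalemxAr.
(* Following a word for the label of [b] shows that such a vector takes at every vertex the value
   that it has at the identity. *)
have fixed_const (x : 'rV[R]_(nvert Q)) : (forall i, x *m left_translation (s i) = x)
    -> x = x 0 (E 1%g) *: const_mx 1.
  move=> xs; apply/rowP => b; rewrite !mxE mulr1 -(vert_labelK b).
  have [t _ <-] := lenP gen (G b); elim: t => [|i t IH]; first by rewrite big_nil.
  by rewrite big_cons -IH -{1}(xs i) row_mul_left_translation label_vertK mulKg.
have gap (x : 'rV[R]_(nvert Q)) tau : x *m (\sum_j mu j *: left_translation (s j))
    = tau *: x ->
    (forall i, x *m left_translation (s i) = x) \/ weight_ratio_sum^-1 <= (1 - tau) / 2.
  rewrite mulA; apply: (@spectral_gap R k _ m _ _ _ m2 _ (schlafli n)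
      mu (fun j => dot w (n j))).
  - by move=> i; exact: left_translation_tr.
  - by move=> i; rewrite left_translationM ss left_translation1.
  - move=> i j ij; rewrite left_translationM left_translationX;
      have := rel_m i j => rij.
    have -> : ((s j * s i) ^+ m i j = ((s i * s j) ^+ m i j)^-1)%g.
      by rewrite -expgVn invMg !simple_inv.
    by rewrite rij invg1 left_translation1.
  - by move=> i; rewrite mxE n1.
  - by move=> i j ij; rewrite mxE nn.
  - by move=> i j; rewrite !mxE dotC.
  - exact: mu0.
  - exact: wd.
  (* The ground state equation: mu_j <w, n_j> is <om_j, w> up to the factor [weight_ratio_sum^-1],
     so this is the expansion of w in simple roots, paired with n_i. *)
  - move=> i; rewrite (dotC w) {2}(expand_root dual w) dot_sumr mulr_sumr;
      apply: eq_bigr => j _.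
    rewrite mxE dotZr /mu /weight_ratio; field.
    by rewrite w0 gt_eqF.
  - exact: mu1.
have lt1 : 1 - 2 / weight_ratio_sum < 1 by rewrite ltrBlDr ltrDl divr_gt0
    ?weight_ratio_sum_gt0.
(* The second eigenvector is a coordinate function on the vertices; an index with [w 0 i != 0] makes
   it nonzero at the identity. *)
have [i wi] : exists i, w 0 i != 0 by apply/rV0Pn; exact: w_neq0.
apply: (@second_eigenvalueE _ _ _ (const_mx 1) (\row_b (w *m rho (G b)) 0 i)).
- rewrite linear_sum /=; apply: eq_bigr => j _; by rewrite linearZ /=
    left_translation_tr.
- by apply/eqP => /rowP/(_ (E 1%g))/eqP; rewrite !mxE oner_eq0.
- rewrite mulA -[RHS]scale1r -mu1 scaler_suml; apply: eq_bigr => j _; congr (_ *: _).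
  by apply/rowP => b; rewrite row_mul_left_translation !mxE.
- move=> x xA; have [xs|c0] := gap x 1 (etrans xA (esym (scale1r x))).
    by exists (x 0 (E 1%g)); exact: fixed_const.
  by move: c0; rewrite subrr mul0r leNgt invr_gt0 weight_ratio_sum_gt0.
- apply/eqP => /rowP/(_ (E 1%g)); rewrite mxE label_vertK rho1 mulmx1 [RHS]mxE => /eqP.
  by rewrite (negPf wi).
- rewrite mulA; apply/rowP => b; rewrite summxE mxE [in RHS]mxE.
  transitivity (((\sum_j mu j *: (w *m rho (s j))) *m rho (G b)) 0 i).
    rewrite mulmx_suml summxE; apply: eq_bigr => j _.
    rewrite -scalemxAl [LHS]mxE [RHS]mxE row_mul_left_translation; congr (_ * _).
    by rewrite mxE label_vertK simple_inv // rhoM mulmxA.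
  have -> : \sum_j mu j *: (w *m rho (s j)) = (1 - 2 / weight_ratio_sum) *: w.
    under eq_bigr do rewrite /mu mulrC -scalerA.
    by rewrite -scaler_sumr weighted_reflections scalerA mulrBr mulVf // mulrC.
  by rewrite -scalemxAl mxE.
- exact: lt1.
- move=> x tau x0 xA; have [xs|c0] := gap x tau xA; [left|right].
    move: xA; rewrite mulA; under eq_bigr do rewrite xs.
    rewrite -scaler_suml mu1 => /eqP; rewrite -subr_eq0 -scalerBl scaler_eq0 (negPf
        x0) orbF.
    by rewrite subr_eq0 => /eqP.
  by move: c0; rewrite ler_pdivlMr //; lra.
Qed.
End Labelled.

Lemma lambda1E : lambda1 rho w = 1 - 2 / \sum_j dot (om j) w / dot w (n j).
Proof.
have [G label_vert] := vert_elt_ex; have /choice[E vert_label] := vert_surj.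
by rewrite (lambda1_labelled label_vert vert_label).
Qed.
End Permutahedron.
End GeometricRepresentation.

(** * Minimisation *)

Section DualRoot.
Context {R : realType}.

Lemma filter_enum_lift k (j : 'I_k.+1) : [seq i <- enum 'I_k.+1 | i != j] =
    [seq lift j l | l <- enum 'I_k].
Proof.
apply: (inj_map val_inj); rewrite -map_comp.
apply: (@irr_sorted_eq _ ltn) => [|||| x].
- exact: ltn_trans.
- exact: ltnn.
- rewrite sorted_map; apply: (@sorted_filter _ (relpre val ltn));
    first by move=> a b c; exact: ltn_trans.
  by rewrite -sorted_map val_enum_ord iota_ltn_sorted.
- rewrite (map_comp (bump j) val) val_enum_ord sorted_map.
  apply: (@sub_sorted _ ltn); last exact: iota_ltn_sorted.
  by move=> a b /=; rewrite /bump; case: leqP; case: leqP => //=; lia.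
- apply/mapP/mapP => [[i]|[l _ ->]].
    rewrite mem_filter => /andP[ij _] ->.
    case: (unliftP j i) => [l ->|ii]; last by rewrite ii eqxx in ij.
    by exists l; rewrite ?mem_enum.
  exists (lift j l) => //; by rewrite mem_filter mem_enum eq_sym neq_lift.
Qed.

(** Up to the factor \det the dual roots form the dual basis: the pairing is the determinant with
    row j replaced by [n i], moved to the top at the cost of the sign (-1)^j that [dual_root]
    compensates. For i != j two rows coincide. *)
Lemma dot_dual_root k (n : 'I_k -> 'rV[R]_k) i j :
  dot (dual_root n j) (n i) = (i == j)%:R * \det (\matrix_l n l).
Proof.
case: k n i j => [n []//|k] n i j.
rewrite /dual_root dotZl dotC dot_cross filter_enum_lift -map_comp.
set us := [seq _ | _ <- _].
pose A : 'M[R]_k.+1 := \matrix_l (if l == j then n i else n l).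
have rowsE : rows (n i :: us) = row_perm (lift_perm ord0 j 1%g) A.
  apply/matrixP => a b; rewrite [LHS]mxE [RHS]mxE mxE.
  case: (unliftP ord0 a) => [l ->|->]; last by rewrite lift_perm_id eqxx.
  rewrite lift_perm_lift perm1 eq_sym (negPf (neq_lift _ _)) /=.
  by rewrite /us add0n (nth_map l) ?size_enum_ord //= nth_ord_enum.
rewrite rowsE row_permE det_mulmx det_perm odd_lift_perm odd_perm1 addbF addFb.
rewrite signr_odd mulrA -expr2 sqrr_sign mul1r /A.
have [->|ij] := eqVneq i j.
  by rewrite mul1r; congr (\det _); apply/row_matrixP => l; rewrite !rowK;
      case: eqP => [->|].
rewrite mul0r; apply: (@determinant_alternate _ _ _ i j) => // l.
by rewrite !mxE eqxx (negPf ij).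
Qed.
End DualRoot.

Section WeightSum.
Context {R : realType} {k : nat}.
Variables C : 'I_k -> 'I_k -> R.
Hypothesis C0 : forall i j, 0 < C i j.
Hypothesis CC : forall i j, C i j = C j i.

(** Symmetrising in i and j turns each pair into a_j/a_i + a_i/a_j - 2 = (a_i - a_j)^2 / (a_i
    a_j). *)
Lemma weight_sum_symm (a : 'I_k -> R) : (forall i, 0 < a i) ->
  2 * (\sum_i \sum_j C i j * a j / a i - \sum_i \sum_j C i j) =
  \sum_i \sum_j C i j * (a i - a j) ^+ 2 / (a i * a j).
Proof.
move=> a0; rewrite mulrBr mulr_natl mulr2n {2}exchange_big /= -big_split /=.
rewrite mulr_sumr -sumrB; apply: eq_bigr => i _.
rewrite -big_split mulr_sumr -sumrB; apply: eq_bigr => j _ /=.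
by rewrite (CC j i); field; rewrite !(gt_eqF (a0 _)).
Qed.

Lemma weight_sum_term_ge0 (a : 'I_k -> R) i j : (forall i, 0 < a i) ->
  0 <= C i j * (a i - a j) ^+ 2 / (a i * a j).
Proof.
by move=> a0; apply: divr_ge0; apply: mulr_ge0; rewrite ?sqr_ge0 //; exact: ltW.
Qed.

Lemma weight_sum_ge (a : 'I_k -> R) : (forall i, 0 < a i) ->
  \sum_i \sum_j C i j <= \sum_i \sum_j C i j * a j / a i.
Proof.
move=> a0; rewrite -subr_ge0 -(@pmulr_rge0 _ 2) // weight_sum_symm //.
by do 2 (apply: sumr_ge0 => ? _); exact: weight_sum_term_ge0.
Qed.

Lemma weight_sum_eq (a : 'I_k -> R) : (forall i, 0 < a i) ->
  \sum_i \sum_j C i j * a j / a i <= \sum_i \sum_j C i j -> forall i j, a i = a j.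
Proof.
move=> a0 le i j; have := weight_sum_symm a0.
have -> : \sum_i \sum_j C i j * a j / a i = \sum_i \sum_j C i j.
  by apply/eqP; rewrite eq_le le weight_sum_ge.
rewrite subrr mulr0 => /esym/eqP; rewrite psumr_eq0; last first.
  by move=> l _; apply: sumr_ge0 => ? _; exact: weight_sum_term_ge0.
move=> /allP/(_ i (mem_index_enum i)) /=; rewrite psumr_eq0; last first.
  by move=> l _; exact: weight_sum_term_ge0.
move=> /allP/(_ j (mem_index_enum j)) /=.
rewrite !mulf_eq0 invr_eq0 mulf_eq0 !(gt_eqF (a0 _)) (gt_eqF (C0 _ _)) /= !orbF.
by rewrite orbb subr_eq0 => /eqP.
Qed.
End WeightSum.

(** The explicit bound 1 / (1 + sum_i 1/f_i) covers the empty index type without a case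
    distinction. *)
Lemma pos_lower_bound (R : realType) (I : finType) (f : I -> R) : (forall i, 0 < f i) ->
  exists2 e, 0 < e & forall i, e <= f i.
Proof.
move=> f0; have S0 : 0 < 1 + \sum_i (f i)^-1.
  by rewrite ltr_pwDl // sumr_ge0 // => i _; rewrite invr_ge0 ltW.
exists (1 + \sum_i (f i)^-1)^-1 => [|i]; first by rewrite invr_gt0.
rewrite -[leRHS]invrK lef_pV2 ?posrE ?invr_gt0 //.
rewrite (bigD1 i) //= addrCA lerDl addr_ge0 // sumr_ge0 // => j _.
by rewrite invr_ge0 ltW.
Qed.

Lemma continuous_dotl (R : realType) k (v : 'rV[R]_k) : continuous (fun x : 'rV[R]_k
    => dot x v).
Proof.
rewrite (_ : (fun x => dot x v) = fun x => \sum_i x 0 i * v 0 i); last first.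
  by apply/funext => x; rewrite dotE.
apply: continuous_big => [|i _ x]; first exact: add_continuous.
have H : {for x, continuous (fun x : 'rV[R]_k => x 0 i)} by apply: coord_continuous.
exact: (@cvgMr_tmp R _ (nbhs x) _ _ _ _ H).
Qed.

Theorem theorem4p4 (R : realType) (k : nat) (hk : (2 <= k)%N)
    (m : 'I_k -> 'I_k -> nat) (hm : coxeter_matrix m)
    (hirr : coxeter_irreducible m)
    (gT : finGroupType) (s : 'I_k -> gT) (hpres : coxeter_presentation m s)
    (n : 'I_k -> 'rV[R]_k) (hn : simple_roots m n)
    (hdet : 0 < \det (\matrix_(i < k) n i))
    (rho : mx_representation R [set: gT]%G k)
    (hrho : geometric_realisation n s rho) :
  let p := dual_root n in
  let F0 := fundamental_domain n in
  let w0 := (enorm (\sum_j p j))^-1 *: \sum_j p j in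
  [/\ (* lambda_1 maps F0 to [-1, 1] *)
      forall w, F0 w -> -1 <= lambda1 rho w <= 1,
      (* lambda_1(w) -> 1 as w tends to the boundary of F0 in the sphere *)
      forall eps : R, 0 < eps -> exists2 delta : R, 0 < delta &
        forall w, F0 w ->
          (exists2 b, boundary_in sphere F0 b & enorm (w - b) < delta) ->
          `|lambda1 rho w - 1| < eps,
      (* w0 is the unique point of F0 where lambda_1 has a global minimum *)
      F0 w0 /\
      (forall w, F0 w ->
         (forall w', F0 w' -> lambda1 rho w <= lambda1 rho w') <-> w = w0),
      (* the coefficient vector of w0 is constant *)
      forall a : 'I_k -> R, w0 = \sum_j a j *: p j ->
        exists c : R, forall j, a j = c
    & (* Q_w0 is the unique equilateral permutahedron *)
      equilateral (permutahedron rho w0) /\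
      (forall w, F0 w -> equilateral (permutahedron rho w) -> w = w0)].
Proof.
move=> p F0 w0.
have [mii hm2] := hm; have [gen rel _] := hpres; have [n1' nn'] := hn;
    have [_ rho_s] := hrho.
have m2 i j : i != j -> (2 <= m i j)%N by move=> /hm2[].
have ss i : (s i * s i = 1)%g by have := rel i i; rewrite mii expg1.
have n1 i : dot (n i) (n i) = 1 by rewrite -enorm_sqr n1' expr1n.
have nn i j : i != j -> dot (n i) (n j) = - cos (pi / (m i j)%:R).
  by move=> ij; rewrite -nn' // mxE.
set D := \det _ in hdet; have D0 : D != 0 by rewrite gt_eqF.
pose om j := D^-1 *: p j.
have dual i j : dot (om j) (n i) = (i == j)%:R.
  by rewrite /om dotZl dot_dual_root mulrCA mulVf // mulr1.
have k0 : (0 < k)%N := ltnW hk.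
pose i0 := Ordinal k0.
(* The coefficient of [p j] in w is <w, n_j> / D, and D > 0; so F0 is the open chamber cut with the
   sphere. *)
have F0E w : F0 w <-> dot w w = 1 /\ sdominant n w.
  split=> [[w1 [a [a0 wE]]]|[w1 wd]].
    split; first exact: sphere_dot.
    move=> i; rewrite wE dot_suml (bigD1 i) //= big1 ?addr0 => [|j ji].
      by rewrite dotZl dot_dual_root eqxx mul1r mulr_gt0.
    by rewrite dotZl dot_dual_root eq_sym (negPf ji) mul0r mulr0.
  split; first by rewrite /sphere /= /enorm w1 sqrtr1.
  exists (fun j => dot w (n j) / D); split=> [j|]; first by rewrite divr_gt0.
  rewrite [LHS](expand_weight dual); apply: eq_bigr => j _.
  by rewrite /om scalerA dotC.
have om0 j : om j != 0.
  apply/eqP => omj; have /eqP := dual j j.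
  by rewrite omj dot0l eqxx eq_sym oner_eq0.
have omd j : dominant n (om j) by move=> i; rewrite dual ler0n.
pose C i j := dot (om i) (om j).
have C0 i j : 0 < C i j by exact: (dominant_pos mii m2 hirr dual nn (omd j) (om0 j)).
have CC i j : C i j = C j i by rewrite /C dotC.
pose S (a : 'I_k -> R) := \sum_i \sum_j C i j * a j / a i.
have lamE w : F0 w -> lambda1 rho w = 1 - 2 / S (fun j => dot w (n j)).
  move=> /F0E[w1 wd]; rewrite (lambda1E gen ss m2 rel dual n1 nn mii hirr rho_s wd w1
      hk).
  congr (1 - 2 / _); apply: eq_bigr => i _.
  rewrite {1}(expand_weight dual w) dot_sumr mulr_suml; apply: eq_bigr => j _.
  by rewrite dotZr (dotC (n j)) [_ * dot (om i) _]mulrC.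
(* One diagonal term suffices: 1 = <om_i, n_i>^2 <= |om_i|^2 = C_ii. This is what keeps 1 - 2 / S at
   or above -1. *)
have Sge1 a : (forall i, 0 < a i) -> 1 <= S a.
  move=> a0; apply: (@le_trans _ _ (C i0 i0)).
    have := cauchy_schwarz_sqr (om i0) (n i0).
    by rewrite dual eqxx expr1n n1 mulr1.
  rewrite /S (bigD1 i0) //= (bigD1 i0) //= mulfK ?gt_eqF // -addrA lerDl addr_ge0 //.
    by rewrite sumr_ge0 // => j _; rewrite divr_ge0 ?mulr_ge0 // ltW.
  by rewrite sumr_ge0 // => i _; rewrite sumr_ge0 // => j _;
      rewrite divr_ge0 ?mulr_ge0 // ltW.
have lam_le w w' : F0 w -> F0 w' ->
    (lambda1 rho w <= lambda1 rho w') = (S (fun j => dot w (n j))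
        <= S (fun j => dot w' (n j))).
  move=> Fw Fw'; rewrite !lamE // lerD2l lerN2 ler_pM2l // lef_pV2 // posrE.
    by apply: lt_le_trans ltr01 (Sge1 _ _) => i; have /F0E[_] := Fw'; exact.
  by apply: lt_le_trans ltr01 (Sge1 _ _) => i; have /F0E[_] := Fw; exact.
pose P := \sum_j p j.
have Pn i : dot P (n i) = D.
  rewrite dot_suml (bigD1 i) //= big1 ?addr0 => [|j ji].
    by rewrite dot_dual_root eqxx mul1r.
  by rewrite dot_dual_root eq_sym (negPf ji) mul0r.
have P0 : 0 < enorm P.
  by rewrite enorm_gt0; apply: contraTneq hdet => P0; rewrite -(Pn i0) P0 dot0l ltxx.
have w0n i : dot w0 (n i) = (enorm P)^-1 * D by rewrite /w0 dotZl Pn.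
have Fw0 : F0 w0.
  apply/F0E; split; last by move=> i; rewrite w0n mulr_gt0 // invr_gt0.
  rewrite /w0 dotZl dotZr -/P -enorm_sqr; by field; rewrite gt_eqF.
have const_w0 w : F0 w -> (forall i j, dot w (n i) = dot w (n j)) -> w = w0.
  move=> /F0E[w1 wd] wc; set c := dot w (n i0).
  have wE : w = (c / D) *: P.
    rewrite [LHS](expand_weight dual) scaler_sumr; apply: eq_bigr => j _.
    by rewrite /om scalerA dotC (wc j i0).
  have cD : 0 < c / D by rewrite divr_gt0 // wd.
  have : enorm w = 1 by rewrite /enorm w1 sqrtr1.
  rewrite {1}wE enormZ (gtr0_norm cD) => E; rewrite wE /w0 -/P; congr (_ *: _).
  by rewrite -[RHS]mul1r -E mulfK // gt_eqF.
have edgeE w : F0 w -> equilateral (permutahedron rho w) <->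
    (forall i j, dot w (n i) = dot w (n j)).
  move=> /F0E[w1 wd]; split=> [[l Hl] i j|H].
    have e a : 2 * dot w (n a) = l.
      rewrite -(edge_length gen n1 rho_s wd 1%g a); apply: Hl.
      by apply/(is_edgeP gen ss m2 rel dual n1 nn rho_s wd); exists 1%g, a.
    by apply: (@mulfI _ 2); rewrite ?e.
  exists (2 * dot w (n i0)) => x y /(is_edgeP gen ss m2 rel dual n1 nn rho_s wd)[g [j
      [-> ->]]].
  by rewrite (edge_length gen n1 rho_s wd) (H j i0).
have S0 : S (fun j => dot w0 (n j)) = \sum_i \sum_j C i j.
  apply: eq_bigr => i _; apply: eq_bigr => j _; rewrite !w0n mulfK //.
  by rewrite mulf_neq0 // invr_neq0 // gt_eqF.
split.
- move=> w Fw; rewrite lamE //; have /F0E[_ wd] := Fw.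
  have S1 := Sge1 _ wd; have Sp := lt_le_trans ltr01 S1.
  have le2 : 2 / S (fun j => dot w (n j)) <= 2 by rewrite ler_pdivrMr // ler_peMr.
  have ge0 : 0 <= 2 / S (fun j => dot w (n j)) by rewrite divr_ge0 // ltW.
  by apply/andP; lra.
- move=> eps eps0.
  have [nu nu0 nuC] : exists2 e, 0 < e & forall ij : 'I_k * 'I_k, e <= C ij.1 ij.2.
    by apply: pos_lower_bound => -[i j]; exact: C0.
  pose M := \sum_l enorm (om l).
  have M0 : 0 < M.
    by rewrite /M (bigD1 i0) //= ltr_pwDl ?enorm_gt0 // sumr_ge0 // => l _;
        exact: enorm_ge0.
  (* With a_j = <w, n_j> and A the sum of the a_l, row j alone gives S >= nu A / a_j >= nu / (M
     a_j); the distance 2 / S from 1 is below eps as soon as a_j < eps nu / (2 M). *)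
  exists (eps * (nu / M) / 2) => [|w Fw [b [[b1 _] bcl] wb]];
      first by rewrite !mulr_gt0 ?invr_gt0.
  have /F0E[w1 wd] := Fw.
  (* Otherwise a neighbourhood of [b] would satisfy all the strict inequalities, yet [b] is a limit
     of points of the sphere outside F0. *)
  have [j bj] : exists j, dot b (n j) <= 0.
    apply: contrapT => H; have bpos j : 0 < dot b (n j).
      by rewrite ltNge; apply/negP => bj; apply: H; exists j.
    have : nbhs b [set x | forall j, 0 < dot x (n j)].
      apply: (@filter_forall _ _ (fun j => [set x | 0 < dot x (n j)]) (nbhs b)) => j.
      apply: (@continuous_dotl R k (n j) b [set y | 0 < y]).
      exact: lt_nbhsr (bpos j).
    move/bcl => [x [[xS xF] xpos]]; apply: xF; apply/F0E; split=> //; exact: sphere_dot.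
  have wj : dot w (n j) < eps * (nu / M) / 2.
    apply: le_lt_trans wb.
    have : dot w (n j) <= dot (w - b) (n j) by rewrite dotBl lerBrDr gerDl.
    move=> /le_trans; apply; apply: le_trans (ler_norm _) _.
    by apply: le_trans (cauchy_schwarz _ _) _; rewrite n1' mulr1.
  pose A := \sum_l dot w (n l).
  (* Bound 1 = |w|^2 = sum_l a_l <om_l, w> termwise by Cauchy-Schwarz: the a_l cannot all be
     small. *)
  have A1 : 1 <= A * M.
    rewrite -w1 {1}(expand_weight dual w) dot_suml /A mulr_suml; apply: ler_sum => l _.
    rewrite dotZl dotC ler_wpM2l ?(ltW (wd l)) //.
    apply: le_trans (ler_norm _) _; apply: le_trans (cauchy_schwarz _ _) _.
    rewrite [enorm w]/enorm w1 sqrtr1 mulr1 /M (bigD1 l) //= lerDl sumr_ge0 // => *.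
    exact: enorm_ge0.
  have Sj : nu * A / dot w (n j) <= S (fun l => dot w (n l)).
    rewrite /S (bigD1 j) //= -[leLHS]addr0 lerD //; last first.
      by rewrite sumr_ge0 // => i _; rewrite sumr_ge0 // => l _;
          rewrite divr_ge0 ?mulr_ge0 // ltW.
    rewrite /A mulr_sumr mulr_suml; apply: ler_sum => l _.
    apply: ler_wpM2r; first by rewrite invr_ge0 ltW.
    by apply: ler_wpM2r (nuC (j, l)); exact/ltW/wd.
  have Sp : 0 < S (fun l => dot w (n l)) by apply: lt_le_trans ltr01 (Sge1 _ wd).
  rewrite lamE // addrAC subrr add0r normrN ger0_norm; last by rewrite divr_ge0 // ltW.
  rewrite ltr_pdivrMr // mulrC -ltr_pdivrMr //.
  apply: lt_le_trans Sj.
  rewrite ltr_pdivlMr //.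
  have nM : nu / M <= nu * A by rewrite ler_pdivrMr // -mulrA ler_peMr // ltW.
  apply: lt_le_trans nM; rewrite mulrC -ltr_pdivlMr ?divr_gt0 //.
  apply: lt_le_trans wj _; rewrite le_eqVlt; apply/orP; left; apply/eqP.
  by field; rewrite gt_eqF //= gt_eqF.
- split=> // w Fw; split=> [H|-> w' Fw'].
    apply: const_w0 => //; have /F0E[_ wd] := Fw.
    apply: (weight_sum_eq C0 CC wd); rewrite -S0 -[X in X <= _]/(S _) -lam_le //.
    exact: H.
  rewrite lam_le // S0; apply: weight_sum_ge => //.
  by have /F0E[_] := Fw'.
- move=> a w0E; exists (enorm P)^-1 => j.
  have := w0n j; rewrite w0E dot_suml (bigD1 j) //= big1 ?addr0 => [|i ij].
    by rewrite dotZl dot_dual_root eqxx mul1r => /(mulIf D0).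
  by rewrite dotZl dot_dual_root eq_sym (negPf ij) mul0r mulr0.
- split=> [|w Fw /edgeE H]; last by apply: const_w0 => //; exact: H.
  by apply/edgeE => // i j; rewrite !w0n.
Qed.
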